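(* Let $L$ be a Markov diffusion operator (with semigroup $(P_t)_{t\ge 0}$, invariant probability measure $\mu$, carré du champ $\Gamma$ and iterated carré du champ $\Gamma_2$) satisfying the curvature condition $\Gamma_2(f) \geq \rho\, \Gamma(f)$ for all $f \in \mathcal{A}$, for some $\rho >0$. Then, for all $f\in\mathcal{A}$, all $t>0$ and all $$\alpha > \frac{e^{2\rho t} + e^{-2\rho t} -2}{2\rho(e^{2\rho t}-1)},$$ the following inequality holds (pointwise on $\mathcal{X}$): $$ \log P_t (e^f) - P_t f \leq c_\alpha(t)\, \log P_{t} \left( e^{\alpha \Gamma (f)} \right), $$ where $$ c_\alpha(t)= \frac{\sqrt{1-e^{-2\rho t}}}{2\sqrt{2\rho \alpha}} \log \left( \frac{(e^{\rho t}a_t-1)(e^{\rho t}a_t+1+a_t^2-e^{-2\rho t})} {(e^{\rho t}a_t+1)(-e^{\rho t}a_t+1+a_t^2-e^{-2\rho t})} \right), \qquad a_t>0,\quad a_t^2 = 2\rho \alpha (e^{2\rho t}-1) $$ (for the exceptional value of $\alpha$ with $e^{\rho t}a_t=1$, where the fraction reads $0/0$, it is understood by continuity in $\alpha$). In particular, for any $\alpha > \frac{1}{2\rho}$ and any $f\in\mathcal{A}$ satisfying $\int f\,d\mu=0$, it holds $$ \int e^f d\mu \leq \left( \int e^{\alpha \Gamma(f)} d\mu \right)^{\frac{1}{2\sqrt{2\rho \alpha}}\log \frac{\sqrt{2\rho \alpha}+1}{\sqrt{2\rho \alpha} -1}} . $$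
   Context: Setting ($\Gamma_2$ formalism). $L$ is a Markov generator on a probability space $(\mathcal{X},\mathcal{B},\mu)$, self-adjoint in $L^2(\mu)$ with domain $\mathcal{D}(L)$, with associated Markov semigroup $(P_t)_{t\ge0}$. One assumes the existence of a set $\mathcal{A}$ of real functions on $\mathcal{X}$ which is contained and dense in every $L^p(\mu)$, $1<p<\infty$, is stable under the action of $P_t$ ($t>0$) and of $L$, is stable under composition with $\mathcal{C}^\infty$ functions, contains the constants, and is such that $\lim_{t\to\infty}P_tf=\int f\,d\mu$ for all $f\in\mathcal{A}$. For $f,g\in\mathcal{A}$: $\Gamma(f,g)=\frac12\left(L(fg)-fLg-gLf\right)$, $\Gamma_2(f,g)=\frac12\left(L\Gamma(f,g)-\Gamma(f,Lg)-\Gamma(g,Lf)\right)$, $\Gamma(f)=\Gamma(f,f)$, $\Gamma_2(f)=\Gamma_2(f,f)$. The integration by parts formula $\int fLg\,d\mu=-\int\Gamma(f,g)\,d\mu$ holds for $f,g\in\mathcal{A}$. $L$ is a diffusion if for every $\mathcal{C}^\infty$ function $\Phi:\mathbb{R}^n\to\mathbb{R}$ and every $f=(f_1,\dots,f_n)\in\mathcal{A}^n$, $L(\Phi(f))=\sum_i\partial_i\Phi(f)Lf_i+\sum_{i,j}\partial^2_{ij}\Phi(f)\Gamma(f_i,f_j)$. *)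

(* Defs.v *)
From HB Require Import structures.
From mathcomp Require Import all_boot all_order all_algebra.
From mathcomp Require Import all_classical all_reals all_analysis.

Set Implicit Arguments.
Unset Strict Implicit.
Unset Printing Implicit Defensive.

Import Order.TTheory GRing.Theory Num.Theory.
Import numFieldNormedType.Exports.

Local Open Scope classical_set_scope.
Local Open Scope ring_scope.

(* Elements of L^p(mu) are given by representatives [T -> R] in [Lfun mu p],
   and operators on L^p(mu) act on representatives.  Identities and
   inequalities between functions therefore hold mu-almost everywhere. *)

Section SmoothFunctions.
Context {R : realType} {n : nat}.

(* [pder [:: i1; ...; ik] Phi] is d_{i1} ... d_{ik} Phi. *)
Definition pder (s : seq 'I_n) (Phi : 'rV[R]_n -> R) : 'rV[R]_n -> R :=
  foldr (fun i (g : 'rV[R]_n -> R) => 'D_(delta_mx ord0 i) g) Phi s.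

Definition smooth (Phi : 'rV[R]_n -> R) : Prop :=
  forall s : seq 'I_n, continuous (pder s Phi) /\
    forall (i : 'I_n) (x : 'rV[R]_n), derivable (pder s Phi) x (delta_mx ord0 i).

End SmoothFunctions.

Section MarkovDiffusion.
Context {R : realType} {d : measure_display} {T : measurableType d}.
Variable mu : probability T R.
Implicit Types (f g u : T -> R) (P : R -> (T -> R) -> T -> R)
  (L : (T -> R) -> T -> R) (A D : set (T -> R)).

Definition Lpdist (p : R) f g : \bar R :=
  'N[mu]_(p%:E)[EFin \o (fun x => (f x - g x)%R)]%E.

Record markov_semigroup P : Prop := MarkovSemigroup {
  ms_L2 : forall (t : R) f, 0 <= t -> f \in Lfun mu 2%:E -> P t f \in Lfun mu 2%:E;
  ms_linear : forall (t a : R) f g, 0 <= t ->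
    f \in Lfun mu 2%:E -> g \in Lfun mu 2%:E ->
    {ae mu, forall x, P t (fun y => a * f y + g y) x = a * P t f x + P t g x};
  ms_contraction : forall (t : R) f, 0 <= t -> f \in Lfun mu 2%:E ->
    ('N[mu]_(2%:E)[EFin \o P t f] <= 'N[mu]_(2%:E)[EFin \o f])%E;
  ms_0 : forall f, f \in Lfun mu 2%:E -> {ae mu, forall x, P 0 f x = f x};
  ms_add : forall (s t : R) f, 0 <= s -> 0 <= t -> f \in Lfun mu 2%:E ->
    {ae mu, forall x, P (s + t) f x = P s (P t f) x};
  ms_continuous : forall f, f \in Lfun mu 2%:E ->
    Lpdist 2 (P t f) f @[t --> 0^'+] --> 0%E;
  ms_positive : forall (t : R) f, 0 <= t -> f \in Lfun mu 2%:E ->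
    {ae mu, forall x, 0 <= f x} -> {ae mu, forall x, 0 <= P t f x};
  ms_unit : forall t : R, 0 <= t -> {ae mu, forall x, P t (cst 1) x = 1}
}.

Definition generator_graph P f g : Prop :=
  [/\ f \in Lfun mu 2%:E, g \in Lfun mu 2%:E &
      Lpdist 2 (fun x => (P t f x - f x) / t) g @[t --> 0^'+] --> 0%E].

Definition generator_domain P : set (T -> R) :=
  [set f | exists g, generator_graph P f g].

Definition is_generator P L : Prop :=
  forall f, generator_domain P f -> generator_graph P f (L f).

(* [L] with domain [D] is densely defined and equal to its adjoint:
   the graph of [L] consists of the pairs (f, g) such that
   <f, L u> = <g, u> for all u in [D]. *)
Definition self_adjoint D L : Prop :=
  (forall f (e : R), f \in Lfun mu 2%:E -> 0 < e ->
     exists2 u, D u & (Lpdist 2 f u < e%:E)%E) /\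
  (forall f g, f \in Lfun mu 2%:E -> g \in Lfun mu 2%:E ->
     (D f /\ {ae mu, forall x, L f x = g x}) <->
     (forall u, D u ->
        (\int[mu]_x (f x * L u x)%:E = \int[mu]_x (g x * u x)%:E)%E)).

Record admissible_class P L A : Prop := AdmissibleClass {
  ac_Lp : forall p : R, 1 < p -> forall f, A f -> f \in Lfun mu p%:E;
  ac_dense : forall p : R, 1 < p ->
    forall f (e : R), f \in Lfun mu p%:E -> 0 < e ->
    exists2 g, A g & (Lpdist p f g < e%:E)%E;
  ac_domain : A `<=` generator_domain P;
  ac_semigroup : forall (t : R) f, 0 < t -> A f -> A (P t f);
  ac_generator : forall f, A f -> A (L f);
  ac_smooth : forall n (Phi : 'rV[R]_n -> R) (f : 'I_n -> T -> R),
    smooth Phi -> (forall i, A (f i)) -> A (fun x => Phi (\row_i f i x));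
  ac_cst : forall c : R, A (cst c);
  ac_ergodic : forall f, A f ->
    Lpdist 2 (P t f) (cst (\int[mu]_x f x)) @[t --> +oo] --> 0%E
}.

Definition Gamma L f g : T -> R := fun x =>
  2^-1 * (L (fun y => f y * g y) x - f x * L g x - g x * L f x).

Definition Gamma2 L f g : T -> R := fun x =>
  2^-1 * (L (Gamma L f g) x - Gamma L f (L g) x - Gamma L g (L f) x).

Definition diffusion L A : Prop :=
  forall n (Phi : 'rV[R]_n -> R) (f : 'I_n -> T -> R),
    smooth Phi -> (forall i, A (f i)) ->
    {ae mu, forall x, L (fun y => Phi (\row_i f i y)) x =
      \sum_(i < n) pder [:: i] Phi (\row_k f k x) * L (f i) x +
      \sum_(i < n) \sum_(j < n)
        pder [:: i; j] Phi (\row_k f k x) * Gamma L (f i) (f j) x}.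

Definition curvature L A (rho : R) : Prop :=
  forall f, A f -> {ae mu, forall x, rho * Gamma L f f x <= Gamma2 L f f x}.

End MarkovDiffusion.

Section Constant.
Context {R : realType}.
Implicit Types rho alpha t : R.

Definition a_ rho alpha t : R :=
  Num.sqrt (2 * rho * alpha * (expR (2 * rho * t) - 1)).

Definition c_formula rho t alpha : R :=
  let a := a_ rho alpha t in
  let E := expR (rho * t) in
  Num.sqrt (1 - expR (- (2 * rho * t))) / (2 * Num.sqrt (2 * rho * alpha)) *
  ln (((E * a - 1) * (E * a + 1 + a ^+ 2 - expR (- (2 * rho * t)))) /
      ((E * a + 1) * (- (E * a) + 1 + a ^+ 2 - expR (- (2 * rho * t))))).

(* When e^{rho t} a_t = 1 the fraction in [c_formula] reads 0/0, and the
   constant is the limit of the formula at that value of [alpha]. *)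
Definition c_ rho alpha t : R :=
  if expR (rho * t) * a_ rho alpha t == 1
  then lim (c_formula rho t b @[b --> alpha^'])
  else c_formula rho t alpha.

End Constant.

(* Main.v *)
(* With C = (1 - e^(-2 rho t)) / (2 rho) and s = sqrt (alpha / C), the threshold
   on alpha reads s > 1 and the constant simplifies to
     c_alpha(t) = 1 / (2 s) * ln ((s + 1) / (s - 1)) = int_0^1 dl / (s^2 - l^2).
   The inequality is Herbst's argument for the local logarithmic Sobolev inequality
     P_t (e^h h) - P_t e^h ln (P_t e^h) <= C P_t (e^h Gamma h):
   for h = l f, the entropic inequality
     P_t (e^h k) <= P_t (e^h h) - P_t e^h ln (P_t e^h) + P_t e^h ln (P_t e^k)
   with k = alpha Gamma f bounds the right-hand side, and one gets
     (ln (P_t e^(l f)) / l)' <= ln (P_t e^(alpha Gamma f)) / (s^2 - l^2),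
   to be integrated over ]0, 1]. The second inequality is the limit t -> oo.

   P_t f is only known up to null sets, so that nothing can be differentiated
   pointwise. But an algebra of integrable functions which is stable under all
   smooth functions consists of essentially bounded functions, and then all the
   curves of functions that occur are differentiable with an error O(h^2) which is
   uniform in L^infty. Monotonicity follows by summing over partitions, which
   involves countably many null sets only.

   The local inequality is obtained by testing against psi >= 0 in A: for
   F(s) = int P_s psi Phi(P_(t-s) g) with Phi(y) = y ln y, the diffusion property
   gives F'(s) = int P_s psi Gamma(u) / u at u = P_(t-s) g, and the curvature
   condition gives F'' >= 2 rho F'. *)

Require Import Defs.
From HB Require Import structures.
From mathcomp Require Import all_boot all_order all_algebra.
From mathcomp Require Import all_classical all_reals all_analysis.
From mathcomp Require Import measurable_realfun ring lra.

Set Implicit Arguments.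
Unset Strict Implicit.
Unset Printing Implicit Defensive.

Import Order.TTheory GRing.Theory Num.Theory.
Import numFieldNormedType.Exports.

Local Open Scope classical_set_scope.
Local Open Scope ring_scope.

(** * Smooth functions of several variables *)

Section SmoothTerms.
Context {R : realType}.

(** Two steps need a parameter chosen at each point: the curvature condition is used for a u - u^2 /
    2 at a = 2 u(x), and Young's inequality at a shift r given by logarithms at x. Almost everywhere
    inequalities do not allow this choice, since the null set depends on the parameter; continuity
    in the parameter reduces the choice to rational values and leaves a single null set. The
    quadratic family also keeps the curvature step polynomial, so that ln u need not lie in A. The
    functions ln and 1 / x are not smooth on the line, so the stability of A and the diffusion
    property say nothing directly about ln u, even for u bounded below. They are replaced by
    functions that are smooth on the line and close to them, with two derivatives, uniformly on
    [delta, oo). The limit is taken only after integration against psi: by self-adjointness L acts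
    on psi there, and no convergence of L along the approximants is required. Nonnegative test
    functions are found as squares: A is dense in L^2, so its squares approximate indicator
    functions in L^1 and detect the sign of a bounded function. *)

Record jet := Jet {
  jet_fun :> nat -> R -> R ;
  jetP : forall k (x : R), is_derive x (1 : R) (jet_fun k) (jet_fun k.+1 x) }.

(** A syntax closed under the formal derivative [der]: smoothness, which concerns all iterated
    partial derivatives, and the values of these derivatives then follow by induction. [App F k]
    stands for the k-th derivative of [F]; the last two constructors serve to regularize 1 / x and
    ln x at 0. *)
Inductive term (n : nat) :=
  | Var of 'I_n
  | Cst of R
  | Add of term n & term n
  | Mul of term n & term n
  | App of jet & nat & term n
  | Inv1Dsqr of term n
  | Ln1Dsqr of term n.

Fixpoint eval n (e : term n) (x : 'rV[R]_n) : R :=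
  match e with
  | Var i => x ord0 i
  | Cst c => c
  | Add a b => eval a x + eval b x
  | Mul a b => eval a x * eval b x
  | App F k a => F k (eval a x)
  | Inv1Dsqr a => (1 + eval a x ^+ 2)^-1
  | Ln1Dsqr a => ln (1 + eval a x ^+ 2)
  end.

Fixpoint der n (i : 'I_n) (e : term n) : term n :=
  match e with
  | Var j => Cst n (i == j)%:R
  | Cst _ => Cst n 0
  | Add a b => Add (der i a) (der i b)
  | Mul a b => Add (Mul a (der i b)) (Mul b (der i a))
  | App F k a => Mul (App F k.+1 a) (der i a)
  | Inv1Dsqr a => Mul (Cst n (- 2))
      (Mul (Mul (Inv1Dsqr a) (Inv1Dsqr a)) (Mul a (der i a)))
  | Ln1Dsqr a => Mul (Cst n 2) (Mul (Inv1Dsqr a) (Mul a (der i a)))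
  end.

Lemma sqr1D_gt0 (y : R) : 0 < 1 + y ^+ 2.
Proof. by rewrite ltr_pwDl// sqr_ge0. Qed.

Lemma derive_line (V : normedModType R) (f : V -> R) (x v : V) :
  'D_(1 : R) (fun h : R => f (h *: v + x)) 0 = 'D_v f x.
Proof.
rewrite /derive; set F1 := (X in lim (X @ _)); set F2 := (X in _ = lim (X @ _)).
suff -> : F1 = F2 by [].
by apply/funext => h; rewrite /F1 /F2/= addr0 -[h%:A]/(h * 1) mulr1 scale0r add0r.
Qed.

(** Only the derivative in one direction is assumed, so the chain rule for differentials is out of
    reach; restricting [f] to the line through [x] in direction [v] brings everything down to one
    real variable. *)
Lemma is_derive_comp_dir (V : normedModType R) (g : R -> R) (f : V -> R)
    (x v : V) (df dg : R) :
  is_derive x v f df -> is_derive (f x) (1 : R) g dg ->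
  is_derive x v (g \o f) (dg * df).
Proof.
move=> [f1 f2] Hg.
pose l (h : R) := f (h *: v + x).
have l0 : l 0 = f x by rewrite /l scale0r add0r.
have Hl : is_derive (0 : R) (1 : R) l df.
  by split; [exact: (derivable1P f x v).1|rewrite derive_line].
have [h1 h2] : is_derive (0 : R) (1 : R) (g \o l) (dg * df).
  by apply: is_derive1_comp; rewrite ?l0.
split; first exact: (derivable1P (g \o f) x v).2.
by rewrite -h2 -derive_line.
Qed.

Lemma is_derive_inv1Dsqr (y : R) : is_derive y (1 : R) (fun z : R => (1 + z ^+ 2)^-1)
  (- 2 * ((1 + y ^+ 2)^-1 * (1 + y ^+ 2)^-1 * y)).
Proof.
have H : is_derive y (1 : R) (fun z : R => 1 + z ^+ 2) (2 * y).
  have := is_deriveD (is_derive_cst (1 : R) y (1 : R)) (is_deriveX 2 (is_derive_id y (1:R))).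
  move=> H; apply: (is_derive_eq H).
  by rewrite add0r expr1 -[_ *: _]/(_ * _) mulr1.
have Hn : 1 + y ^+ 2 != 0 by rewrite gt_eqF// sqr1D_gt0.
apply: (is_derive_eq (@is_deriveV R (fun z => 1 + z ^+ 2) y _ _ Hn H)).
by rewrite -[_ *: _]/(_ * _) expr2 invfM; ring.
Qed.

Lemma is_derive_ln1Dsqr (y : R) : is_derive y (1 : R) (fun z : R => ln (1 + z ^+ 2))
  (2 * ((1 + y ^+ 2)^-1 * y)).
Proof.
have H : is_derive y (1 : R) (fun z : R => 1 + z ^+ 2) (2 * y).
  have := is_deriveD (is_derive_cst (1 : R) y (1 : R)) (is_deriveX 2 (is_derive_id y (1:R))).
  move=> H; apply: (is_derive_eq H).
  by rewrite add0r expr1 -[_ *: _]/(_ * _) mulr1.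
have := @is_derive1_comp _ (@ln R) (fun z => 1 + z ^+ 2) y _ _
  (is_derive1_ln (sqr1D_gt0 y)) H.
by move=> H'; apply: (is_derive_eq H'); ring.
Qed.

Lemma is_derive_eval n (e : term n) (i : 'I_n) (x : 'rV[R]_n) :
  is_derive x (delta_mx ord0 i) (eval e) (eval (der i e) x).
Proof.
elim: e => [j|c|a iha b ihb|a iha b ihb|F k a iha|a iha|a iha] /=.
- have H : (fun h : R => h^-1 *: (((fun y : 'rV[R]_n => y ord0 j) \o shift x)
      (h *: delta_mx ord0 i) - x ord0 j)) @ 0^' --> ((i == j)%:R : R).
    apply/cvgrPdist_le => e e0; near=> h.
    rewrite /= !mxE addrK eqxx andTb [j == i]eq_sym.
    rewrite -[_ *: _]/(_ * _) mulKf ?subrr ?normr0 ?(ltW e0)//.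
    by near: h; exact: nbhs_dnbhs_neq.
  by split; [exact: cvgP H|exact: cvg_lim H].
- exact: is_derive_cst.
- exact: is_deriveD.
- exact: is_deriveM.
- by apply: is_derive_comp_dir; last exact: jetP.
- apply: is_derive_eq; first exact: is_derive_comp_dir iha (is_derive_inv1Dsqr _).
  by ring.
- apply: is_derive_eq; first exact: is_derive_comp_dir iha (is_derive_ln1Dsqr _).
  by ring.
Unshelve. all: by end_near.
Qed.

Lemma is_derive_continuous (g : R -> R) (x dg : R) :
  is_derive x (1 : R) g dg -> {for x, continuous g}.
Proof. by move=> [D _]; apply/differentiable_continuous/derivable1_diffP. Qed.

Lemma continuous_eval n (e : term n) : continuous (eval e).
Proof.
elim: e => [j|c|a iha b ihb|a iha b ihb|F k a iha|a iha|a iha] x /=.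
- exact: coord_continuous.
- exact: cst_continuous.
- by apply: continuousD; [exact: iha|exact: ihb].
- by apply: continuousM; [exact: iha|exact: ihb].
- apply: (@continuous_comp _ _ _ (eval a) (F k)); first exact: iha.
  exact: is_derive_continuous (jetP _ _ _).
- apply: (@continuous_comp _ _ _ (eval a) (fun z : R => (1 + z ^+ 2)^-1)).
    exact: iha.
  exact: is_derive_continuous (is_derive_inv1Dsqr _).
- apply: (@continuous_comp _ _ _ (eval a) (fun z : R => ln (1 + z ^+ 2))).
    exact: iha.
  exact: is_derive_continuous (is_derive_ln1Dsqr _).
Qed.

Lemma pder_eval n (e : term n) (s : seq 'I_n) :
  pder s (eval e) = eval (foldr (@der n) e s).
Proof.
elim: s => [//|i s ih] /=; rewrite /pder/= -/(pder s _) ih.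
by apply/funext => x; have [_ ->] := is_derive_eval (foldr (@der n) e s) i x.
Qed.

Lemma smooth_eval n (e : term n) : smooth (eval e).
Proof.
move=> s; rewrite pder_eval; split; first exact: continuous_eval.
by move=> i x; have [] := is_derive_eval (foldr (@der n) e s) i x.
Qed.

Definition exp_jet : jet := @Jet (fun=> expR) (fun _ => @is_derive_expR R).

End SmoothTerms.

(** * Entire functions of arbitrary growth *)

Section FastGrowth.
Context {R : realType}.
Implicit Types (c : nat -> R) (M : nat -> R).

(** Infinite radius of convergence in the form of Cauchy's estimates, a condition that passes to the
    derived series by enlarging r. *)
Definition entire c := forall r : R, 0 <= r -> exists K, forall k, `|c k| * r ^+ k <= K.

Lemma entire_cvg c x : entire c -> cvgn (pseries c x).
Proof.
move=> /(_ (2 * `|x|)); rewrite mulr_ge0// => /(_ isT)[K HK].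
have K0 : 0 <= K by apply: le_trans (HK 0%N); rewrite mulr_ge0// exprn_ge0// mulr_ge0.
apply: normed_cvg.
apply: (@series_le_cvg _ _ (geometric K (2^-1))) => [k|k|k|].
- by rewrite normr_ge0.
- by rewrite /= mulr_ge0// exprn_ge0.
- rewrite /= exprVn ler_pdivlMr ?exprn_gt0// normrM normrX -mulrA -exprMn.
  by rewrite [`|x| * 2]mulrC; exact: HK.
- by apply: is_cvg_geometric_series; rewrite ger0_norm// invf_lt1 ?ltr1n.
Qed.

Lemma entire_diffs c : entire c -> entire (pseries_diffs c).
Proof.
(* At radius 2 (r + 1) the factor 2^(k+1) absorbs k + 1, and r + 1 >= 1 absorbs the shift of the
   exponent from k to k + 1. *)
move=> Hc r r0; have [K HK] := Hc (2 * (r + 1)) ltac:(by rewrite mulr_ge0// addr_ge0).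
exists K => k; apply: le_trans (HK k.+1).
rewrite /pseries_diffs normrM -mulrA mulrCA ler_wpM2l//.
rewrite ger0_norm// exprMn ler_pM// ?exprn_ge0//.
  by rewrite -natrX ler_nat ltnW// ltn_expl.
rewrite (@le_trans _ _ ((r + 1) ^+ k))//.
  by rewrite lerXn2r ?nnegrE ?addr_ge0// lerDl.
by rewrite exprS ler_peMl ?exprn_ge0 ?addr_ge0// lerDr.
Qed.

Lemma entire_iter c k : entire c -> entire (iter k (@pseries_diffs R) c).
Proof. by move=> Hc; elim: k => //= k; exact: entire_diffs. Qed.

Definition pseries_fun c (x : R) : R := limn (pseries c x).

Lemma is_derive_pseries_fun c : entire c -> forall x,
  is_derive x (1 : R) (pseries_fun c) (pseries_fun (pseries_diffs c) x).
Proof.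
move=> Hc x; apply: (@pseries_snd_diffs _ c (`|x| + 1)).
- exact: entire_cvg.
- exact/entire_cvg/entire_diffs.
- exact/entire_cvg/entire_diffs/entire_diffs.
- by rewrite [ltRHS]ger0_norm ?addr_ge0// ltrDl.
Qed.

Definition pseries_jet c (Hc : entire c) : jet :=
  @Jet _ (fun k => pseries_fun (iter k (@pseries_diffs R) c))
    (fun k => is_derive_pseries_fun (entire_iter k Hc)).

(* [level M] stays at n until M n <= 2 ^ k and then passes to n + 1. With the
   coefficients [(2 / level M k) ^ k] below, the last term of level n is at least
   2 ^ k >= M n on [n, oo), while the series converges everywhere. *)
Fixpoint level M (k : nat) : nat :=
  if k is k'.+1 then (level M k' + ((M (level M k') <= 2 ^+ k')%R : bool))%N else 1%N.

Lemma level_gt0 M k : (0 < level M k)%N.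
Proof. by elim: k => //= k ih; rewrite addn_gt0 ih. Qed.

(** No level lasts forever, since 2^k eventually exceeds M n. The index found is the first one,
    after the level is reached, at which this happens; the level is still n there and becomes n + 1
    right after. *)
Lemma level_attained M n : (0 < n)%N ->
  exists k, level M k = n /\ M n <= 2 ^+ k.
Proof.
have stay k0 : exists k, level M k = level M k0 /\ M (level M k0) <= 2 ^+ k.
  have /ex_minnP[m /andP[Hm1 Hm2] Hmin] :
      exists m, (k0 <= m)%N && (M (level M k0) <= 2 ^+ m).
    have [j Hj] : exists j : nat, M (level M k0) <= j%:R.
      exists (Num.truncn `|M (level M k0)|).+1.
      by rewrite (le_trans (ler_norm _))// ltW// truncnS_gt.
    exists (k0 + j)%N; rewrite leq_addr (le_trans Hj)// -natrX ler_nat.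
    by rewrite (leq_trans (leq_addl k0 j))// ltnW// ltn_expl.
  exists m; split => //.
  have Hlev i : (k0 + i <= m)%N -> level M (k0 + i) = level M k0.
    elim: i => [|i ih]; first by rewrite addn0.
    rewrite addnS => Hi /=; rewrite ih ?(ltnW Hi)//.
    case: (leP (M (level M k0)) (2 ^+ (k0 + i))) => H; last by rewrite addn0.
    have := Hmin (k0 + i)%N; rewrite leq_addr H => /(_ isT).
    by rewrite leqNgt Hi.
  by rewrite -(subnKC Hm1) Hlev// subnKC.
case: n => // n _; elim: n => [|n [k [k1 k2]]]; first exact: (stay 0%N).
by have := stay k.+1; rewrite /= k1 k2 addn1.
Qed.

Lemma leq_level M : {homo level M : k k' / (k <= k')%N}.
Proof.
move=> k k' /subnKC <-; elim: (k' - k)%N => [|i ih]; first by rewrite addn0.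
by rewrite addnS /= (leq_trans ih)// leq_addr.
Qed.

Definition fast_coeff M k : R := (2 / (level M k)%:R) ^+ k.

Lemma fast_coeff_ge0 M k : 0 <= fast_coeff M k.
Proof. by rewrite exprn_ge0// divr_ge0. Qed.

(** The k-th term at radius r is (2 r / level)^k, at most 1 once the level exceeds 2 r; the finitely
    many earlier terms are bounded by a power of 2 r + 1. *)
Lemma entire_fast_coeff M : entire (fast_coeff M).
Proof.
move=> r r0.
pose n := (Num.truncn (2 * r)).+1.
have [//|k0 [Hk0 _]] := @level_attained M n.
have B k : `|fast_coeff M k| * r ^+ k = (2 * r / (level M k)%:R) ^+ k.
  by rewrite ger0_norm ?fast_coeff_ge0// -exprMn mulrAC.
exists ((2 * r + 1) ^+ k0) => k; rewrite B.
have r20 : 0 <= 2 * r by rewrite mulr_ge0.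
have lv0 : 0 < (level M k)%:R :> R by rewrite ltr0n level_gt0.
have le1 : (1 : R) <= 2 * r + 1 by rewrite lerDr.
have le0 : 0 <= 2 * r + 1 := le_trans ler01 le1.
have q0 : 0 <= 2 * r / (level M k)%:R by rewrite divr_ge0// ltW.
have [kk0|kk0] := leqP k k0.
  rewrite (@le_trans _ _ ((2 * r + 1) ^+ k))//; last exact: ler_weXn2l.
  rewrite lerXn2r// ler_pdivrMr//.
  by rewrite (@le_trans _ _ (2 * r + 1))// ?lerDl// ler_peMr// ler1n level_gt0.
rewrite (@le_trans _ _ 1)//; last by rewrite exprn_ege1.
rewrite exprn_ile1// ler_pdivrMr// mul1r.
rewrite (@le_trans _ _ n%:R) ?(ltW (truncnS_gt _))// ler_nat -Hk0.
by rewrite leq_level// ltnW.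
Qed.

Lemma fast_growth M n (y : R) : (0 < n)%N -> n%:R <= y ->
  M n <= pseries_fun (fast_coeff M) y.
Proof.
move=> n0 ny; have [k [k1 k2]] := @level_attained M n n0.
have y0 : 0 <= y by rewrite (le_trans _ ny).
have nd : nondecreasing_seq (pseries (fast_coeff M) y).
  apply/nondecreasing_seqP => i; rewrite /pseries /series/= big_nat_recr//=.
  by rewrite lerDl mulr_ge0 ?fast_coeff_ge0// exprn_ge0.
apply: (@le_trans _ _ (pseries (fast_coeff M) y k.+1)); last first.
  exact: (nondecreasing_cvgn_le nd (@entire_cvg _ y (@entire_fast_coeff M)) k.+1).
apply: (le_trans k2); rewrite /pseries /series/= big_nat_recr//=.
rewrite ler_wpDl//.
  by apply: sumr_ge0 => i _; rewrite mulr_ge0 ?fast_coeff_ge0// exprn_ge0.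
rewrite /fast_coeff k1 -exprMn lerXn2r ?nnegrE//.
  by rewrite mulr_ge0// divr_ge0.
by rewrite mulrAC -mulrA ler_peMr// ler_pdivlMr ?ltr0n// mul1r.
Qed.

End FastGrowth.

(** * Bounded functions and differentiable curves *)

Lemma ae_app {R : realType} {d : measure_display} {T : measurableType d}
    (mu : {measure set T -> \bar R}) (P Q : T -> Prop) :
  {ae mu, forall x, P x} -> {ae mu, forall x, P x -> Q x} ->
  {ae mu, forall x, Q x}.
Proof. by move=> HP; apply: filterS2 HP => x p; apply. Qed.

Ltac with_ae H := apply: (ae_app H).

Section Bounded.
Context {R : realType} {d : measure_display} {T : measurableType d}.
Variable mu : probability T R.
Implicit Types f g h : T -> R.

Definition bdd f := measurable_fun setT f /\
  exists K : R, {ae mu, forall x, `|f x| <= K}.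

Definition Int f : R := \int[mu]_x f x.

Lemma bdd_bound f : bdd f -> exists2 K : R, 0 <= K & {ae mu, forall x, `|f x| <= K}.
Proof.
move=> [_ [K HK]]; exists `|K|; first exact: normr_ge0.
by with_ae HK; apply: aeW => x Hx; rewrite (le_trans Hx)// ler_norm.
Qed.

Lemma bdd_cst c : bdd (cst c).
Proof. by split; [exact: measurable_cst|exists `|c|; apply: aeW]. Qed.

Lemma bddD f g : bdd f -> bdd g -> bdd (fun x => f x + g x).
Proof.
move=> [mf [K HK]] [mg [K' HK']]; split; first exact: measurable_funD.
exists (K + K'); with_ae HK; with_ae HK'; apply: aeW => x h1 h2.
by rewrite (le_trans (ler_normD _ _))// lerD.
Qed.

Lemma bddM f g : bdd f -> bdd g -> bdd (fun x => f x * g x).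
Proof.
move=> [mf [K HK]] [mg [K' HK']]; split; first exact: measurable_funM.
exists (K * K'); with_ae HK; with_ae HK'; apply: aeW => x h1 h2.
by rewrite normrM ler_pM.
Qed.

Lemma bddZ c f : bdd f -> bdd (fun x => c * f x).
Proof. exact: bddM (bdd_cst c). Qed.

Lemma bddN f : bdd f -> bdd (fun x => - f x).
Proof.
move=> Hf; have := bddZ (-1) Hf; rewrite (_ : (fun x => _) = (fun x => - f x))//.
by apply/funext => x; rewrite mulN1r.
Qed.

Lemma bddB f g : bdd f -> bdd g -> bdd (fun x => f x - g x).
Proof. by move=> Hf Hg; exact: (bddD Hf (bddN Hg)). Qed.

Lemma bdd_sqr f : bdd f -> bdd (fun x => f x ^+ 2).
Proof. by move=> Hf; exact: (bddM Hf Hf). Qed.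

Lemma bdd_norm f : bdd f -> bdd (fun x => `|f x|).
Proof.
move=> [mf [K HK]]; split; first exact: measurableT_comp.
by exists K; with_ae HK; apply: aeW => x; rewrite normr_id.
Qed.

Lemma bdd_sum n (F : 'I_n -> T -> R) : (forall i, bdd (F i)) ->
  bdd (fun x => \sum_(i < n) F i x).
Proof.
elim: n F => [|n ih] F HF.
  rewrite (_ : (fun x => _) = cst 0); first exact: bdd_cst.
  by apply/funext => x; rewrite big_ord0.
rewrite (_ : (fun x => _) = (fun x => \sum_(i < n) F (widen_ord (leqnSn n) i) x + F ord_max x)).
  by apply: bddD => //; exact: ih.
by apply/funext => x; rewrite big_ord_recr.
Qed.

Lemma bdd_max0 f : bdd f -> bdd (fun x => Num.max (f x) 0).
Proof.
move=> [mf [K HK]]; split; first exact: measurable_maxr.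
exists K; with_ae HK; apply: aeW => x Hx.
by case: (leP (f x) 0) => //; rewrite normr0 (le_trans _ Hx).
Qed.

Lemma bdd_integrable f : bdd f -> mu.-integrable setT (EFin \o f).
Proof.
move=> [mf [K HK]]; apply/integrableP; split; first exact/measurable_EFinP.
have HK' : {ae mu, forall x, `|f x| <= `|K|}.
  by with_ae HK; apply: aeW => x h; rewrite (le_trans h)// ler_norm.
apply: (@le_lt_trans _ _ (\int[mu]_x (`|K|)%:E)%E); last first.
  rewrite integral_cst// [X in (_ * X)%E](_ : _ = 1%E) ?mule1 ?ltry//; exact: probability_setT.
apply: ae_ge0_le_integral => //.
  by apply: measurableT_comp => //; exact/measurable_EFinP.
by with_ae HK'; apply: aeW => x h _; rewrite lee_fin.
Qed.

Lemma IntE f : bdd f -> (\int[mu]_x (f x)%:E)%E = (Int f)%:E.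
Proof. by move=> Hf; rewrite /Int /Rintegral fineK// integrable_fin_num// bdd_integrable. Qed.

Lemma Int_cst c : Int (cst c) = c.
Proof.
rewrite /Int Rintegral_cst// [X in fine X](_ : _ = 1%E) ?mulr1//.
exact: probability_setT.
Qed.

Lemma IntD f g : bdd f -> bdd g -> Int (fun x => f x + g x) = Int f + Int g.
Proof. by move=> Hf Hg; rewrite /Int RintegralD// bdd_integrable. Qed.

Lemma IntB f g : bdd f -> bdd g -> Int (fun x => f x - g x) = Int f - Int g.
Proof. by move=> Hf Hg; rewrite /Int RintegralB// bdd_integrable. Qed.

Lemma IntZ c f : bdd f -> Int (fun x => c * f x) = c * Int f.
Proof. by move=> Hf; rewrite /Int RintegralZl// bdd_integrable. Qed.

Lemma IntN f : bdd f -> Int (fun x => - f x) = - Int f.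
Proof.
move=> Hf; have := IntZ (-1) Hf; rewrite mulN1r => <-; congr Int.
by apply/funext => x; rewrite mulN1r.
Qed.

Lemma Int_sum n (F : 'I_n -> T -> R) : (forall i, bdd (F i)) ->
  Int (fun x => \sum_(i < n) F i x) = \sum_(i < n) Int (F i).
Proof.
elim: n F => [|n ih] F HF.
  rewrite big_ord0 -[RHS](Int_cst 0); congr Int.
  by apply/funext => x; rewrite big_ord0.
rewrite big_ord_recr/= -ih// -IntD//; last exact: bdd_sum.
by congr Int; apply/funext => x; rewrite big_ord_recr.
Qed.

Lemma Int_ge0 f : bdd f -> {ae mu, forall x, 0 <= f x} -> 0 <= Int f.
Proof.
move=> Hf f0; rewrite -lee_fin -IntE//.
rewrite (ae_eq_integral (fun x => (Num.max (f x) 0)%:E)) => [|//|||].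
- by apply: integral_ge0 => x _; rewrite lee_fin le_max lexx orbT.
- by apply/measurable_EFinP; exact: (proj1 Hf).
- by apply/measurable_EFinP; exact: (proj1 (bdd_max0 Hf)).
- by with_ae f0; apply: aeW => x h _; rewrite max_l.
Qed.

Lemma Int_le f g : bdd f -> bdd g -> {ae mu, forall x, f x <= g x} -> Int f <= Int g.
Proof.
move=> Hf Hg fg; rewrite -subr_ge0 -IntB//; apply: Int_ge0; first exact: bddB.
by with_ae fg; apply: aeW => x; rewrite subr_ge0.
Qed.

Lemma Int_eq f g : bdd f -> bdd g -> {ae mu, forall x, f x = g x} -> Int f = Int g.
Proof.
move=> Hf Hg fg; apply/eqP; rewrite eq_le !Int_le//;
  by with_ae fg; apply: aeW => x ->.
Qed.

Lemma Int_norm_le f c : bdd f -> {ae mu, forall x, `|f x| <= c} -> `|Int f| <= c.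
Proof.
move=> Hf fc; have h1 := Int_cst c.
have h2 : Int f <= c.
  rewrite -[leRHS]h1; apply: Int_le => //; first exact: bdd_cst.
  by with_ae fc; apply: aeW => x; exact/le_trans/ler_norm.
have h3 : - Int f <= c.
  rewrite -[leRHS]h1 -mulN1r -IntZ//; apply: Int_le; [exact: bddZ|exact: bdd_cst|].
  with_ae fc; apply: aeW => x; rewrite mulN1r -normrN; exact/le_trans/ler_norm.
by rewrite ler_norml h2 andbT lerNl.
Qed.

Lemma Int_sqr_eq0 f : bdd f -> Int (fun x => f x ^+ 2) = 0 -> {ae mu, forall x, f x = 0}.
Proof.
move=> Hf H; have Hf2 := bdd_sqr Hf.
have : (\int[mu]_x `|(f x ^+ 2)%:E|)%E = 0%E.
  rewrite -[RHS]/((0 : R)%:E) -H -IntE//; apply: eq_integral => x _.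
  by rewrite gee0_abs// lee_fin sqr_ge0.
have mf2 : measurable_fun setT (fun x => (f x ^+ 2)%:E).
  by apply/measurable_EFinP; exact: (proj1 Hf2).
move=> /(ae_eq_integral_abs mu measurableT mf2) {}H.
with_ae H; apply: aeW => x /(_ I) /= [] /eqP.
by rewrite sqrf_eq0 => /eqP.
Qed.

(** Turns errors that are small only in L^2 into a pointwise inequality: the positive part of [f]
    has L^2 norm below every bound. *)
Lemma ae_le0_L2 f : bdd f ->
  (forall e, 0 < e -> exists r, [/\ bdd r, Int (fun x => r x ^+ 2) <= e &
     {ae mu, forall x, f x <= `|r x|}]) ->
  {ae mu, forall x, f x <= 0}.
Proof.
move=> Hf H; have Hm := bdd_max0 Hf.
have H0 : Int (fun x => Num.max (f x) 0 ^+ 2) = 0.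
  apply/eqP; rewrite eq_le; apply/andP; split; last first.
    by apply: Int_ge0; [exact: bdd_sqr|apply: aeW => x; exact: sqr_ge0].
  apply/ler_addgt0Pl => e e0; rewrite addr0; have [r [Hr re fr]] := H e e0.
  apply: le_trans re; apply: Int_le; [exact: bdd_sqr|exact: bdd_sqr|].
  with_ae fr; apply: aeW => x h; rewrite -[leRHS]real_normK ?num_real//.
  by rewrite lerXn2r ?nnegrE ?le_max ?lexx ?orbT// ge_max h/=.
with_ae (Int_sqr_eq0 Hm H0); apply: aeW => x <-.
by rewrite le_max lexx.
Qed.

Lemma Lfun_measurable p f : f \in Lfun mu p -> measurable_fun setT f.
Proof. by move=> /sub_Lfun_mfun; rewrite inE. Qed.

Lemma LnormE f : bdd f ->
  ('N[mu]_(2%:E)[EFin \o f] = (Num.sqrt (Int (fun x => f x ^+ 2)))%:E)%E.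
Proof.
move=> Hf; have Hf2 := bdd_sqr Hf.
rewrite unlock /Lnorm.
rewrite (_ : (\int[mu]_x (`|(EFin \o f) x| `^ 2))%E =
    (Int (fun x => f x ^+ 2))%:E); last first.
  rewrite -IntE//; apply: eq_integral => x _ /=.
  by rewrite powR_mulrn// real_normK ?num_real.
rewrite poweR_EFin; congr EFin.
by rewrite powR12_sqrt// Int_ge0//; apply: aeW => x; exact: sqr_ge0.
Qed.

Lemma bdd_L2 f : bdd f -> f \in Lfun mu 2%:E.
Proof.
move=> Hf; rewrite inE; apply/andP; split; rewrite inE/=; first exact: (proj1 Hf).
by rewrite /finite_norm LnormE// ltry.
Qed.

Lemma LpdistE f g : bdd f -> bdd g ->
  Lpdist mu 2 f g = (Num.sqrt (Int (fun x => (f x - g x) ^+ 2)))%:E.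
Proof. by move=> Hf Hg; rewrite /Lpdist LnormE//; exact: bddB. Qed.

(** The filter is abstract in order to serve both at [0^'+], for the generator, and at [+oo], for
    ergodicity. *)
Lemma Lpdist_cvg0 (F : set_system R) (u : R -> T -> R) f : Filter F ->
  (forall t, 0 < t -> bdd (u t)) -> bdd f -> F [set t | 0 < t] ->
  Lpdist mu 2 (u t) f @[t --> F] --> 0%E ->
  forall e, 0 < e -> \forall t \near F, Int (fun x => (u t x - f x) ^+ 2) <= e.
Proof.
move=> FF Hu Hf F0 H e e0.
have se0 : 0 < Num.sqrt e by rewrite sqrtr_gt0.
move/fine_cvgP: H => [_ /cvgrPdist_le /(_ _ se0)].
apply: filterS2 F0 => t t0; rewrite /= LpdistE//=; last exact: Hu.
by rewrite sub0r normrN ger0_norm ?sqrtr_ge0// ler_sqrt// ltW.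
Qed.

End Bounded.

(** * Second-order estimates for ln and exp *)

Section ScalarEstimates.
Context {R : realType}.

Lemma ln_le_sub1 (x : R) : 0 < x -> ln x <= x - 1.
Proof.
by move=> x0; have := expR_ge1Dx (ln x); rewrite lnK ?posrE// lerBrDl.
Qed.

(** The inequality ln z <= z - 1 at z = y / x bounds the remainder above by 0, and at z = x / y it
    bounds it below by - (y - x)^2 / (x y). *)
Lemma ln_taylor (m x y : R) : 0 < m -> m <= x -> m <= y ->
  `|ln y - ln x - (y - x) / x| <= m ^- 2 * (y - x) ^+ 2.
Proof.
move=> m0 mx my.
have x0 := lt_le_trans m0 mx; have y0 := lt_le_trans m0 my.
have h1 := ln_le_sub1 (divr_gt0 y0 x0).
have h2 := ln_le_sub1 (divr_gt0 x0 y0).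
rewrite !ln_div ?posrE// in h1 h2.
have e1 : y / x - 1 = (y - x) / x by field; lra.
have e2 : x / y - 1 = - (y - x) / x + (y - x) ^+ 2 / (x * y) by field; apply/andP; split; lra.
rewrite e1 in h1; rewrite e2 in h2.
have h3 : (y - x) ^+ 2 / (x * y) <= m ^- 2 * (y - x) ^+ 2.
  rewrite mulrC ler_wpM2r ?sqr_ge0// lef_pV2 ?posrE ?mulr_gt0// ?exprn_gt0//.
  by rewrite expr2 ler_pM// ltW.
have h4 : 0 <= m ^- 2 * (y - x) ^+ 2 by rewrite mulr_ge0 ?sqr_ge0// invr_ge0 sqr_ge0.
rewrite ler_norml; apply/andP; split; lra.
Qed.

(** By convexity at both points the remainder lies between 0 and (y - x) (e^y - e^x), and the latter
    increment is estimated by convexity again. *)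
Lemma expR_taylor (M x y : R) : x <= M -> y <= M ->
  `|expR y - expR x - (y - x) * expR x| <= expR M * (y - x) ^+ 2.
Proof.
move=> xM yM.
have mono (u v : R) : (v - u) * expR u <= expR v - expR u.
  have := expR_ge1Dx (v - u); rewrite expRB ler_pdivlMr ?expR_gt0//.
  by rewrite mulrDl mul1r; lra.
have h1 := mono x y; have h2 := mono y x.
have eM (u : R) : u <= M -> 0 < expR u <= expR M by rewrite expR_gt0 ler_expR.
have /andP[ex0 exM] := eM x xM; have /andP[ey0 eyM] := eM y yM.
rewrite ger0_norm; last lra.
have h : (y - x) * (expR y - expR x) <= (y - x) * ((y - x) * expR M).
  have [xy|yx] := lerP x y.
    have d0 : 0 <= y - x by rewrite subr_ge0.
    rewrite ler_wpM2l// (@le_trans _ _ ((y - x) * expR y))// ?ler_wpM2l//; lra.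
  have d0 : y - x <= 0 by rewrite subr_le0 ltW.
  rewrite ler_wnM2l// (@le_trans _ _ ((y - x) * expR x))// ler_wnM2l//.
rewrite [leRHS](_ : _ = (y - x) * ((y - x) * expR M)); last by ring.
by apply: le_trans h; lra.
Qed.

(** Cauchy-Schwarz against the constant vector, obtained from the nonnegativity of the variance. *)
Lemma sqr_sum_le n (a : 'I_n -> R) :
  (\sum_(i < n) a i) ^+ 2 <= n%:R * \sum_(i < n) a i ^+ 2.
Proof.
case: n a => [|n] a; first by rewrite !big_ord0 mul0r expr0n.
set S := \sum_i a i; set Q := \sum_i _.
have : 0 <= \sum_(i < n.+1) (n.+1%:R * a i - S) ^+ 2.
  by apply: sumr_ge0 => i _; exact: sqr_ge0.
rewrite (eq_bigr (fun i => n.+1%:R ^+ 2 * a i ^+ 2 + (- 2 * n.+1%:R * S * a i + S ^+ 2)));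
  last by move=> i _; ring.
have SE : \sum_(i < n.+1) S ^+ 2 = n.+1%:R * S ^+ 2.
  by rewrite sumr_const card_ord mulr_natl.
rewrite big_split big_split/= SE -!mulr_sumr -/S -/Q.
rewrite (_ : _ + _ = n.+1%:R * (n.+1%:R * Q - S ^+ 2)); last by ring.
by rewrite pmulr_rge0 ?ltr0n// subr_ge0.
Qed.

Lemma ln_lipschitz (m x y : R) : 0 < m -> m <= x -> m <= y ->
  `|ln x - ln y| <= m^-1 * `|x - y|.
Proof.
move=> m0.
have half (a b : R) : m <= a -> m <= b -> ln a - ln b <= m^-1 * `|a - b|.
  move=> ma mb; have a0 := lt_le_trans m0 ma; have b0 := lt_le_trans m0 mb.
  rewrite -ln_div ?posrE// (le_trans (ln_le_sub1 (divr_gt0 a0 b0)))//.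
  rewrite (_ : a / b - 1 = b^-1 * (a - b)); last by field; rewrite gt_eqF.
  rewrite (le_trans (ler_norm _))// normrM ler_wpM2r//.
  by rewrite gtr0_norm ?invr_gt0// lef_pV2 ?posrE.
move=> mx my; rewrite ler_norml half// andbT lerNl opprB distrC.
exact: half.
Qed.

End ScalarEstimates.

(** * Curves of bounded functions, differentiable uniformly in L^infty *)

Section Curves.
Context {R : realType} {d : measure_display} {T : measurableType d}.
Variable mu : probability T R.
Implicit Types (X Y : R -> T -> R).

(** Rational parameters cost countably many null sets, and a negative value at a real parameter
    would persist at a nearby rational. This allows the parameter to be chosen afterwards as a
    function of the point. *)
Lemma ae_forall_real (H : R -> T -> R) :
  (forall a, {ae mu, forall x, 0 <= H a x}) -> (forall x, continuous (H ^~ x)) ->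
  {ae mu, forall x, forall a, 0 <= H a x}.
Proof.
move=> H0 Hc.
have Hq : {ae mu, forall x, forall q : rat, 0 <= H (ratr q) x}.
  have : {ae mu, forall x, forall n : nat, if (unpickle n : option rat) is Some q
      then 0 <= H (ratr q) x else true}.
    by apply: ae_foralln => n; case: unpickle => [q|]; [exact: H0|exact: aeW].
  by move=> h; with_ae h; apply: aeW => x h' q; have := h' (pickle q); rewrite pickleK.
with_ae Hq; apply: aeW => x {}Hq a; rewrite leNgt; apply/negP => Ha.
have : \forall b \near a, H b x < 0.
  have E := Hc x a; rewrite /continuous_at in E.
  exact: (@cvgr_lt _ _ _ _ _ _ E _ Ha).
move=> [e e0 He].
have [q] : exists q, ratr q \in `]a - e, a + e[.
  by apply: rat_in_itvoo; have : 0 < e by []; lra.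
rewrite in_itv/= => /andP[q1 q2]; have := He (ratr q).
rewrite /ball/= ltr_distlC q1 q2 => /(_ isT).
by rewrite ltNge Hq.
Qed.

(* X is differentiable on [a, b] with derivative X', with a second-order error
   that is uniform in L^infty; the exceptional null sets may depend on s, s'. *)
Definition curve (a b : R) X X' := exists2 K : R, 0 <= K &
  (forall s, s \in `[a, b] -> [/\ bdd mu (X s), bdd mu (X' s),
     {ae mu, forall x, `|X s x| <= K} & {ae mu, forall x, `|X' s x| <= K}]) /\
  (forall s s', s \in `[a, b] -> s' \in `[a, b] ->
     {ae mu, forall x, `|X s' x - X s x - (s' - s) * X' s x| <= K * (s' - s) ^+ 2}).

Lemma curve_bdd a b X X' s : curve a b X X' -> s \in `[a, b] -> bdd mu (X s).
Proof. by case=> K _ [H _] /H[]. Qed.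

Lemma curve_eq a b X X' Y Y' : curve a b X X' ->
  (forall s, s \in `[a, b] -> bdd mu (Y s) /\ bdd mu (Y' s)) ->
  (forall s, s \in `[a, b] -> {ae mu, forall x, X s x = Y s x}) ->
  (forall s, s \in `[a, b] -> {ae mu, forall x, X' s x = Y' s x}) ->
  curve a b Y Y'.
Proof.
move=> [K K0 [H1 H2]] HY XY XY'; exists K => //; split=> [s sab|s s' sab s'ab].
  have [_ _ h3 h4] := H1 s sab; have [? ?] := HY s sab; split => //.
    by with_ae h3; with_ae (XY s sab); apply: aeW => x ->.
  by with_ae h4; with_ae (XY' s sab); apply: aeW => x ->.
with_ae (H2 _ _ sab s'ab); with_ae (XY s sab); with_ae (XY s' s'ab).
by with_ae (XY' s sab); apply: aeW => x -> -> ->.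
Qed.

Lemma curve_const a b f : bdd mu f -> curve a b (fun=> f) (fun=> cst 0).
Proof.
move=> Hf; have [K K0 HK] := bdd_bound Hf; exists K => //; split=> [s _|s s' _ _].
  by split => //; [exact: bdd_cst|apply: aeW => x; rewrite normr0].
by apply: aeW => x; rewrite subrr mulr0 subrr normr0 mulr_ge0 ?sqr_ge0.
Qed.

Lemma curve_id a b : curve a b (fun s => cst s) (fun=> cst 1).
Proof.
exists (`|a| + `|b| + 1); first by rewrite !addr_ge0.
have ab0 : 0 <= `|a| + `|b| by rewrite addr_ge0.
split=> [s|s s' _ _].
  rewrite in_itv/= => /andP[sa sb]; split; [exact: bdd_cst|exact: bdd_cst| |].
    apply: aeW => x /=; rewrite ler_norml.
    have := ler_norm (- a); have := ler_norm b; rewrite normrN.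
    have := normr_ge0 a; have := normr_ge0 b => *; apply/andP; split; lra.
  by apply: aeW => x; rewrite normr1 lerDr.
by apply: aeW => x; rewrite mulr1 subrr normr0 mulr_ge0 ?sqr_ge0// addr_ge0.
Qed.

Lemma curveD a b X X' Y Y' : curve a b X X' -> curve a b Y Y' ->
  curve a b (fun s x => X s x + Y s x) (fun s x => X' s x + Y' s x).
Proof.
move=> [K K0 [H1 H2]] [J J0 [G1 G2]]; exists (K + J); first exact: addr_ge0.
split=> [s sab|s s' sab s'ab].
  have [? ? h3 h4] := H1 s sab; have [? ? g3 g4] := G1 s sab.
  split; [exact: bddD|exact: bddD| |].
    by with_ae h3; with_ae g3; apply: aeW => x ? ?; rewrite (le_trans (ler_normD _ _))// lerD.
  by with_ae h4; with_ae g4; apply: aeW => x ? ?; rewrite (le_trans (ler_normD _ _))// lerD.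
with_ae (H2 _ _ sab s'ab); with_ae (G2 _ _ sab s'ab); apply: aeW => x h g.
rewrite [leRHS]mulrDl (_ : _ - _ = (X s' x - X s x - (s' - s) * X' s x) +
  (Y s' x - Y s x - (s' - s) * Y' s x)); last by ring.
by rewrite (le_trans (ler_normD _ _))// lerD.
Qed.

Lemma curveM a b X X' Y Y' : curve a b X X' -> curve a b Y Y' ->
  curve a b (fun s x => X s x * Y s x) (fun s x => X' s x * Y s x + X s x * Y' s x).
Proof.
move=> [K K0 [H1 H2]] [J J0 [G1 G2]].
pose w := `|b - a|.
have w0 : 0 <= w by exact: normr_ge0.
pose L := K * (1 + w) * (J * (1 + w)) + K * J + J * K.
have KJ0 : 0 <= K * J by exact: mulr_ge0.
have L0 : 0 <= L by rewrite /L !addr_ge0// ?mulr_ge0// ?mulr_ge0// addr_ge0.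
have B0 : 0 <= K * J + K * J by exact: addr_ge0.
exists (L + (K * J + K * J)); first exact: addr_ge0.
split=> [s sab|s s' sab s'ab].
  have [? ? h3 h4] := H1 s sab; have [? ? g3 g4] := G1 s sab.
  split; [exact: bddM|by apply: bddD; apply: bddM| |].
    with_ae h3; with_ae g3; apply: aeW => x ? ?.
    by rewrite normrM (@le_trans _ _ (K * J))// ?ler_pM// addrA lerDr addr_ge0.
  with_ae h3; with_ae g3; with_ae h4; with_ae g4; apply: aeW => x ? ? ? ?.
  rewrite (le_trans (ler_normD _ _))// !normrM (@le_trans _ _ (K * J + K * J))//.
    by rewrite lerD// ler_pM.
  by rewrite lerDr.
have hw : `|s' - s| <= w.
  rewrite /w; move: sab s'ab; rewrite !in_itv/= => /andP[? ?] /andP[? ?].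
  by rewrite [leRHS]ger0_norm ?ler_norml; last lra; apply/andP; split; lra.
have [_ _ h3 h4] := H1 s sab; have [_ _ g3 g4] := G1 s sab.
with_ae (H2 _ _ sab s'ab); with_ae (G2 _ _ sab s'ab).
with_ae h3; with_ae g3; with_ae h4; with_ae g4; apply: aeW => x.
set h := s' - s in hw *; move: (X s' x) (Y s' x) (X s x) (X' s x) (Y s x) (Y' s x).
move=> x1 y1 x0 x' y0 y' y'J x'K y0J x0K ry rx.
(* Since h^2 <= w |h| on an interval of length w, the second-order bound makes increments Lipschitz
   with constant M (1 + w); the product of two increments is then O(h^2). *)
have lip (z1 z0 z' M : R) : `|z'| <= M -> `|z1 - z0 - h * z'| <= M * h ^+ 2 ->
    `|z1 - z0| <= M * (1 + w) * `|h|.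
  move=> z'M rz; rewrite -(subrK (h * z') (z1 - z0)) (le_trans (ler_normD _ _))//.
  rewrite (le_trans (lerD rz (_ : _ <= `|h| * M)))//.
    by rewrite normrM ler_wpM2l.
  have M0 : 0 <= M by rewrite (le_trans _ z'M).
  rewrite -[h ^+ 2]real_normK ?num_real// expr2 mulrA.
  rewrite -[_ + _]/(M * `|h| * `|h| + `|h| * M).
  rewrite (_ : M * (1 + w) * `|h| = M * `|h| * w + `|h| * M); last by ring.
  by rewrite lerD2r ler_wpM2l// mulr_ge0.
have lx := lip _ _ _ _ x'K rx; have ly := lip _ _ _ _ y'J ry.
rewrite (_ : _ - _ = (x1 - x0) * (y1 - y0) + x0 * (y1 - y0 - h * y') +
  y0 * (x1 - x0 - h * x')); last by ring.
apply: (@le_trans _ _ (L * h ^+ 2)); last first.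
  by rewrite ler_wpM2r ?sqr_ge0// lerDl addr_ge0.
rewrite [leRHS](_ : _ = K * (1 + w) * (J * (1 + w)) * h ^+ 2 + K * J * h ^+ 2 +
  J * K * h ^+ 2); last by rewrite /L; ring.
apply: (le_trans (ler_normD _ _)); apply: lerD.
  apply: (le_trans (ler_normD _ _)); apply: lerD.
    rewrite normrM (le_trans (ler_pM _ _ lx ly))//.
    by rewrite -[h ^+ 2]real_normK ?num_real// expr2 mulrACA.
  by rewrite normrM -mulrA ler_pM.
by rewrite normrM -mulrA ler_pM.
Qed.

Lemma curveZ a b c X X' : curve a b X X' ->
  curve a b (fun s x => c * X s x) (fun s x => c * X' s x).
Proof.
move=> HX; have := curveM (curve_const a b (bdd_cst mu c)) HX.
rewrite (_ : (fun s x => cst 0 x * _ + _) = (fun s x => c * X' s x))//.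
by apply/funext => s; apply/funext => x /=; rewrite mul0r add0r.
Qed.

Lemma curveB a b X X' Y Y' : curve a b X X' -> curve a b Y Y' ->
  curve a b (fun s x => X s x - Y s x) (fun s x => X' s x - Y' s x).
Proof.
move=> HX HY; have := curveD HX (curveZ (-1) HY).
rewrite (_ : (fun s x => X s x + _) = (fun s x => X s x - Y s x)); last first.
  by apply/funext => s; apply/funext => x /=; rewrite mulN1r.
rewrite (_ : (fun s x => X' s x + _) = (fun s x => X' s x - Y' s x))//.
by apply/funext => s; apply/funext => x /=; rewrite mulN1r.
Qed.

Lemma bdd_ln m f : 0 < m -> bdd mu f -> {ae mu, forall x, m <= f x} ->
  bdd mu (fun x => ln (f x)).
Proof.
move=> m0 [mf [K HK]] mf'; split.
  by apply: measurableT_comp => //; exact: measurable_ln.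
exists (`|ln m| + `|ln K|); with_ae HK; with_ae mf'; apply: aeW => x h1 h2.
have f0 := lt_le_trans m0 h1; rewrite gtr0_norm// in h2.
have : ln m <= ln (f x) by rewrite ler_ln ?posrE.
have : ln (f x) <= ln K by rewrite ler_ln ?posrE// (lt_le_trans f0).
have := ler_norm (ln K); have := ler_norm (- ln m); rewrite normrN.
have := normr_ge0 (ln K); have := normr_ge0 (ln m).
by rewrite ler_norml => *; apply/andP; split; lra.
Qed.

Lemma bdd_inv m f : 0 < m -> bdd mu f -> {ae mu, forall x, m <= f x} ->
  bdd mu (fun x => (f x)^-1).
Proof.
move=> m0 Hf mf'; split; last first.
  exists m^-1; with_ae mf'; apply: aeW => x h1.
  have f0 := lt_le_trans m0 h1.
  by rewrite ger0_norm ?invr_ge0 ?(ltW f0)// lef_pV2 ?posrE.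
apply: measurableT_comp; last exact: (proj1 Hf).
(* Measurability of the inverse is read off z exp(- ln(z^2)), which also agrees with it at 0, where
   the inverse is 0. *)
rewrite (_ : @GRing.inv R = fun z => z * expR (- ln (z ^+ 2))).
  apply: measurable_funM => //; apply: measurableT_comp => //.
  apply: measurableT_comp => //; apply: measurableT_comp; first exact: measurable_ln.
  exact: measurable_funX.
apply/funext => z; have [->|z0] := eqVneq z 0; first by rewrite invr0 mul0r.
by rewrite expRN lnK ?posrE ?exprn_even_gt0// expr2 invfM mulVKf.
Qed.

Lemma curve_ln a b m X X' : 0 < m -> curve a b X X' ->
  (forall s, s \in `[a, b] -> {ae mu, forall x, m <= X s x}) ->
  curve a b (fun s x => ln (X s x)) (fun s x => X' s x / X s x).
Proof.
move=> m0 HX mX; have [K K0 [H1 H2]] := HX.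
pose w := `|b - a|; have w0 : 0 <= w by exact: normr_ge0.
pose K1 := Num.max m K.
have m10 : 0 <= m^-1 by rewrite invr_ge0 ltW.
pose lip := K * (1 + w); have lip0 : 0 <= lip by rewrite mulr_ge0// addr_ge0.
pose J := `|ln m| + `|ln K1|.
have J0 : 0 <= J by rewrite addr_ge0.
pose B := m ^- 2 * lip ^+ 2 + K / m.
have B0 : 0 <= B by rewrite addr_ge0// mulr_ge0// ?invr_ge0 ?sqr_ge0.
have Km0 : 0 <= K / m by exact: mulr_ge0.
have JK0 : 0 <= J + K / m by exact: addr_ge0.
exists (J + K / m + B); first exact: addr_ge0.
split=> [s sab|s s' sab s'ab].
  have [h1 h2 h3 h4] := H1 s sab.
  split; [exact: bdd_ln h1 (mX s sab)| |  |].
  - by apply: bddM => //; exact: bdd_inv h1 (mX s sab).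
  - with_ae h3; with_ae (mX s sab); apply: aeW => x g1 g2.
    have x0 := lt_le_trans m0 g1; rewrite gtr0_norm// in g2.
    apply: (@le_trans _ _ J); last by rewrite -addrA lerDl addr_ge0.
    have : ln m <= ln (X s x) by rewrite ler_ln ?posrE.
    have : ln (X s x) <= ln K1 by rewrite ler_ln ?posrE ?lt_max ?m0// le_max g2 orbT.
    have := ler_norm (ln K1); have := ler_norm (- ln m); rewrite normrN.
    have := normr_ge0 (ln K1); have := normr_ge0 (ln m); rewrite /J.
    by rewrite ler_norml => *; apply/andP; split; lra.
  - with_ae h4; with_ae (mX s sab); apply: aeW => x g1 g2.
    have x0 := lt_le_trans m0 g1.
    apply: (@le_trans _ _ (K / m)); last by rewrite addrAC lerDr addr_ge0.
    by rewrite normrM ler_pM// ger0_norm ?invr_ge0 ?(ltW x0)// lef_pV2 ?posrE.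
have hw : `|s' - s| <= w.
  rewrite /w; move: sab s'ab; rewrite !in_itv/= => /andP[? ?] /andP[? ?].
  by rewrite [leRHS]ger0_norm ?ler_norml; last lra; apply/andP; split; lra.
have [_ _ _ h4] := H1 s sab.
with_ae h4; with_ae (H2 _ _ sab s'ab); with_ae (mX s sab); with_ae (mX s' s'ab).
apply: aeW => x; set h := s' - s in hw *.
move: (X s' x) (X s x) (X' s x) => y1 y0 y' my1 my0 rz z'M.
have y00 := lt_le_trans m0 my0.
have lp : `|y1 - y0| <= lip * `|h|.
  rewrite -(subrK (h * y') (y1 - y0)) (le_trans (ler_normD _ _))//.
  rewrite (le_trans (lerD rz (_ : _ <= `|h| * K)))//.
    by rewrite normrM ler_wpM2l.
  rewrite -[h ^+ 2]real_normK ?num_real// expr2 mulrA /lip.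
  rewrite (_ : K * (1 + w) * `|h| = K * `|h| * w + `|h| * K); last by ring.
  by rewrite lerD2r ler_wpM2l// mulr_ge0.
apply: (@le_trans _ _ (B * h ^+ 2)); last first.
  by rewrite ler_wpM2r ?sqr_ge0// lerDr.
rewrite (_ : _ - _ = (ln y1 - ln y0 - (y1 - y0) / y0) + (y1 - y0 - h * y') / y0);
  last by field; lra.
rewrite [leRHS](_ : _ = m ^- 2 * lip ^+ 2 * h ^+ 2 + K / m * h ^+ 2); last by rewrite mulrDl.
apply: (le_trans (ler_normD _ _)); apply: lerD.
  apply: (le_trans (ln_taylor m0 my0 my1)).
  rewrite -mulrA ler_wpM2l ?invr_ge0 ?sqr_ge0//.
  rewrite -exprMn -[leLHS]real_normK ?num_real// -[leRHS]real_normK ?num_real//.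
  by rewrite lerXn2r ?nnegrE// normrM (ger0_norm lip0).
rewrite normrM mulrAC ler_pM// ger0_norm ?invr_ge0 ?(ltW y00)// lef_pV2 ?posrE//.
Qed.

Lemma curve_exp a b f : bdd mu f ->
  curve a b (fun s x => expR (s * f x)) (fun s x => f x * expR (s * f x)).
Proof.
move=> Hf; have [K K0 HK] := bdd_bound Hf.
pose M := (`|a| + `|b|) * K.
have M0 : 0 <= M by rewrite mulr_ge0// addr_ge0.
have sM s x : s \in `[a, b] -> `|f x| <= K -> s * f x <= M.
  rewrite in_itv/= => /andP[sa sb] fK.
  rewrite (le_trans (ler_norm _))// normrM ler_pM// ler_norml.
  have := ler_norm (- a); have := ler_norm b; rewrite normrN.
  by have := normr_ge0 a; have := normr_ge0 b => *; apply/andP; split; lra.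
have bd s : s \in `[a, b] -> bdd mu (fun x => expR (s * f x)).
  move=> sab; split.
    by apply: measurableT_comp => //; apply: measurable_funM => //; exact: (proj1 Hf).
  exists (expR M); with_ae HK; apply: aeW => x /sM H.
  by rewrite ger0_norm ?expR_ge0// ler_expR H.
have e0 : 0 <= expR M by exact: expR_ge0.
exists (expR M * (1 + K + K ^+ 2)); first by rewrite mulr_ge0// !addr_ge0// sqr_ge0.
split=> [s sab|s s' sab s'ab].
  split; [exact: bd|by apply: bddM => //; exact: bd| |].
  - with_ae HK; apply: aeW => x /sM H; rewrite ger0_norm ?expR_ge0//.
    rewrite (@le_trans _ _ (expR M))// ?ler_expR ?H//.
    by rewrite ler_peMr// -addrA lerDl addr_ge0// sqr_ge0.
  - with_ae HK; apply: aeW => x fK; have H := sM s x sab fK.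
    rewrite normrM [`|expR _|]ger0_norm ?expR_ge0//.
    apply: (@le_trans _ _ (K * expR M)).
      by rewrite ler_pM ?expR_ge0 ?ler_expR ?H.
    by rewrite mulrC ler_wpM2l// addrAC lerDr addr_ge0// sqr_ge0.
with_ae HK; apply: aeW => x fK.
have H := expR_taylor (sM s x sab fK) (sM s' x s'ab fK).
rewrite [X in `|_ - X|](_ : _ = (s' * f x - s * f x) * expR (s * f x)); last by ring.
apply: (le_trans H); rewrite (_ : _ ^+ 2 = f x ^+ 2 * (s' - s) ^+ 2); last by ring.
rewrite mulrA ler_wpM2r ?sqr_ge0// ler_wpM2l//.
rewrite (@le_trans _ _ (K ^+ 2))// ?lerDr ?addr_ge0//.
by rewrite -[f x ^+ 2]real_normK ?num_real// lerXn2r ?nnegrE.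
Qed.

(* Discretization into n steps leaves an error of order 1 / n. *)
Lemma curve_le a b X X' : a <= b -> curve a b X X' ->
  (forall s, s \in `[a, b] -> {ae mu, forall x, 0 <= X' s x}) ->
  {ae mu, forall x, X a x <= X b x}.
Proof.
move=> ab [K K0 [H1 H2]] X'0.
pose p (n i : nat) := a + (i%:R / n.+1%:R) * (b - a).
have pab n i : (i <= n.+1)%N -> p n i \in `[a, b].
  move=> i_n; rewrite in_itv/= /p.
  have h1 : 0 <= (i%:R / n.+1%:R : R) by rewrite divr_ge0.
  have h2 : (i%:R / n.+1%:R : R) <= 1 by rewrite ler_pdivrMr ?ltr0n// mul1r ler_nat.
  have d0 : 0 <= b - a by rewrite subr_ge0.
  have h3 := mulr_ge0 h1 d0; have h4 := ler_piMl d0 h2.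
  move: h3 h4; set q := (_ * (b - a)) => h3 h4.
  by apply/andP; split; lra.
have step : {ae mu, forall x, forall n i, (i <= n)%N ->
    X (p n i) x - K * ((b - a) / n.+1%:R) ^+ 2 <= X (p n i.+1) x}.
  apply: ae_foralln => n; apply: ae_foralln => i.
  have [i_n|i_n] := leqP i n; last by apply: aeW.
  with_ae (H2 _ _ (pab n i (leqW i_n)) (pab n i.+1 i_n)).
  with_ae (X'0 _ (pab n i (leqW i_n))); apply: aeW => x x'0 + _.
  have -> : p n i.+1 - p n i = (b - a) / n.+1%:R.
    by rewrite /p -natr1; field; rewrite -?natr1 ?pnatr_eq0//.
  rewrite ler_norml => /andP[h _].
  have : 0 <= (b - a) / n.+1%:R * X' (p n i) x.
    by rewrite mulr_ge0// divr_ge0// subr_ge0.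
  by move: h; set dt := (b - a) / _; set e := _ * dt ^+ 2; set v := dt * _ => ? ?; lra.
with_ae step; apply: aeW => x {}step.
have all n i : (i <= n.+1)%N ->
    X a x - i%:R * (K * ((b - a) / n.+1%:R) ^+ 2) <= X (p n i) x.
  elim: i => [|i ih] i_n; first by rewrite /p !mul0r addr0 subr0.
  apply: le_trans (step n i i_n); rewrite -natr1.
  by have := ih (ltnW i_n); set e := K * _ ^+ 2 => ?; lra.
apply/ler_addgt0Pr => e e0.
pose n := Num.truncn (K * (b - a) ^+ 2 / e).
have := all n n.+1 (leqnn _).
rewrite (_ : p n n.+1 = b); last by rewrite /p divff ?pnatr_eq0// mul1r addrC subrK.
rewrite (_ : n.+1%:R * _ = K * (b - a) ^+ 2 / n.+1%:R); last first.
  by field; rewrite ?nat1r ?natr1 pnatr_eq0.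
have : K * (b - a) ^+ 2 / n.+1%:R <= e.
  have hn : K * (b - a) ^+ 2 / e < n.+1%:R := truncnS_gt _.
  by rewrite ler_pdivrMr ?ltr0n// -ler_pdivrMl// [_^-1 * _]mulrC ltW.
by set v := _ / _ => ? ?; lra.
Qed.

(** The whole space has positive measure. Real-valued curves are treated as curves of constant
    functions, and this brings their conclusions back to the reals. *)
Lemma ae_const (P : Prop) : {ae mu, forall x, P} -> P.
Proof.
move=> H; have mu0 : (0 < mu [set: T])%E.
  by rewrite [X in (_ < X)%E](_ : _ = 1%E) ?lte01//; exact: probability_setT.
have PF := ae_properfilter_algebraOfSetsType mu0.
by have [] := @filter_ex _ _ PF _ H.
Qed.

Lemma curve_Int a b X X' : curve a b X X' ->
  curve a b (fun s => cst (Int mu (X s))) (fun s => cst (Int mu (X' s))).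
Proof.
move=> [K K0 [H1 H2]]; exists K => //; split=> [s sab|s s' sab s'ab].
  have [h1 h2 h3 h4] := H1 s sab; split; [exact: bdd_cst|exact: bdd_cst| |].
    by apply: aeW => x /=; exact: (Int_norm_le h1 h3).
  by apply: aeW => x /=; exact: (Int_norm_le h2 h4).
have [g1 g2 _ _] := H1 s sab; have [g1' _ _ _] := H1 s' s'ab.
apply: aeW => x /=; rewrite -IntZ// -IntB// -IntB//; [|exact: bddB|exact: bddZ].
by apply: Int_norm_le; [by apply: bddB; [exact: bddB|exact: bddZ]|exact: H2].
Qed.

Lemma curve_real_le a b (F F' : R -> R) : a <= b ->
  curve a b (fun s => cst (F s)) (fun s => cst (F' s)) ->
  (forall s, s \in `[a, b] -> 0 <= F' s) -> F a <= F b.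
Proof.
move=> ab HF F'0; apply: ae_const; apply: (curve_le ab HF) => s sab.
by apply: aeW => x; exact: F'0.
Qed.

Lemma curve_real_eq a b (F F' : R -> R) : a <= b ->
  curve a b (fun s => cst (F s)) (fun s => cst (F' s)) ->
  (forall s, s \in `[a, b] -> F' s = 0) -> F a = F b.
Proof.
move=> ab HF F'0; apply/eqP; rewrite eq_le (curve_real_le ab HF)/=; last first.
  by move=> s /F'0 ->.
have := @curve_real_le _ _ (fun s => -1 * F s) (fun s => -1 * F' s) ab (curveZ (-1) HF).
rewrite !mulN1r lerN2; apply=> s /F'0 ->.
by rewrite mulr0.
Qed.

Lemma curve_sub a b a' b' X X' : a <= a' -> b' <= b -> curve a b X X' ->
  curve a' b' X X'.
Proof.
move=> aa' bb' [K K0 [H1 H2]]; exists K => //.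
have sub s : s \in `[a', b'] -> s \in `[a, b].
  by rewrite !in_itv/= => /andP[h1 h2]; rewrite (le_trans aa' h1) (le_trans h2 bb').
by split=> [s /sub|s s' /sub ? /sub ?]; [exact: H1|exact: H2].
Qed.

Lemma curve_cst_exp a b (c : R) :
  curve a b (fun s => cst (expR (s * c))) (fun s => cst (c * expR (s * c))).
Proof. exact: (curve_exp a b (bdd_cst mu c)). Qed.

(* F'' >= c F' makes exp(- c s) F' s nondecreasing. *)
Lemma curve_gronwall (c t : R) (F F' F'' : R -> R) : 0 < c -> 0 <= t ->
  curve 0 t (fun s => cst (F s)) (fun s => cst (F' s)) ->
  curve 0 t (fun s => cst (F' s)) (fun s => cst (F'' s)) ->
  (forall s, s \in `[0, t] -> c * F' s <= F'' s) ->
  F t - F 0 <= (1 - expR (- (c * t))) / c * F' t.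
Proof.
move=> c0 t0 CF CF' H.
have mono s : s \in `[0, t] -> expR (s * - c) * F' s <= expR (t * - c) * F' t.
  move=> sab; have [s0 st] : 0 <= s /\ s <= t by move: sab; rewrite in_itv/= => /andP[].
  have C := curveM (curve_cst_exp s t (- c)) (curve_sub s0 (lexx t) CF').
  apply: (@curve_real_le s t (fun s => expR (s * - c) * F' s)
    (fun s => - c * expR (s * - c) * F' s + expR (s * - c) * F'' s) st C) => r.
  rewrite in_itv/= => /andP[sr rt].
  have /H h : r \in `[0, t] by rewrite in_itv/= rt (le_trans s0).
  rewrite (_ : _ + _ = expR (r * - c) * (F'' r - c * F' r)); last by ring.
  by rewrite mulr_ge0 ?expR_ge0// subr_ge0.
(* The monotonicity just proved reads F'(s) <= K e^(c s); integrating it means that K / c e^(c s) -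
   F(s) is nondecreasing. *)
pose K := expR (t * - c) * F' t.
have C := curveB (curveZ (K / c) (curve_cst_exp 0 t c)) CF.
have := @curve_real_le 0 t (fun s => K / c * expR (s * c) - F s)
    (fun s => K / c * (c * expR (s * c)) - F' s) t0 C.
have D s : s \in `[0, t] -> 0 <= K / c * (c * expR (s * c)) - F' s.
  move=> /mono h; rewrite subr_ge0 -(ler_pM2l (expR_gt0 (s * - c))).
  rewrite [leRHS](_ : _ = expR (s * - c + s * c) * K); last first.
    by rewrite expRD; field; rewrite gt_eqF.
  by rewrite -mulrDr addNr mulr0 expR0 mul1r.
move=> /(_ D); rewrite mul0r expR0 mulr1 => h.
rewrite (_ : _ / c * F' t = K / c * expR (t * c) - K / c); first by lra.
rewrite /K mulrN [t * c]mulrC expRN; field.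
by rewrite !gt_eqF ?expR_gt0.
Qed.

Lemma curve_cst_inv (a b : R) : 0 < a ->
  curve a b (fun s => cst s^-1) (fun s => cst (- s ^- 2)).
Proof.
move=> a0; have p n : 0 < a ^- n by rewrite invr_gt0 exprn_gt0.
have le n s : s \in `[a, b] -> 0 < s ^- n <= a ^- n.
  rewrite in_itv/= => /andP[as' _]; have s0 := lt_le_trans a0 as'.
  rewrite invr_gt0 exprn_gt0//= lef_pV2 ?posrE ?exprn_gt0//.
  by apply: lerXn2r; rewrite // nnegrE ltW.
exists (a ^- 1 + a ^- 2 + a ^- 3); first by rewrite !addr_ge0// ltW.
split=> [s sab|s s' sab s'ab].
  split; [exact: bdd_cst|exact: bdd_cst| |]; apply: aeW => x /=.
    have /andP[h1 h2] := le 1%N s sab; rewrite -[s]expr1 gtr0_norm//.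
    by rewrite (le_trans h2)// -addrA lerDl addr_ge0// ltW.
  have /andP[h1 h2] := le 2%N s sab; rewrite normrN gtr0_norm//.
  by rewrite (le_trans h2)// addrAC lerDr addr_ge0// ltW.
apply: aeW => x /=.
have /andP[h1 h2] := le 2%N s sab; have /andP[g1 g2] := le 1%N s' s'ab.
have s0 : 0 < s by move: sab; rewrite in_itv/= => /andP[/(lt_le_trans a0)].
have s'0 : 0 < s' by move: s'ab; rewrite in_itv/= => /andP[/(lt_le_trans a0)].
rewrite (_ : _ - _ = s ^- 2 * s' ^- 1 * (s' - s) ^+ 2); last by field; rewrite !gt_eqF.
have i0 : 0 <= s ^- 2 * s' ^- 1 by apply: mulr_ge0; exact: ltW.
rewrite normrM (ger0_norm i0) (ger0_norm (sqr_ge0 _)) ler_wpM2r ?sqr_ge0//.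
rewrite (@le_trans _ _ (a ^- 3))//; last by rewrite lerDr addr_ge0// ltW.
rewrite (_ : a ^- 3 = a ^- 2 * a ^- 1); last by field; rewrite gt_eqF.
by rewrite ler_pM// ltW.
Qed.

End Curves.

(** * The constant *)

Section Constants.
Context {R : realType}.
Implicit Types (rho alpha t s : R).

Definition herbst_const s : R := 1 / (2 * s) * ln ((s + 1) / (s - 1)).

Lemma continuous_herbst_const s : 1 < s -> {for s, continuous herbst_const}.
Proof.
move=> s1; have s0 : 0 < s by rewrite (lt_trans ltr01).
have s10 : 0 < s - 1 by rewrite subr_gt0.
apply: cvgM.
  apply: cvgM; first exact: cvg_cst.
  apply: cvgV; first by rewrite mulf_neq0// gt_eqF.
  by apply: cvgM; [exact: cvg_cst|exact: cvg_id].
apply: continuous_cvg.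
  by apply: continuous_ln; rewrite divr_gt0// addr_gt0.
apply: cvgM; first by apply: cvgD; [exact: cvg_id|exact: cvg_cst].
apply: cvgV; first by rewrite gt_eqF.
by apply: cvgB; [exact: cvg_id|exact: cvg_cst].
Qed.

(* The numerator and the denominator in [c_formula] share the factor
   e^(rho t) a - 1, up to which the fraction is (s + 1) / (s - 1). *)
Lemma c_formulaE rho t s : 0 < rho -> 0 < t -> 1 < s ->
  let alpha := s ^+ 2 * ((1 - expR (- (2 * rho * t))) / (2 * rho)) in
  expR (rho * t) * a_ rho alpha t != 1 ->
  c_formula rho t alpha = herbst_const s.
Proof.
move=> rho0 t0 s1 alpha.
have s0 : 0 < s by rewrite (lt_trans ltr01).
pose E := expR (rho * t); have E0 : 0 < E by exact: expR_gt0.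
have q : expR (- (2 * rho * t)) = E ^- 2.
  by rewrite /E -expRM_natl expRN; congr (expR _)^-1; ring.
have q' : expR (2 * rho * t) = E ^+ 2 by rewrite /E -expRM_natl; congr expR; ring.
have E1 : 1 < E by rewrite expR_gt1 mulr_gt0.
have r0 : 0 < 1 - E ^- 2.
  by rewrite subr_gt0 invf_lt1 ?exprn_gt0// exprn_egt1.
have alphaE : 2 * rho * alpha = s ^+ 2 * (1 - E ^- 2).
  by rewrite /alpha q; field; rewrite !gt_eqF.
have aE : a_ rho alpha t = s * (1 - E ^- 2) * E.
  rewrite /a_ alphaE q' (_ : _ * _ = (s * (1 - E ^- 2) * E) ^+ 2); last first.
    by field; rewrite gt_eqF.
  by rewrite sqrtr_sqr ger0_norm// !mulr_ge0// ltW.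
rewrite /c_formula aE alphaE q -/E => Ea1.
rewrite /herbst_const; congr (_ * ln _).
  rewrite sqrtrM ?sqr_ge0// sqrtr_sqr ger0_norm ?(ltW s0)//.
  by field; rewrite !gt_eqF// sqrtr_gt0.
have n1 : E * (s * (1 - E ^- 2) * E) - 1 != 0 by rewrite subr_eq0.
have n2 : s - 1 != 0 by rewrite gt_eqF// subr_gt0.
have n3 : E * (s * (1 - E ^- 2) * E) + 1 != 0.
  by rewrite gt_eqF// addr_gt0// !mulr_gt0.
have n4 : - (E * (s * (1 - E ^- 2) * E)) + 1 + (s * (1 - E ^- 2) * E) ^+ 2 - E ^- 2 != 0.
  rewrite (_ : _ - _ = (1 - E ^- 2) * (s - 1) * (E * (s * (1 - E ^- 2) * E) - 1)).
    by rewrite !mulf_neq0// gt_eqF.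
  by field; rewrite gt_eqF.
apply/eqP; rewrite eqr_div ?mulf_neq0//; apply/eqP.
by field; rewrite gt_eqF.
Qed.

(** At the exceptional [alpha] the constant is a limit. As [a_] is injective in positive [alpha], no
    other exceptional value lies nearby, so that the formula coincides with the continuous function
    [herbst_const] on a punctured neighbourhood. *)
Lemma c_E rho t s : 0 < rho -> 0 < t -> 1 < s ->
  c_ rho (s ^+ 2 * ((1 - expR (- (2 * rho * t))) / (2 * rho))) t = herbst_const s.
Proof.
move=> rho0 t0 s1; rewrite /c_; case: ifPn => [/eqP Ea|]; last exact: c_formulaE.
set C := _ / _ in Ea *.
have C0 : 0 < C.
  by rewrite divr_gt0 ?mulr_gt0// subr_gt0 expR_lt1 oppr_lt0 !mulr_gt0.
have s0 : 0 < s by rewrite (lt_trans ltr01).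
pose S (b : R) := Num.sqrt (b / C).
have Ss : S (s ^+ 2 * C) = s by rewrite /S mulfK ?gt_eqF// sqrtr_sqr gtr0_norm.
have bE b : 0 < b -> b = S b ^+ 2 * C.
  by move=> b0; rewrite /S sqr_sqrtr ?divfK ?gt_eqF// divr_ge0// ltW.
have cS : {for s ^+ 2 * C, continuous S}.
  apply: continuous_cvg; first exact: sqrt_continuous.
  by apply: cvgM; [exact: cvg_id|exact: cvg_cst].
have cH : herbst_const (S b) @[b --> (s ^+ 2 * C)^'] --> herbst_const s.
  rewrite -[in X in _ --> X]Ss; apply: cvg_within_filter.
  by apply: continuous_cvg => //; apply: continuous_herbst_const; rewrite Ss.
apply/cvg_lim => //; apply: cvg_trans cH; apply: near_eq_cvg.
have b1 : \forall b \near (s ^+ 2 * C)^', 1 < S b.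
  by apply: cvg_within; apply: (cvgr_gt _ cS); rewrite Ss.
have b0 : \forall b \near (s ^+ 2 * C)^', 0 < b.
  by apply: cvg_within; apply: (cvgr_gt (s ^+ 2 * C) cvg_id); rewrite mulr_gt0// exprn_gt0.
have bn : \forall b \near (s ^+ 2 * C)^', b != s ^+ 2 * C by exact: nbhs_dnbhs_neq.
apply: filterS3 b0 b1 bn => b p0 p1 pn.
rewrite {2}(bE b p0) c_formulaE// -/C -(bE b p0).
apply: contraNneq pn => Eb; apply/eqP.
have : a_ rho b t = a_ rho (s ^+ 2 * C) t.
  by apply: (mulfI (_ : expR (rho * t) != 0)); rewrite ?gt_eqF ?expR_gt0// Eb Ea.
rewrite /a_ => /eqP.
have K0 : 0 < expR (2 * rho * t) - 1 by rewrite subr_gt0 expR_gt1 !mulr_gt0.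
have sC0 : 0 < s ^+ 2 * C by rewrite mulr_gt0 ?exprn_gt0.
have A0 z : 0 < z -> 0 <= 2 * rho * z * (expR (2 * rho * t) - 1).
  by move=> z0; rewrite ltW// mulr_gt0// mulr_gt0// mulr_gt0.
rewrite (eqr_sqrt (A0 _ p0) (A0 _ sC0)).
have K1 : expR (2 * rho * t) - 1 != 0 by rewrite gt_eqF.
have r2 : 2 * rho != 0 by rewrite gt_eqF// mulr_gt0.
by move=> /eqP /(mulIf K1) /(mulfI r2).
Qed.

Lemma threshold_E rho t : 0 < rho -> 0 < t ->
  (expR (2 * rho * t) + expR (- (2 * rho * t)) - 2) / (2 * rho * (expR (2 * rho * t) - 1)) =
  (1 - expR (- (2 * rho * t))) / (2 * rho).
Proof.
move=> rho0 t0; rewrite expRN; have e0 := expR_gt0 (2 * rho * t).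
have e1 : 0 < expR (2 * rho * t) - 1 by rewrite subr_gt0 expR_gt1 !mulr_gt0.
by field; rewrite !gt_eqF.
Qed.

Lemma cvg_expRN_pinfty (c : R) : 0 < c -> expR (- (c * t)) @[t --> +oo] --> (0 : R).
Proof.
move=> c0; apply/cvgrPdist_le => e e0; near=> t.
have t0 : 0 < t by near: t; exact: (nbhs_pinfty_gt (num_real _)).
have te : (c * e)^-1 <= t by near: t; exact: (nbhs_pinfty_ge (num_real _)).
rewrite sub0r normrN gtr0_norm ?expR_gt0// expRN invf_ple ?posrE ?expR_gt0//.
rewrite (le_trans _ (expR_ge1Dx _))// (@le_trans _ _ (c * t)) ?lerDr//.
by rewrite -ler_pdivrMl// -invfM.
Unshelve. all: by end_near.
Qed.

End Constants.

(** * Markov diffusion semigroups *)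

Ltac bounded := repeat (first [assumption | apply: bddB | apply: bddD | apply: bddN |
  apply: bddM | exact: bdd_cst]).

Section MarkovDiffusion.
Context {R : realType} {d : measure_display} {T : measurableType d}.
Variables (mu : probability T R) (P : R -> (T -> R) -> T -> R)
  (L : (T -> R) -> T -> R) (A : set (T -> R)) (rho : R).
Hypotheses (P_markov : markov_semigroup mu P) (L_generator : is_generator mu P L)
  (L_self_adjoint : self_adjoint mu (generator_domain mu P) L)
  (A_admissible : admissible_class mu P L A) (L_diffusion : diffusion mu L A)
  (rho_gt0 : 0 < rho) (L_curvature : curvature mu L A rho).
Implicit Types f g k u : T -> R.

Local Notation bdd := (bdd mu).
Local Notation Int := (Int mu).
Local Notation G := (Gamma L).

Lemma P_lin t a f g : 0 <= t -> bdd f -> bdd g ->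
  {ae mu, forall x, P t (fun y => a * f y + g y) x = a * P t f x + P t g x}.
Proof. by move=> t0 Hf Hg; apply: ms_linear => //; exact: bdd_L2. Qed.

Lemma PD t f g : 0 <= t -> bdd f -> bdd g ->
  {ae mu, forall x, P t (fun y => f y + g y) x = P t f x + P t g x}.
Proof.
move=> t0 Hf Hg; with_ae (P_lin 1 t0 Hf Hg); apply: aeW => x.
by rewrite mul1r (_ : (fun y => 1 * f y + g y) = (fun y => f y + g y))//;
  apply/funext => y; rewrite mul1r.
Qed.

Lemma P0 t : 0 <= t -> {ae mu, forall x, P t (cst 0) x = 0}.
Proof.
(* Linearity is applied to 0 = (-1) 0 + 0. *)
move=> t0; with_ae (P_lin (-1) t0 (bdd_cst mu 0) (bdd_cst mu 0)); apply: aeW => x.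
rewrite (_ : (fun y : T => _) = cst 0); last by apply/funext => y /=; rewrite mulr0 addr0.
by rewrite mulN1r addNr.
Qed.

Lemma PZ t a f : 0 <= t -> bdd f ->
  {ae mu, forall x, P t (fun y => a * f y) x = a * P t f x}.
Proof.
move=> t0 Hf; with_ae (P_lin a t0 Hf (bdd_cst mu 0)); with_ae (P0 t0); apply: aeW => x ->.
by rewrite (_ : (fun y : T => _ + _) = (fun y => a * f y)) ?addr0//;
  apply/funext => y /=; rewrite addr0.
Qed.

Lemma P_cst t c : 0 <= t -> {ae mu, forall x, P t (cst c) x = c}.
Proof.
move=> t0; with_ae (PZ c t0 (bdd_cst mu 1)); with_ae (ms_unit P_markov t0).
apply: aeW => x ->; rewrite mulr1.
by rewrite (_ : (fun y : T => _) = cst c)//; apply/funext => y /=; rewrite mulr1.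
Qed.

Lemma PB t f g : 0 <= t -> bdd f -> bdd g ->
  {ae mu, forall x, P t (fun y => f y - g y) x = P t f x - P t g x}.
Proof.
move=> t0 Hf Hg; with_ae (P_lin (-1) t0 Hg Hf); apply: aeW => x.
rewrite mulN1r addrC (_ : (fun y => _ + _) = (fun y => f y - g y))//.
by apply/funext => y; rewrite mulN1r addrC.
Qed.

Lemma P_le t f g : 0 <= t -> bdd f -> bdd g ->
  {ae mu, forall x, f x <= g x} -> {ae mu, forall x, P t f x <= P t g x}.
Proof.
move=> t0 Hf Hg fg.
have : {ae mu, forall x, 0 <= P t (fun y => g y - f y) x}.
  apply: (ms_positive P_markov) => //; first exact/bdd_L2/bddB.
  by with_ae fg; apply: aeW => x; rewrite subr_ge0.
move=> H; with_ae H; with_ae (PB t0 Hg Hf); apply: aeW => x ->.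
by rewrite subr_ge0.
Qed.

Lemma P_bound t f K : 0 <= t -> bdd f ->
  {ae mu, forall x, `|f x| <= K} -> {ae mu, forall x, `|P t f x| <= K}.
Proof.
move=> t0 Hf fK.
have h1 : {ae mu, forall x, P t f x <= P t (cst K) x}.
  apply: P_le => //; first exact: bdd_cst.
  by with_ae fK; apply: aeW => x; rewrite ler_norml => /andP[].
have h2 : {ae mu, forall x, P t (cst (- K)) x <= P t f x}.
  apply: P_le => //; first exact: bdd_cst.
  by with_ae fK; apply: aeW => x; rewrite ler_norml => /andP[].
with_ae h1; with_ae h2; with_ae (P_cst K t0); with_ae (P_cst (- K) t0).
by apply: aeW => x -> -> ? ?; rewrite ler_norml; apply/andP.
Qed.

Lemma bddP t f : 0 <= t -> bdd f -> bdd (P t f).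
Proof.
move=> t0 Hf; split; first exact: (Lfun_measurable (ms_L2 P_markov t0 (bdd_L2 Hf))).
by have [K _ HK] := bdd_bound Hf; exists K; exact: P_bound.
Qed.

Lemma P_ge t f c : 0 <= t -> bdd f ->
  {ae mu, forall x, c <= f x} -> {ae mu, forall x, c <= P t f x}.
Proof.
move=> t0 Hf cf; have := P_le t0 (bdd_cst mu c) Hf cf.
by move=> H; with_ae H; with_ae (P_cst c t0); apply: aeW => x ->.
Qed.

Lemma P_sqr_le t f : 0 <= t -> bdd f ->
  Int (fun x => P t f x ^+ 2) <= Int (fun x => f x ^+ 2).
Proof.
move=> t0 Hf; have := ms_contraction P_markov t0 (bdd_L2 Hf).
rewrite !LnormE//; last exact: bddP.
rewrite lee_fin ler_sqrt// Int_ge0//; first exact: bdd_sqr.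
by apply: aeW => x; exact: sqr_ge0.
Qed.

Lemma curve_P a b X X' t : 0 <= t -> curve mu a b X X' ->
  curve mu a b (fun s => P t (X s)) (fun s => P t (X' s)).
Proof.
move=> t0 [K K0 [H1 H2]]; exists K => //; split=> [s sab|s s' sab s'ab].
  have [h1 h2 h3 h4] := H1 s sab.
  by split; [exact: bddP|exact: bddP|exact: P_bound|exact: P_bound].
have [h1 h2 _ _] := H1 s sab; have [h1' _ _ _] := H1 s' s'ab.
have B1 := bddB h1' h1; have B2 := bddZ (s' - s) h2.
have := P_bound t0 (bddB B1 B2) (H2 _ _ sab s'ab).
move=> H; with_ae H; with_ae (PB t0 B1 B2); with_ae (PB t0 h1' h1); with_ae (PZ (s' - s) t0 h2).
by apply: aeW => x -> -> ->.
Qed.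

(** * Pointwise increments of the semigroup from its L^2 derivative *)

Section Telescoping.
Variables (f g m : T -> R) (c : R).
Hypotheses (Bf : bdd f) (Bg : bdd g) (Bm : bdd m) (Gfg : generator_graph mu P f g).

(* P_h f - f is the Riemann sum of P_tau g over [0, h] up to an error
   which tends to 0 in L^2 with the mesh. *)
Lemma P_increment (h : R) : 0 <= h ->
  (forall tau, 0 <= tau <= h -> {ae mu, forall x, `|P tau g x - m x| <= c}) ->
  {ae mu, forall x, `|P h f x - f x - h * m x| <= h * c}.
Proof.
rewrite le_eqVlt => /predU1P[<- _|h0 Hc].
  with_ae (ms_0 P_markov (bdd_L2 Bf)); apply: aeW => x ->.
  by rewrite subrr !mul0r subrr normr0.
pose e (t : R) x := (P t f x - f x) / t - g x.
have Be t : 0 < t -> bdd (e t).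
  move=> t0; apply: bddB => //; apply: bddM; last exact: bdd_cst.
  by apply: bddB => //; exact: (bddP (ltW _)).
have e_small : forall eps, 0 < eps ->
    exists n : nat, Int (fun x => e (h / n.+1%:R) x ^+ 2) <= eps.
  have [_ _ Hg] := Gfg.
  move=> eps eps0.
  have := @Lpdist_cvg0 _ _ _ mu (0^'+) _ g _ _ Bg _ Hg eps eps0.
  case=> [t t0| |eta eta0 Heta].
  - apply: bddM; last exact: bdd_cst.
    by apply: bddB => //; exact: (bddP (ltW _)).
  - exact: nbhs_right_gt.
  exists (Num.truncn (h / eta)).
  have hn : h / eta < (Num.truncn (h / eta)).+1%:R := truncnS_gt _.
  apply: Heta; last by rewrite divr_gt0.
  rewrite /= sub0r normrN gtr0_norm ?divr_gt0//.
  by rewrite ltr_pdivrMr ?ltr0n// mulrC -ltr_pdivrMr.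
pose W x := `|P h f x - f x - h * m x| - h * c.
have BW : bdd W.
  apply: bddB; last exact: bdd_cst.
  apply: bdd_norm; apply: bddB; last exact: bddZ.
  by apply: bddB => //; exact: (bddP (ltW _)).
suff : {ae mu, forall x, W x <= 0}.
  by move=> H; with_ae H; apply: aeW => x; rewrite /W subr_le0.
apply: (ae_le0_L2 BW) => eps eps0.
(* The residual [r] below is t = h / (n + 1) times a sum of n + 1 images of [e t] under L^2
   contractions, so its squared norm is at most h^2 times that of [e t]. *)
have [n Hn] := e_small (eps / h ^+ 2) (divr_gt0 eps0 (exprn_gt0 2 h0)).
set t := h / n.+1%:R in Hn.
have t0 : 0 < t by rewrite /t divr_gt0.
have it0 (i : nat) : 0 <= i%:R * t by rewrite mulr_ge0// ltW.
pose r x := t * \sum_(i < n.+1) P (i%:R * t) (e t) x.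
have Br : bdd r.
  by apply: bddZ; apply: bdd_sum => i; apply: bddP => //; exact: Be.
exists r; split => //.
  apply: (@le_trans _ _ (Int (fun x => t ^+ 2 * (n.+1%:R *
      \sum_(i < n.+1) P (i%:R * t) (e t) x ^+ 2)))).
    apply: Int_le; [exact: bdd_sqr| |].
      apply/bddZ/bddZ/bdd_sum => i; apply/bdd_sqr/bddP => //; exact: Be.
    apply: aeW => x; rewrite /r exprMn ler_wpM2l ?sqr_ge0//.
    exact: sqr_sum_le.
  have Bs i : bdd (fun x => P (i%:R * t) (e t) x ^+ 2).
    by apply/bdd_sqr/bddP => //; exact: Be.
  rewrite IntZ; last by apply/bddZ/bdd_sum.
  rewrite IntZ; last exact: bdd_sum.
  rewrite Int_sum//.
  apply: (@le_trans _ _ (t ^+ 2 * (n.+1%:R * (n.+1%:R * (eps / h ^+ 2))))).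
    rewrite ler_wpM2l ?sqr_ge0// ler_wpM2l// -[n.+1 in leRHS]card_ord mulr_natl -sumr_const.
    by apply: ler_sum => i _; apply: le_trans Hn; apply: P_sqr_le => //; exact: Be.
  by rewrite /t le_eqVlt; apply/orP; left; apply/eqP; field; rewrite ?nat1r ?natr1 pnatr_eq0 gt_eqF.
(* By definition of [e t], P_t f = f + t (e t + g); the semigroup at time i t is applied to this
   identity. *)
have step : {ae mu, forall x, forall i : nat, P (i.+1%:R * t) f x =
    P (i%:R * t) f x + t * (P (i%:R * t) (e t) x + P (i%:R * t) g x)}.
  apply: ae_foralln => i.
  have := ms_add P_markov (it0 i) (ltW t0) (bdd_L2 Bf).
  have eE : P t f = fun y => t * (e t y + g y) + f y.
    by apply/funext => y; rewrite /e; field; rewrite gt_eqF.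
  move=> H; with_ae H; with_ae (P_lin t (it0 i) (bddD (Be t t0) Bg) Bf).
  with_ae (PD (it0 i) (Be t t0) Bg); apply: aeW => x h1 h2.
  rewrite eE h2 h1 (_ : i%:R * t + t = i.+1%:R * t); last by rewrite -natr1; ring.
  by move=> ->; rewrite addrC.
have Hm : {ae mu, forall x, forall i : nat, (i <= n)%N -> `|P (i%:R * t) g x - m x| <= c}.
  apply: ae_foralln => i; have [i_n|i_n] := leqP i n; last by apply: aeW.
  have : 0 <= i%:R * t <= h.
    rewrite it0/= /t mulrA ler_pdivrMr ?ltr0n// mulrC ler_wpM2l ?(ltW h0)//.
    by rewrite ler_nat ltnW.
  by move=> /Hc H; with_ae H; apply: aeW => x ? _.
with_ae step; with_ae Hm; with_ae (ms_0 P_markov (bdd_L2 Bf)); apply: aeW => x p0 {}Hm {}step.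
have tel (k : nat) : (k <= n.+1)%N -> P (k%:R * t) f x = f x +
    t * \sum_(i < k) P (i%:R * t) (e t) x + t * \sum_(i < k) P (i%:R * t) g x.
  elim: k => [|k ih] kn; first by rewrite mul0r p0 !big_ord0 !mulr0 !addr0.
  by rewrite step ih ?(ltnW kn)// !big_ord_recr/=; ring.
have := tel n.+1 (leqnn _); rewrite -/(r x).
have -> : n.+1%:R * t = h by rewrite /t; field; rewrite ?nat1r ?natr1 pnatr_eq0.
rewrite /W => ->; rewrite lerBlDr.
have hE : h * m x = t * \sum_(i < n.+1) m x.
  rewrite sumr_const card_ord -[m x *+ _]mulr_natl /t; field.
  by rewrite ?nat1r ?natr1 pnatr_eq0.
rewrite (_ : _ - _ = r x + t * \sum_(i < n.+1) (P (i%:R * t) g x - m x)); last first.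
  by rewrite sumrB hE; ring.
rewrite (le_trans (ler_normD _ _))// lerD2l normrM gtr0_norm//.
rewrite (_ : h * c = t * \sum_(i < n.+1) c); last first.
  rewrite sumr_const card_ord -[c *+ _]mulr_natl /t; field.
  by rewrite ?nat1r ?natr1 pnatr_eq0.
rewrite ler_wpM2l ?(ltW t0)// (le_trans (ler_norm_sum _ _ _))//.
by apply: ler_sum => i _; apply: Hm; rewrite -ltnS.
Qed.

End Telescoping.

(** * The admissible class as an algebra of bounded functions *)

Lemma A_term n (e : term n) (f : 'I_n -> T -> R) :
  (forall i, A (f i)) -> A (fun x => eval e (\row_i f i x)).
Proof. by move=> Af; exact: (ac_smooth A_admissible (smooth_eval e) Af). Qed.

Definition vec (s : seq (T -> R)) (i : 'I_(size s)) : T -> R := nth (cst 0) s i.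

Lemma A_vec (s : seq (T -> R)) : (forall f, List.In f s -> A f) ->
  forall i : 'I_(size s), A (vec i).
Proof.
elim: s => [|f s ih] As [i Hi] //; rewrite /vec/=.
case: i Hi => [|i] Hi /=; first by apply: As; left.
by apply: (ih _ (Ordinal (Hi : (i < size s)%N))) => g gs; apply: As; right.
Qed.

Lemma A_app (F : jet) f : A f -> A (fun x => F 0%N (f x)).
Proof.
move=> Af; have := @A_term 1 (App F 0 (Var ord0)) (fun=> f) (fun=> Af).
by rewrite (_ : (fun x => eval _ _) = (fun x => F 0%N (f x)))//;
  apply/funext => x /=; rewrite mxE.
Qed.

Lemma A_mul f g : A f -> A g -> A (fun x => f x * g x).
Proof.
move=> Af Ag.
have := @A_term 2 (Mul (Var ord0) (Var (lift ord0 ord0))) (@vec [:: f; g]).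
rewrite (_ : (fun x => eval _ _) = (fun x => f x * g x)).
  by apply; apply: (@A_vec [:: f; g]) => h /= [<-//|[<-//|[]]].
by apply/funext => x /=; rewrite !mxE.
Qed.

Lemma A_add f g : A f -> A g -> A (fun x => f x + g x).
Proof.
move=> Af Ag.
have := @A_term 2 (Add (Var ord0) (Var (lift ord0 ord0))) (@vec [:: f; g]).
rewrite (_ : (fun x => eval _ _) = (fun x => f x + g x)).
  by apply; apply: (@A_vec [:: f; g]) => h /= [<-//|[<-//|[]]].
by apply/funext => x /=; rewrite !mxE.
Qed.

Lemma A_scale c f : A f -> A (fun x => c * f x).
Proof. by move=> Af; exact: (A_mul (ac_cst A_admissible c) Af). Qed.

Lemma A_sub f g : A f -> A g -> A (fun x => f x - g x).
Proof.
move=> Af Ag; have := A_add Af (A_scale (-1) Ag).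
by rewrite (_ : (fun x => _ + _) = (fun x => f x - g x))//;
  apply/funext => x; rewrite mulN1r.
Qed.

Lemma A_L2 f : A f -> f \in Lfun mu 2%:E.
Proof. by apply: (ac_Lp A_admissible); rewrite ltr1n. Qed.

(* An unbounded element h would yield a smooth function of h growing too fast
   to be integrable. *)
Lemma A_bdd f : A f -> bdd f.
Proof.
move=> Af; split; first exact: Lfun_measurable (A_L2 Af).
pose h x := f x * f x; have Ah : A h by exact: A_mul.
have mh : measurable_fun setT h := Lfun_measurable (A_L2 Ah).
have [[n Hn]|Hno] := pselect (exists n : nat, {ae mu, forall x, h x <= n%:R}).
  exists (n%:R + 1); with_ae Hn; apply: aeW => x; rewrite /h => hx.
  have [f1|f1] := lerP `|f x| 1; first by rewrite (le_trans f1)// lerDr.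
  rewrite (@le_trans _ _ (`|f x| * `|f x|))// ?ler_peMl ?(ltW f1)//.
  by rewrite -normrM ger0_norm ?(le_trans hx) ?lerDl// -expr2 sqr_ge0.
exfalso.
pose E (n : nat) := h @^-1` `[n%:R, +oo[%classic.
have mE n : measurable (E n).
  by rewrite -[E n]setTI; apply: mh => //; exact: measurable_itv.
have E0 n : (0 < mu (E n))%E.
  rewrite lt0e measure_ge0 andbT; apply/eqP => H; apply: Hno; exists n.
  exists (E n); split => // x /= /negP; rewrite -ltNge => /ltW hx.
  by rewrite /E/= in_itv/= hx.
have Efin n : mu (E n) \is a fin_num by exact: fin_num_measure.
(* With this choice, a function above [M n] on [E n] has integral at least n. The smooth function
   [g] of [h] satisfies this for every n > 0, hence is not integrable. *)
pose M (n : nat) : R := n%:R / fine (mu (E n)).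
have M0 n : 0 <= M n by rewrite divr_ge0// fine_ge0.
pose g x := pseries_fun (fast_coeff M) (h x).
have Ag : A g by exact: (A_app (pseries_jet (@entire_fast_coeff _ M)) Ah).
have /Lfun1_integrable/integrableP[mg] : g \in Lfun mu 1.
  apply: Lfun_subset12 (A_L2 Ag); exact: fin_num_measure.
apply/negP; rewrite -leNgt leye_eq; apply/eqP/eqyP => r r0.
pose n := (Num.truncn r).+1.
have rn : r <= n%:R by rewrite ltW// truncnS_gt.
apply: (@le_trans _ _ (\int[mu]_x (M n * \1_(E n) x)%:E)%E).
  have -> : (\int[mu]_x (M n * \1_(E n) x)%:E = n%:R%:E)%E.
    under eq_integral do rewrite EFinM.
    rewrite integralZl//; last exact: integrable_indic.
    rewrite integral_indic// [X in (_ * X)%E](_ : _ = (fine (mu (E n)))%:E); last first.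
      by rewrite setIT; exact/esym/fineK.
    rewrite -EFinM /M divfK//.
    by rewrite gt_eqF// fine_gt0// E0 ltey_eq Efin.
  by rewrite lee_fin.
apply: ge0_le_integral => //.
- by move=> x _; rewrite lee_fin mulr_ge0.
- by apply/measurable_EFinP; apply: measurable_funM => //; exact: measurable_indic.
- exact: measurableT_comp.
- move=> x _; rewrite lee_fin; have [xE|xE] := pselect (E n x).
    rewrite indicE mem_set//= mulr1 (le_trans _ (ler_norm _))//.
    by apply: fast_growth => //; move: xE; rewrite /E/= in_itv/= andbT.
  by rewrite indicE memNset// mulr0.
Qed.

(** * The generator and the semigroup on the admissible class *)

Lemma L_graph f : A f -> generator_graph mu P f (L f).
Proof. by move=> Af; exact: (L_generator (ac_domain A_admissible Af)). Qed.

Lemma A_L f : A f -> A (L f).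
Proof. exact: (ac_generator A_admissible). Qed.

Lemma bdd_L f : A f -> bdd (L f).
Proof. by move=> /A_L/A_bdd. Qed.

Lemma domain_dual f u : A f -> generator_domain mu P u ->
  (\int[mu]_x (f x * L u x)%:E = \int[mu]_x (L f x * u x)%:E)%E.
Proof.
move=> Af; have [_ sa] := L_self_adjoint.
apply: (proj1 (sa f (L f) (A_L2 Af) (A_L2 (A_L Af)))).
by split; [exact: (ac_domain A_admissible)|apply: aeW].
Qed.

Lemma L_symmetric f g : A f -> A g ->
  Int (fun x => f x * L g x) = Int (fun x => L f x * g x).
Proof.
move=> Af Ag; have := domain_dual Af (ac_domain A_admissible Ag).
rewrite !IntE; first by move=> [].
  by apply: bddM; [exact: bdd_L|exact: A_bdd].
by apply: bddM; [exact: A_bdd|exact: bdd_L].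
Qed.

(** [L] acts on representatives, so its invariance under almost everywhere equality needs an
    argument: self-adjointness determines the graph by integrals against the whole domain, and these
    do not see null sets. *)
Lemma L_eq f g : A f -> A g -> {ae mu, forall x, f x = g x} ->
  {ae mu, forall x, L f x = L g x}.
Proof.
move=> Af Ag fg; have [_ sa] := L_self_adjoint.
have H : {ae mu, forall x, L g x = L f x}.
  apply: (proj2 (proj2 (sa g (L f) (A_L2 Ag) (A_L2 (A_L Af))) _)) => u Du.
  rewrite -(domain_dual Af Du); apply: ae_eq_integral => //.
  - apply/measurable_EFinP/measurable_funM; first exact: (proj1 (A_bdd Ag)).
    by have [_ + _] := L_generator Du; exact: Lfun_measurable.
  - apply/measurable_EFinP/measurable_funM; first exact: (proj1 (A_bdd Af)).
    by have [_ + _] := L_generator Du; exact: Lfun_measurable.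
  - by with_ae fg; apply: aeW => x -> _.
by with_ae H; apply: aeW => x ->.
Qed.

(** The increment estimate with m = 0: the semigroup preserves the bound on L f. *)
Lemma P_lipschitz f : A f -> exists2 K : R, 0 <= K &
  forall h : R, 0 <= h -> {ae mu, forall x, `|P h f x - f x| <= h * K}.
Proof.
move=> Af; have [K K0 HK] := bdd_bound (bdd_L Af); exists K => // h h0.
have B0 := bdd_cst mu 0.
have H := P_increment (A_bdd Af) (bdd_L Af) B0 (L_graph Af) h0.
have H' : {ae mu, forall x, `|P h f x - f x - h * cst 0 x| <= h * K}.
  apply: H => tau /andP[tau0 _].
  by with_ae (P_bound tau0 (bdd_L Af) HK); apply: aeW => x; rewrite subr0.
by with_ae H'; apply: aeW => x /=; rewrite mulr0 subr0.
Qed.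

(** The increment estimate with m = L f. As L f is again in A, the Lipschitz bound keeps P_tau (L f)
    within tau K of L f, which gains the second power of h. *)
Lemma P_taylor f : A f -> exists2 K : R, 0 <= K &
  forall h : R, 0 <= h -> {ae mu, forall x, `|P h f x - f x - h * L f x| <= K * h ^+ 2}.
Proof.
move=> Af; have [K K0 HK] := P_lipschitz (A_L Af); exists K => // h h0.
have H := P_increment (A_bdd Af) (bdd_L Af) (bdd_L Af) (L_graph Af) h0.
have H' : {ae mu, forall x, `|P h f x - f x - h * L f x| <= h * (h * K)}.
  apply: H => tau /andP[tau0 tauh].
  by with_ae (HK _ tau0); apply: aeW => x /le_trans; apply; rewrite ler_wpM2r.
by with_ae H'; apply: aeW => x; rewrite (_ : h * (h * K) = K * h ^+ 2)//; ring.
Qed.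

Lemma P_lipschitz_shift f : A f -> exists2 K : R, 0 <= K &
  forall s h : R, 0 <= s -> 0 <= h -> {ae mu, forall x, `|P (s + h) f x - P s f x| <= K * h}.
Proof.
move=> Af; have [K K0 HK] := P_lipschitz Af; exists K => // s h s0 h0.
have Bf := A_bdd Af; have BPf := bddP h0 Bf.
with_ae (ms_add P_markov s0 h0 (A_L2 Af)); with_ae (PB s0 BPf Bf).
with_ae (P_bound s0 (bddB BPf Bf) (HK h h0)).
by apply: aeW => x + E1 -> ; rewrite E1 mulrC.
Qed.

Lemma P_taylor_shift f : A f -> exists2 K : R, 0 <= K &
  forall s h : R, 0 <= s -> 0 <= h ->
    {ae mu, forall x, `|P (s + h) f x - P s f x - h * P s (L f) x| <= K * h ^+ 2}.
Proof.
move=> Af; have [K K0 HK] := P_taylor Af; exists K => // s h s0 h0.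
have Bf := A_bdd Af; have BPf := bddP h0 Bf; have BL := bdd_L Af.
with_ae (ms_add P_markov s0 h0 (A_L2 Af)); with_ae (PB s0 BPf Bf).
with_ae (PZ h s0 BL); with_ae (PB s0 (bddB BPf Bf) (bddZ h BL)).
with_ae (P_bound s0 (bddB (bddB BPf Bf) (bddZ h BL)) (HK h h0)).
by apply: aeW => x + E1 E2 E3 ->; rewrite E1 E2 E3.
Qed.

Lemma curve_semigroup a b f : 0 <= a -> A f ->
  curve mu a b (fun s => P s f) (fun s => P s (L f)).
Proof.
move=> a0 Af; have Bf := A_bdd Af; have BL := bdd_L Af.
have [K1 K10 HK1] := bdd_bound Bf; have [K2 K20 HK2] := bdd_bound BL.
have [K3 K30 HK3] := P_taylor_shift Af; have [K4 K40 HK4] := P_lipschitz_shift (A_L Af).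
exists (K1 + K2 + K3 + K4); first by rewrite !addr_ge0.
have pos s : s \in `[a, b] -> 0 <= s by rewrite in_itv/= => /andP[/(le_trans a0)].
split=> [s /pos s0|s s' /pos s0 /pos s'0].
  split; [exact: bddP|exact: bddP| |].
    by with_ae (P_bound s0 Bf HK1); apply: aeW => x; lra.
  by with_ae (P_bound s0 BL HK2); apply: aeW => x; lra.
have le1 (z : R) : K3 * z ^+ 2 <= (K1 + K2 + K3 + K4) * z ^+ 2.
  by rewrite ler_wpM2r ?sqr_ge0//; lra.
have le2 (z : R) : K3 * z ^+ 2 + K4 * z ^+ 2 <= (K1 + K2 + K3 + K4) * z ^+ 2.
  by rewrite -mulrDl ler_wpM2r ?sqr_ge0//; lra.
have [ss'|s's] := leP s s'.
  have h0 : 0 <= s' - s by rewrite subr_ge0.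
  with_ae (HK3 s _ s0 h0); apply: aeW => x; rewrite subrKC => /le_trans; exact.
(* The semigroup only moves forward, so a backward increment is expanded at s', and the Lipschitz
   bound on P (L f) moves the derivative from s' to s. *)
have h0 : 0 <= s - s' by rewrite subr_ge0 ltW.
with_ae (HK3 s' _ s'0 h0); with_ae (HK4 s' _ s'0 h0); apply: aeW => x.
rewrite subrKC => H1 H2; apply: le_trans (le2 _).
rewrite -[(s' - s) ^+ 2]sqrrN opprB.
rewrite (_ : _ - _ = (s - s') * (P s (L f) x - P s' (L f) x) -
   (P s f x - P s' f x - (s - s') * P s' (L f) x)); last by ring.
rewrite (le_trans (ler_normB _ _))// addrC lerD// normrM ger0_norm//.
by rewrite expr2 mulrCA ler_wpM2l.
Qed.

Lemma curve_rev t X X' : curve mu 0 t X X' ->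
  curve mu 0 t (fun s => X (t - s)) (fun s x => - X' (t - s) x).
Proof.
move=> [K K0 [H1 H2]]; exists K => //.
have rev s : s \in `[0, t] -> t - s \in `[0, t].
  by rewrite !in_itv/= => /andP[? ?]; apply/andP; split; lra.
split=> [s /rev st|s s' /rev st /rev s't].
  have [h1 h2 h3 h4] := H1 _ st; split => //; first exact: bddN.
  by with_ae h4; apply: aeW => x; rewrite normrN.
with_ae (H2 _ _ st s't); apply: aeW => x.
rewrite (_ : t - s' - (t - s) = - (s' - s)); last by ring.
by rewrite sqrrN mulrN mulNr.
Qed.

(** Stability of A is assumed for positive times only, and P_0 f is merely almost everywhere equal
    to f: hence a representative. L commutes with P_s because P_s (L f) and L (P_s f) are both
    first-order coefficients of h |-> P_(s+h) f; the two expansions are compared at h = 1 / (n +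
    1). *)
Lemma P_rep s f : 0 <= s -> A f -> exists k, [/\ A k,
  {ae mu, forall x, P s f x = k x} & {ae mu, forall x, P s (L f) x = L k x}].
Proof.
move=> + Af; rewrite le_eqVlt => /predU1P[<-|s0].
  exists f; split => //; first exact: (ms_0 P_markov (A_L2 Af)).
  exact: (ms_0 P_markov (A_L2 (A_L Af))).
have s00 := ltW s0.
have Ak : A (P s f) by exact: (ac_semigroup A_admissible).
exists (P s f); split => //; first by apply: aeW.
have [K K0 HK] := P_taylor Ak; have [J J0 HJ] := P_taylor_shift Af.
have H : {ae mu, forall x, forall n : nat,
    `|P s (L f) x - L (P s f) x| <= (K + J) * n.+1%:R^-1}.
  apply: ae_foralln => n; have h0 : 0 < n.+1%:R^-1 :> R by rewrite invr_gt0 ltr0n.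
  with_ae (HK _ (ltW h0)); with_ae (HJ s _ s00 (ltW h0)).
  with_ae (ms_add P_markov (ltW h0) s00 (A_L2 Af)).
  move: (n.+1%:R^-1 : R) h0 => h h0; apply: aeW => x; rewrite [h + s]addrC => -> H1 H2.
  rewrite -(ler_pM2l h0) -{1}(gtr0_norm h0) -normrM.
  rewrite (_ : h * (P s (L f) x - L (P s f) x) =
    (P h (P s f) x - P s f x - h * L (P s f) x) -
    (P h (P s f) x - P s f x - h * P s (L f) x)); last by ring.
  rewrite (le_trans (ler_normB _ _))// mulrCA -expr2 mulrDl.
  by apply: lerD.
with_ae H; apply: aeW => x {}H; apply/eqP; rewrite -subr_eq0 -normr_le0.
apply/ler_addgt0Pr => e e0; rewrite add0r.
apply: (le_trans (H (Num.truncn ((K + J) / e)))).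
have hn : (K + J) / e < (Num.truncn ((K + J) / e)).+1%:R := truncnS_gt _.
by rewrite ler_pdivrMr ?ltr0n// -ler_pdivrMl// mulrC ltW.
Qed.

(** By symmetry of L, the function r |-> int P_r f P_(s-r) g has zero derivative on [0, s]. *)
Lemma P_symmetric s f g : 0 <= s -> A f -> A g ->
  Int (fun x => f x * P s g x) = Int (fun x => P s f x * g x).
Proof.
move=> s0 Af Ag.
have C := curveM (curve_semigroup s (lexx 0) Af) (curve_rev (curve_semigroup s (lexx 0) Ag)).
have D r : r \in `[0, s] ->
    Int (fun x => P r (L f) x * P (s - r) g x + P r f x * - P (s - r) (L g) x) = 0.
  rewrite in_itv/= => /andP[r0 rs]; have sr0 : 0 <= s - r by rewrite subr_ge0.
  have [k [Ak k1 k2]] := P_rep r0 Af; have [l [Al l1 l2]] := P_rep sr0 Ag.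
  have B1 : bdd (fun x => L k x * l x) by apply: bddM; [exact: bdd_L|exact: A_bdd].
  have B2 : bdd (fun x => k x * L l x) by apply: bddM; [exact: A_bdd|exact: bdd_L].
  rewrite (@Int_eq _ _ _ _ _ (fun x => L k x * l x - k x * L l x)).
  - by rewrite IntB// L_symmetric// subrr.
  - apply: bddD; apply: bddM; [exact: (bddP r0 (bdd_L _))|exact: (bddP sr0 (A_bdd _))|
      exact: (bddP r0 (A_bdd _))|apply/bddN; exact: (bddP sr0 (bdd_L _))].
  - exact: bddB.
  - with_ae k1; with_ae k2; with_ae l1; with_ae l2; apply: aeW => x -> -> -> ->.
    by rewrite mulrN.
have CI := curve_Int C.
have E := curve_real_eq s0 CI D; rewrite subrr subr0 in E.
have Bf := A_bdd Af; have Bg := A_bdd Ag.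
have BPf := bddP s0 Bf; have BPg := bddP s0 Bg.
have BPf0 := bddP (lexx 0) Bf; have BPg0 := bddP (lexx 0) Bg.
transitivity (Int (fun x => P 0 f x * P s g x)).
  apply: Int_eq; [exact: bddM|exact: bddM|].
  by with_ae (ms_0 P_markov (A_L2 Af)); apply: aeW => x ->.
rewrite E; apply: Int_eq; [exact: bddM|exact: bddM|].
by with_ae (ms_0 P_markov (A_L2 Ag)); apply: aeW => x ->.
Qed.

(* Squares of elements of A approximate the indicator of [f > 0] in L^1. *)
Lemma ae_le0_test f : bdd f ->
  (forall g, A g -> Int (fun x => g x ^+ 2 * f x) <= 0) ->
  {ae mu, forall x, f x <= 0}.
Proof.
move=> Bf H; have [K K0 HK] := bdd_bound Bf.
pose E := f @^-1` `]0, +oo[%classic.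
have mE : measurable E by rewrite -[E]setTI; apply: (proj1 Bf) => //; exact: measurable_itv.
pose u x : R := \1_E x.
have Bu : bdd u.
  split; first exact: measurable_indic.
  by exists 1; apply: aeW => x; rewrite /u indicE; case: (x \in E); rewrite ?normr1 ?normr0.
have uu x : u x ^+ 2 = u x.
  by rewrite /u indicE; case: (x \in E); rewrite ?expr1n ?expr0n.
have uf x : u x * f x = Num.max (f x) 0.
  rewrite /u indicE; have [xE|xE] := boolP (x \in E).
    move: xE; rewrite inE /E/= in_itv/= andbT => f0.
    by rewrite mul1r max_l// ltW.
  rewrite mul0r max_r// leNgt; apply: contra xE => f0.
  by rewrite inE /E/= in_itv/= f0.
have Bm := bdd_max0 Bf.
have I0 : Int (fun x => Num.max (f x) 0) <= 0.
  apply/ler_addgt0Pr => e e0; rewrite add0r.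
  (* |u^2 - g^2| <= (1 + c) (u - g)^2 + u^2 / c *)
  pose c := (2 * (K + 1)) / e.
  have K1 : 0 < K + 1 by rewrite ltr_wpDl.
  have c0 : 0 < c by rewrite /c divr_gt0// mulr_gt0.
  (* The constants make each of the two error terms at most e / 2; K + 1 replaces K, which may
     vanish. *)
  pose e' := e / 2 / ((1 + c) * (K + 1)).
  have e'0 : 0 < e' by rewrite /e' !divr_gt0// mulr_gt0// addr_gt0.
  have se'0 : 0 < Num.sqrt e' by rewrite sqrtr_gt0.
  have [g Ag] := ac_dense A_admissible (ltr1n R 2) (bdd_L2 Bu) se'0.
  have Bg := A_bdd Ag.
  rewrite LpdistE// lte_fin ltr_sqrt// => gu.
  have Bgu := bdd_sqr (bddB Bu Bg); have Bu2 := bdd_sqr Bu; have Bg2 := bdd_sqr Bg.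
  have B1 := bddZ (K * (1 + c)) Bgu; have B2 := bddZ (K * c^-1) Bu2.
  have Bgf := bddM Bg2 Bf.
  apply: (@le_trans _ _ (Int (fun x => g x ^+ 2 * f x +
     (K * (1 + c) * (u x - g x) ^+ 2 + K * c^-1 * u x ^+ 2)))).
    apply: Int_le => //; first by apply: bddD => //; exact: bddD.
    with_ae HK; apply: aeW => x fK; rewrite -uf -{1}uu.
    rewrite -lerBlDl -mulrBl.
    rewrite [leRHS](_ : _ = ((u x - g x) ^+ 2 + (c * (u x - g x) ^+ 2 + c^-1 * u x ^+ 2)) * K);
      last by ring.
    rewrite (le_trans (ler_norm _))// normrM ler_pM//.
    have h : `|u x ^+ 2 - g x ^+ 2| <= (u x - g x) ^+ 2 + 2 * `|u x * (u x - g x)|.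
      rewrite (_ : u x ^+ 2 - g x ^+ 2 = 2 * (u x * (u x - g x)) - (u x - g x) ^+ 2); last by ring.
      rewrite (le_trans (ler_normB _ _))// addrC (ger0_norm (sqr_ge0 _)) lerD2l.
      by rewrite normrM (ger0_norm (ler0n _ 2)).
    apply: (le_trans h); rewrite lerD2l.
    rewrite normrM; move: (normr_ge0 (u x)) (normr_ge0 (u x - g x)).
    rewrite -[u x ^+ 2]real_normK ?num_real// -[(u x - g x) ^+ 2]real_normK ?num_real//.
    move: `|u x| `|u x - g x| => p q p0 q0.
    rewrite -(ler_pM2l c0) mulrDr mulVKf ?gt_eqF//.
    have : 0 <= (c * q - p) ^+ 2 by exact: sqr_ge0.
    by lra.
  rewrite IntD//; last exact: bddD.
  rewrite IntD// !IntZ//.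
  have h1 := H g Ag.
  have h2 : Int (fun x => u x ^+ 2) <= 1.
    rewrite -[leRHS](Int_cst mu 1); apply: Int_le => //; first exact: bdd_cst.
    by apply: aeW => x; rewrite uu /u indicE; case: (x \in E).
  have h3 : K * (1 + c) * Int (fun x => (u x - g x) ^+ 2) <= e / 2.
    apply: (@le_trans _ _ ((K + 1) * (1 + c) * e')).
      rewrite ler_pM//; [by rewrite mulr_ge0// addr_ge0// ltW| | |exact: ltW]; last first.
        by rewrite ler_wpM2r ?lerDl// addr_ge0// ltW.
      by apply: Int_ge0 => //; apply: aeW => x; exact: sqr_ge0.
    rewrite /e' le_eqVlt; apply/orP; left; apply/eqP; field.
    by rewrite !gt_eqF// addr_gt0.
  have h4 : K * c^-1 * Int (fun x => u x ^+ 2) <= e / 2.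
    apply: (@le_trans _ _ ((K + 1) * c^-1 * 1)).
      rewrite ler_pM// ?mulr_ge0 ?invr_ge0 ?(ltW c0)//.
        by apply: Int_ge0 => //; apply: aeW => x; exact: sqr_ge0.
      by rewrite ler_wpM2r ?lerDl// invr_ge0 ltW.
    rewrite /c le_eqVlt; apply/orP; left; apply/eqP; field.
    by rewrite !gt_eqF.
  by lra.
have : {ae mu, forall x, Num.max (f x) 0 <= 0}.
  have Bs : bdd (fun x => Num.max (f x) 0 ^+ 2) by exact: bdd_sqr.
  have : {ae mu, forall x, Num.max (f x) 0 = 0}.
    apply: (Int_sqr_eq0 Bm); apply/eqP; rewrite eq_le; apply/andP; split; last first.
      by apply: Int_ge0 => //; apply: aeW => x; exact: sqr_ge0.
    apply: (@le_trans _ _ (K * Int (fun x => Num.max (f x) 0))); last first.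
      by rewrite mulr_ge0_le0.
    rewrite -IntZ//; apply: Int_le => //; first exact: bddZ.
    with_ae HK; apply: aeW => x fK; rewrite expr2 ler_wpM2r ?le_max ?lexx ?orbT//.
    by rewrite ge_max K0 (le_trans (ler_norm _)).
  by move=> h; with_ae h; apply: aeW => x ->.
by move=> h; with_ae h; apply: aeW => x; rewrite ge_max => /andP[].
Qed.

(** * Gamma calculus, chain rules for ln and 1 / x, and curvature *)

Lemma GammaC f g : G f g = G g f.
Proof.
apply/funext => x; rewrite /Gamma (_ : (fun y => f y * g y) = (fun y => g y * f y)); first by ring.
by apply/funext => y; rewrite mulrC.
Qed.

Lemma A_Gamma f g : A f -> A g -> A (G f g).
Proof.
move=> Af Ag; rewrite /Gamma; apply: (A_scale).
apply: (A_sub); last exact: (A_mul Ag (A_L Af)).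
apply: (A_sub); last exact: (A_mul Af (A_L Ag)).
exact/A_L/(A_mul).
Qed.

Lemma L_term n (e : term n) (f : 'I_n -> T -> R) : (forall i, A (f i)) ->
  {ae mu, forall x, L (fun y => eval e (\row_i f i y)) x =
    \sum_(i < n) eval (der i e) (\row_k f k x) * L (f i) x +
    \sum_(i < n) \sum_(j < n) eval (der i (der j e)) (\row_k f k x) * G (f i) (f j) x}.
Proof.
move=> Af; with_ae (L_diffusion (smooth_eval e) Af); apply: aeW => x ->.
by congr (_ + _); apply: eq_bigr => i _; [|apply: eq_bigr => j _]; rewrite pder_eval.
Qed.

(* phi1 and phi2 stand for the first two derivatives of phi0. *)
Definition chain_rule (phi0 phi1 phi2 : R -> R) := forall k u, A k -> A u ->
  A (fun x => k x * phi0 (u x)) /\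
  {ae mu, forall x, L (fun y => k y * phi0 (u y)) x =
    phi0 (u x) * L k x + phi1 (u x) * (k x * L u x + 2 * G k u x) +
    k x * phi2 (u x) * G u u x}.

(* [ln r + ln (1 + (x / r)^2) / 2 = ln (r^2 + x^2) / 2] is smooth on the whole
   line and tends to [ln x] with its derivatives, uniformly on [delta, oo), as r -> 0. *)
Lemma chain_rule_ln (r : R) : 0 < r -> chain_rule
  (fun x => ln r + 2^-1 * ln (1 + (x / r) ^+ 2)) (fun x => x / (r ^+ 2 + x ^+ 2))
  (fun x => (r ^+ 2 - x ^+ 2) / (r ^+ 2 + x ^+ 2) ^+ 2).
Proof.
move=> r0 k u Ak Au.
pose w := Mul (Cst 2 r^-1) (Var (lift ord0 ord0 : 'I_2)).
pose e := Mul (Var (ord0 : 'I_2)) (Add (Cst 2 (ln r)) (Mul (Cst 2 2^-1) (Ln1Dsqr w))).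
pose f : 'I_2 -> T -> R := @vec [:: k; u].
have Af : forall i, A (f i) by apply: (@A_vec [:: k; u]) => h /= [<-//|[<-//|[]]].
have E : (fun x => eval e (\row_i f i x)) =
    (fun x => k x * (ln r + 2^-1 * ln (1 + (u x / r) ^+ 2))).
  by apply/funext => x; rewrite /= !mxE /f/vec/= [r^-1 * _]mulrC.
split; first by rewrite -E; exact: (A_term e Af).
have := L_term e Af; rewrite E => H; with_ae H; apply: aeW => x ->.
rewrite !big_ord_recl !big_ord0 /= !mxE /f /vec /= (GammaC u k).
have h1 : 0 < 1 + (r^-1 * u x) ^+ 2 by exact: sqr1D_gt0.
have h2 : r ^+ 2 + u x ^+ 2 != 0 by rewrite gt_eqF// ltr_pwDl ?exprn_gt0// sqr_ge0.
have -> : (1 + (r^-1 * u x) ^+ 2)^-1 = r ^+ 2 / (r ^+ 2 + u x ^+ 2).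
  by field; rewrite h2 gt_eqF.
rewrite [r^-1 * _]mulrC.
by field; rewrite h2 gt_eqF.
Qed.

(** The regularized inverse is the derivative of the regularized logarithm, so that the two share
    most of their error estimates. *)
Lemma chain_rule_inv (r : R) : 0 < r -> chain_rule
  (fun x => x / (r ^+ 2 + x ^+ 2)) (fun x => (r ^+ 2 - x ^+ 2) / (r ^+ 2 + x ^+ 2) ^+ 2)
  (fun x => (2 * x ^+ 3 - 6 * r ^+ 2 * x) / (r ^+ 2 + x ^+ 2) ^+ 3).
Proof.
move=> r0 k u Ak Au.
pose w := Mul (Cst 2 r^-1) (Var (lift ord0 ord0 : 'I_2)).
pose e := Mul (Var (ord0 : 'I_2)) (Mul (Mul (Cst 2 r^-1) w) (Inv1Dsqr w)).
pose f : 'I_2 -> T -> R := @vec [:: k; u].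
have Af : forall i, A (f i) by apply: (@A_vec [:: k; u]) => h /= [<-//|[<-//|[]]].
have h2 y : r ^+ 2 + y ^+ 2 != 0 by rewrite gt_eqF// ltr_pwDl ?exprn_gt0// sqr_ge0.
have iE y : (1 + (r^-1 * y) ^+ 2)^-1 = r ^+ 2 / (r ^+ 2 + y ^+ 2).
  have h1 : 0 < 1 + (r^-1 * y) ^+ 2 by exact: sqr1D_gt0.
  by field; rewrite h2 gt_eqF.
have E : (fun x => eval e (\row_i f i x)) =
    (fun x => k x * (u x / (r ^+ 2 + u x ^+ 2))).
  apply/funext => x; rewrite /= !mxE /f/vec/= iE.
  by field; rewrite h2 gt_eqF.
split; first by rewrite -E; exact: (A_term e Af).
have := L_term e Af; rewrite E => H; with_ae H; apply: aeW => x ->.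
rewrite !big_ord_recl !big_ord0 /= !mxE /f /vec /= (GammaC u k) iE.
by field; rewrite h2 gt_eqF.
Qed.

(** Uniform closeness on [delta, oo) to functions obeying the chain rule; [phi0] itself may be
    singular at 0, and phi0(u) is not claimed to lie in A. *)
Definition approx_chain_rule (delta : R) (phi0 phi1 phi2 : R -> R) :=
  forall e, 0 < e -> exists psi0 psi1 psi2, chain_rule psi0 psi1 psi2 /\
    forall x, delta <= x -> [/\ `|psi0 x - phi0 x| <= e, `|psi1 x - phi1 x| <= e &
      `|psi2 x - phi2 x| <= e].

(** For an approximant, symmetry moves L from psi to the product and the chain rule applies. Both
    sides then depend on the approximant only through its values and two derivatives at u >= delta,
    multiplied by bounded functions. *)
Lemma integral_chain_rule delta phi0 phi1 phi2 psi k u :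
  approx_chain_rule delta phi0 phi1 phi2 -> A psi -> A k -> A u ->
  {ae mu, forall x, delta <= u x} ->
  bdd (fun x => phi0 (u x)) -> bdd (fun x => phi1 (u x)) -> bdd (fun x => phi2 (u x)) ->
  Int (fun x => L psi x * (k x * phi0 (u x))) =
  Int (fun x => psi x * (phi0 (u x) * L k x +
    phi1 (u x) * (k x * L u x + 2 * G k u x) + k x * phi2 (u x) * G u u x)).
Proof.
move=> app Apsi Ak Au du B0 B1 B2.
have BLpsi := A_bdd (A_L Apsi); have Bpsi := A_bdd Apsi; have Bk := A_bdd Ak.
have BLk := A_bdd (A_L Ak); have BLu := A_bdd (A_L Au).
have BGk := A_bdd (A_Gamma Ak Au); have BGu := A_bdd (A_Gamma Au Au).
pose Q1 x := k x * L u x + 2 * G k u x; pose Q2 x := k x * G u u x.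
have BQ1 : bdd Q1 by apply: bddD; [exact: bddM|exact: bddZ].
have BQ2 : bdd Q2 by exact: bddM.
have [K1 K10 HK1] := bdd_bound (bddM BLpsi Bk).
have [K2 K20 HK2] := bdd_bound Bpsi; have [K3 K30 HK3] := bdd_bound BLk.
have [K4 K40 HK4] := bdd_bound BQ1; have [K5 K50 HK5] := bdd_bound BQ2.
pose K := K1 + K2 * (K3 + K4 + K5).
have K0 : 0 <= K by rewrite /K addr_ge0// mulr_ge0// !addr_ge0.
pose X x := L psi x * (k x * phi0 (u x)).
pose Y x := psi x * (phi0 (u x) * L k x + phi1 (u x) * Q1 x + k x * phi2 (u x) * G u u x).
have BX : bdd X by apply/bddM/bddM.
have BY : bdd Y.
  apply: bddM => //; apply: bddD; last by apply: bddM => //; exact: bddM.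
  by apply: bddD; exact: bddM.
suff H e : 0 < e -> `|Int X - Int Y| <= K * e.
  apply/eqP; rewrite -subr_eq0 -normr_le0 -/X -/Y.
  apply/ler_addgt0Pr => e e0; rewrite add0r.
  have K1' : 0 < K + 1 by rewrite ltr_wpDl.
  apply: le_trans (H (e / (K + 1)) (divr_gt0 e0 K1')) _.
  by rewrite mulrCA ler_piMr ?(ltW e0)// ler_pdivrMr// mul1r lerDl.
move=> e0; have [psi0 [psi1 [psi2 [ch ap]]]] := app e e0.
have [Aw Lw] := ch k u Ak Au; have Bw := A_bdd Aw; have BLw := A_bdd (A_L Aw).
have BX' : bdd (fun x => L psi x * (k x * psi0 (u x))) by exact: bddM.
have BY' : bdd (fun x => psi x * L (fun y => k y * psi0 (u y)) x) by exact: bddM.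
have E : Int (fun x => L psi x * (k x * psi0 (u x))) =
    Int (fun x => psi x * L (fun y => k y * psi0 (u y)) x).
  by rewrite (L_symmetric Apsi Aw).
rewrite (_ : Int X - Int Y = (Int X - Int (fun x => L psi x * (k x * psi0 (u x)))) +
   (Int (fun x => psi x * L (fun y => k y * psi0 (u y)) x) - Int Y)); last by rewrite E; ring.
rewrite -!IntB// /K mulrDl (le_trans (ler_normD _ _))// lerD//.
  apply: Int_norm_le; first exact: bddB.
  with_ae HK1; with_ae du; apply: aeW => x /ap[h _ _] hK.
  rewrite /X (_ : _ - _ = L psi x * k x * (phi0 (u x) - psi0 (u x))); last by ring.
  by rewrite normrM ler_pM// distrC.
apply: Int_norm_le; first exact: bddB.
with_ae HK2; with_ae HK3; with_ae HK4; with_ae HK5; with_ae Lw; with_ae du.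
apply: aeW => x /ap[h0 h1 h2] -> k5 k4 k3 k2.
rewrite /Y -/(Q1 x) (_ : _ - _ = psi x * ((psi0 (u x) - phi0 (u x)) * L k x +
  (psi1 (u x) - phi1 (u x)) * Q1 x + (psi2 (u x) - phi2 (u x)) * Q2 x)); last first.
  by rewrite /Q2; ring.
rewrite normrM -mulrA ler_pM// [leRHS](_ : _ = e * K3 + e * K4 + e * K5); last by ring.
rewrite (le_trans (ler_normD _ _))// lerD//; last by rewrite normrM ler_pM.
by rewrite (le_trans (ler_normD _ _))// lerD// normrM ler_pM.
Qed.

Lemma approx_small delta e : 0 < delta -> 0 < e -> exists2 r : R, 0 < r &
  forall x, delta <= x -> [/\ `|ln r + 2^-1 * ln (1 + (x / r) ^+ 2) - ln x| <= e,
    `|x / (r ^+ 2 + x ^+ 2) - x^-1| <= e,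
    `|(r ^+ 2 - x ^+ 2) / (r ^+ 2 + x ^+ 2) ^+ 2 - - x ^- 2| <= e &
    `|(2 * x ^+ 3 - 6 * r ^+ 2 * x) / (r ^+ 2 + x ^+ 2) ^+ 3 - 2 * x ^- 3| <= e].
Proof.
move=> d0 e0.
(* Each summand of C controls one of the four errors, which are at most r^2 times delta^-2,
   delta^-3, 3 delta^-4 and 12 delta^-5; r is then fixed by r^2 C = e. *)
pose C := delta ^- 2 + delta ^- 3 + 3 * delta ^- 4 + 12 * delta ^- 5.
have dn n : 0 < delta ^- n by rewrite invr_gt0 exprn_gt0.
have C0 : 0 < C by rewrite /C !addr_gt0// mulr_gt0.
pose r := Num.sqrt (e / C).
have eC : 0 < e / C by exact: divr_gt0.
have r0 : 0 < r by rewrite sqrtr_gt0.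
have rE : r ^+ 2 = e / C by rewrite sqr_sqrtr// ltW.
exists r => // x dx; have x0 := lt_le_trans d0 dx.
have xn n : x ^- n <= delta ^- n.
  rewrite lef_pV2 ?posrE ?exprn_gt0//.
  by apply: lerXn2r; rewrite // nnegrE ltW.
have y0 n : 0 < x ^- n by rewrite invr_gt0 exprn_gt0.
have bound (z w : R) : 0 <= z <= r ^+ 2 * w -> w <= C -> `|z| <= e.
  move=> /andP[z0 zw] wC; rewrite ger0_norm// (le_trans zw)// rE mulrAC.
  by rewrite ler_pdivrMr// ler_wpM2l// ltW.
have c2 : delta ^- 2 <= C by rewrite /C -!addrA lerDl !addr_ge0// ?mulr_ge0// ltW.
have c3 : delta ^- 3 <= C.
  move: (dn 2%N) (dn 3%N) (dn 4%N) (dn 5%N); rewrite /C.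
  by move: (delta ^- 2) (delta ^- 3) (delta ^- 4) (delta ^- 5) => *; lra.
have c4 : 3 * delta ^- 4 <= C.
  move: (dn 2%N) (dn 3%N) (dn 4%N) (dn 5%N); rewrite /C.
  by move: (delta ^- 2) (delta ^- 3) (delta ^- 4) (delta ^- 5) => *; lra.
have c5 : 12 * delta ^- 5 <= C.
  move: (dn 2%N) (dn 3%N) (dn 4%N) (dn 5%N); rewrite /C.
  by move: (delta ^- 2) (delta ^- 3) (delta ^- 4) (delta ^- 5) => *; lra.
have r20 : 0 < r ^+ 2 by exact: exprn_gt0.
have E0 : ln r + 2^-1 * ln (1 + (x / r) ^+ 2) - ln x = 2^-1 * ln (1 + r ^+ 2 * x ^- 2).
  have lnsq (y : R) : 0 < y -> ln y = 2^-1 * ln (y ^+ 2).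
    by move=> y00; rewrite lnXn// -[ln y *+ 2]mulr_natl mulKf.
  rewrite (lnsq r r0) (lnsq x x0) -mulrDr -mulrBr; congr (_ * _).
  have s0 : 0 < 1 + (x / r) ^+ 2 by exact: sqr1D_gt0.
  rewrite -lnM ?posrE// -ln_div ?posrE ?mulr_gt0 ?exprn_gt0//; congr ln.
  by field; rewrite !gt_eqF.
have rx : 0 < r ^+ 2 + x ^+ 2 by rewrite addr_gt0// exprn_gt0.
move: (r ^+ 2) r20 rx bound E0 => s s0 sx bound E0.
have nn : [/\ 0 <= s, 0 <= x & 0 <= s + x ^+ 2] by rewrite !ltW.
case: nn => s00 x00 sx00.
split.
- rewrite E0; apply: (bound _ (delta ^- 2)) => //.
  have sy : 0 < s * x ^- 2 by exact: mulr_gt0.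
  rewrite mulr_ge0 ?ln_ge0 ?lerDl ?(ltW sy)//=.
  have := @le_ln1Dx R (s * x ^- 2) ltac:(by rewrite (lt_trans _ sy)// ltrN10).
  have : s * x ^- 2 <= s * delta ^- 2 by rewrite ler_wpM2l.
  have := ltW sy; by move: (s * x ^- 2) (s * _) => a b *; lra.
- rewrite distrC (_ : _ - _ = s / (x * (s + x ^+ 2))); last by field; rewrite !gt_eqF.
  apply: (bound _ (delta ^- 3)) => //; rewrite divr_ge0 ?mulr_ge0//=.
  apply: (@le_trans _ _ (s * x ^- 3)); last by rewrite ler_wpM2l.
  rewrite ler_wpM2l// lef_pV2 ?posrE ?exprn_gt0 ?mulr_gt0// exprS ler_wpM2l//.
  by rewrite lerDr.
- rewrite opprK (_ : _ + _ = (3 * s * x ^+ 2 + s ^+ 2) / (x ^+ 2 * (s + x ^+ 2) ^+ 2));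
    last by field; rewrite !gt_eqF.
  apply: (bound _ (3 * delta ^- 4)) => //.
  rewrite divr_ge0 ?addr_ge0 ?mulr_ge0 ?sqr_ge0//=.
  apply: (@le_trans _ _ (s * (3 * x ^- 4))); last by rewrite ler_wpM2l// ler_wpM2l.
  rewrite -subr_ge0 (_ : _ - _ = s * (3 * s ^+ 2 + 5 * s * x ^+ 2) / (x ^+ 4 * (s + x ^+ 2) ^+ 2));
    last by field; rewrite !gt_eqF.
  by rewrite divr_ge0// ?mulr_ge0// ?addr_ge0// ?mulr_ge0// ?sqr_ge0// ?exprn_ge0.
- rewrite distrC (_ : _ - _ = (12 * x ^+ 4 * s + 6 * x ^+ 2 * s ^+ 2 + 2 * s ^+ 3) /
    (x ^+ 3 * (s + x ^+ 2) ^+ 3)); last by field; rewrite !gt_eqF.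
  apply: (bound _ (12 * delta ^- 5)) => //.
  have p1 n : 0 <= x ^+ n by exact: exprn_ge0.
  have p2 n : 0 <= s ^+ n by exact: exprn_ge0.
  have p3 n : 0 <= (s + x ^+ 2) ^+ n by exact: exprn_ge0.
  rewrite divr_ge0 ?addr_ge0 ?mulr_ge0//=.
  apply: (@le_trans _ _ (s * (12 * x ^- 5))); last by rewrite ler_wpM2l// ler_wpM2l.
  rewrite -subr_ge0 (_ : _ - _ = s * (12 * s ^+ 3 + 34 * s ^+ 2 * x ^+ 2 + 30 * s * x ^+ 4) /
    (x ^+ 5 * (s + x ^+ 2) ^+ 3)); last by field; rewrite !gt_eqF.
  by rewrite divr_ge0// ?mulr_ge0// ?addr_ge0// ?mulr_ge0.
Qed.

Lemma approx_ln delta : 0 < delta ->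
  approx_chain_rule delta (@ln R) (fun x => x^-1) (fun x => - x ^- 2).
Proof.
move=> d0 e e0; have [r r0 H] := approx_small d0 e0.
exists (fun x => ln r + 2^-1 * ln (1 + (x / r) ^+ 2)), (fun x => x / (r ^+ 2 + x ^+ 2)),
  (fun x => (r ^+ 2 - x ^+ 2) / (r ^+ 2 + x ^+ 2) ^+ 2).
by split; [exact: chain_rule_ln|move=> x /H[]].
Qed.

Lemma approx_inv delta : 0 < delta ->
  approx_chain_rule delta (fun x => x^-1) (fun x => - x ^- 2) (fun x => 2 * x ^- 3).
Proof.
move=> d0 e e0; have [r r0 H] := approx_small d0 e0.
exists (fun x => x / (r ^+ 2 + x ^+ 2)),
  (fun x => (r ^+ 2 - x ^+ 2) / (r ^+ 2 + x ^+ 2) ^+ 2),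
  (fun x => (2 * x ^+ 3 - 6 * r ^+ 2 * x) / (r ^+ 2 + x ^+ 2) ^+ 3).
by split; [exact: chain_rule_inv|move=> x /H[]].
Qed.

(** The formula Gamma2(phi(u)) = phi'^2 Gamma2(u) + phi' phi'' Gamma(u, Gamma(u)) + phi''^2
    Gamma(u)^2 with phi' = a - u and phi'' = -1. As v, L v and Gamma(v) are polynomials in the three
    elements u, L u, Gamma(u) of A, the diffusion property in three variables reduces it to an
    algebraic identity. *)
Lemma Gamma2_quadratic (a : R) u : A u ->
  let v x := a * u x - 2^-1 * (u x * u x) in A v /\
  {ae mu, forall x, G v v x = (a - u x) ^+ 2 * G u u x /\
   Gamma2 L v v x = (a - u x) ^+ 2 * Gamma2 L u u x - (a - u x) * G u (G u u) x +
     G u u x ^+ 2}.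
Proof.
move=> Au v.
pose f : 'I_3 -> T -> R := @vec [:: u; L u; G u u].
have Af : forall i, A (f i).
  apply: (@A_vec [:: u; L u; G u u]) => h /= [<-//|[<-|[<-|[]]]].
    exact: A_L.
  exact: A_Gamma.
pose V0 := @Var R 3 ord0.
pose V1 := @Var R 3 (lift ord0 ord0).
pose V2 := @Var R 3 (lift ord0 (lift ord0 ord0)).
pose C c := @Cst R 3 c.
pose ev e x := eval e (\row_i f i x).
have A_ev e : A (ev e) by exact: (A_term e Af).
pose ev0 := Add (Mul (C a) V0) (Mul (C (- 2^-1)) (Mul V0 V0)).
pose ep := Add (C a) (Mul (C (-1)) V0).
pose eLv := Add (Mul ep V1) (Mul (C (-1)) V2).
have vE : v = ev ev0.
  by apply/funext => x; rewrite /v /ev/= !mxE /f/vec/=; ring.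
have Av : A v by rewrite vE.
split => //.
have evE e x : ev e x = eval e (\row_i f i x) by [].
have LT e : {ae mu, forall x, L (ev e) x =
    \sum_(i < 3) ev (der i e) x * L (f i) x +
    \sum_(i < 3) \sum_(j < 3) ev (der i (der j e)) x * G (f i) (f j) x}.
  exact: (L_term e Af).
have L1 : {ae mu, forall x, L v x = ev eLv x}.
  rewrite vE; with_ae (LT ev0); apply: aeW => x ->.
  by rewrite !big_ord_recl !big_ord0 !evE /= !mxE /f /vec /=; field.
have GvE : {ae mu, forall x, G v v x = ev (Mul (Mul ep ep) V2) x}.
  with_ae L1; with_ae (LT (Mul ev0 ev0)); apply: aeW => x h1 h2.
  have -> : G v v x = 2^-1 * (L (ev (Mul ev0 ev0)) x - v x * L v x - v x * L v x).
    by rewrite /Gamma vE.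
  rewrite h1 h2 vE.
  by rewrite !big_ord_recl !big_ord0 !evE /= !mxE /f /vec /=; field.
have L3 := L_eq (A_Gamma Av Av) (A_ev _) GvE.
have L4 := L_eq (A_L Av) (A_ev _) L1.
have L5 : {ae mu, forall x, L (fun y => v y * L v y) x = L (ev (Mul ev0 eLv)) x}.
  apply: L_eq => //; first exact: (A_mul Av (A_L Av)).
  by with_ae L1; apply: aeW => x; rewrite vE => ->.
with_ae GvE; with_ae L1; with_ae L3; with_ae L4; with_ae L5.
with_ae (LT (Mul (Mul ep ep) V2)); with_ae (LT eLv); with_ae (LT (Mul ev0 eLv)).
apply: aeW => x t1 t2 t3 e5 e4 e3 e1 eG; split.
  by rewrite eG evE/= !mxE /f/vec/=; ring.
rewrite /Gamma2 e3 [Gamma L v (L v) x]/Gamma e5 e4 e1 t1 t2 t3.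
rewrite !big_ord_recl !big_ord0 vE !evE /= !mxE /f /vec /=.
rewrite (GammaC (L u) u) (GammaC (G u u) u) (GammaC (G u u) (L u)).
by field.
Qed.

(* Curvature for a u - u^2 / 2 at the value a = 2 u(x), where the first two
   derivatives are those of u(x)^2 log. *)
Lemma curvature_log delta u : 0 < delta -> A u -> {ae mu, forall x, delta <= u x} ->
  {ae mu, forall x, rho * (G u u x / u x) <=
    u x * (Gamma2 L u u x / u x ^+ 2 - G u (G u u) x / u x ^+ 3 + G u u x ^+ 2 / u x ^+ 4)}.
Proof.
move=> d0 Au du.
have : {ae mu, forall x, forall a, 0 <= (a - u x) ^+ 2 * (Gamma2 L u u x - rho * G u u x) -
    (a - u x) * G u (G u u) x + G u u x ^+ 2}.
  apply: ae_forall_real => [a|x].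
    have [Av H] := Gamma2_quadratic a Au.
    with_ae H; with_ae (L_curvature Av); apply: aeW => x h [e1 e2]; move: h; rewrite e1 e2.
    by rewrite -subr_ge0; congr (_ <= _); ring.
  move=> a; apply: (@is_derive_continuous R _ a (2 * (a - u x) *
    (Gamma2 L u u x - rho * G u u x) - G u (G u u) x)).
  apply: is_derive_eq; rewrite -?[_ *: _]/(_ * _); ring.
move=> H; with_ae H; with_ae du; apply: aeW => x dx /(_ (2 * u x)).
have u0 := lt_le_trans d0 dx.
rewrite -subr_ge0 => h; rewrite -subr_ge0.
rewrite (_ : _ - _ = ((2 * u x - u x) ^+ 2 * (Gamma2 L u u x - rho * G u u x) -
    (2 * u x - u x) * G u (G u u) x + G u u x ^+ 2) / u x ^+ 3); last first.
  by field; rewrite gt_eqF.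
by rewrite divr_ge0 ?exprn_ge0 ?(ltW u0)//; move: h; rewrite subr0.
Qed.

(** * First and second derivatives of the entropy at a fixed time *)

Section FixedTime.
Variables (delta : R) (psi u : T -> R).
Hypotheses (delta_gt0 : 0 < delta) (Apsi : A psi) (Au : A u)
  (u_ge : {ae mu, forall x, delta <= u x}).

Let Bpsi : bdd psi := A_bdd Apsi.
Let BLpsi : bdd (L psi) := A_bdd (A_L Apsi).
Let BLLpsi : bdd (L (L psi)) := A_bdd (A_L (A_L Apsi)).
Let Bu : bdd u := A_bdd Au.
Let BLu : bdd (L u) := A_bdd (A_L Au).
Let BLLu : bdd (L (L u)) := A_bdd (A_L (A_L Au)).
Let BGu : bdd (G u u) := A_bdd (A_Gamma Au Au).
Let BLGu : bdd (L (G u u)) := A_bdd (A_L (A_Gamma Au Au)).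
Let BGGu : bdd (G (G u u) u) := A_bdd (A_Gamma (A_Gamma Au Au) Au).
Let BGLu : bdd (G (L u) u) := A_bdd (A_Gamma (A_L Au) Au).
Let Bln : bdd (fun x => ln (u x)) := bdd_ln delta_gt0 Bu u_ge.
Let Binv : bdd (fun x => (u x)^-1) := bdd_inv delta_gt0 Bu u_ge.

Let Binv2 : bdd (fun x => - u x ^- 2).
Proof.
apply: bddN; have := bddM Binv Binv; rewrite (_ : (fun x => _) = (fun x => u x ^- 2))//.
by apply/funext => x; rewrite expr2 invfM.
Qed.

Let Binv3 : bdd (fun x => 2 * u x ^- 3).
Proof.
apply: bddZ; have := bddM Binv (bddM Binv Binv).
rewrite (_ : (fun x => _) = (fun x => u x ^- 3))//.
by apply/funext => x; rewrite !exprS expr0 mulr1 !invfM.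
Qed.

(** The chain rule for ln with weight k = u gives L (u ln u) = L u ln u + L u + Gamma(u) / u in
    integrated form. *)
Lemma entropy_derivative :
  Int (fun x => L psi x * (u x * ln (u x)) + psi x * (- L u x * ln (u x) - L u x)) =
  Int (fun x => psi x * (G u u x / u x)).
Proof.
rewrite IntD; [|by bounded|by bounded].
rewrite (integral_chain_rule (approx_ln delta_gt0) Apsi Au Au u_ge Bln Binv Binv2).
rewrite -IntD; [|by bounded|by bounded].
apply: Int_eq; [by bounded|by bounded|].
with_ae u_ge; apply: aeW => x ux.
by field; rewrite gt_eqF// (lt_le_trans delta_gt0).
Qed.

(** Moving one L off psi in the products with u ln u, L u ln u, L u and Gamma(u) / u turns the
    right-hand side into the integral of 2 psi u Gamma2(ln u), where Gamma2(ln u) stands for its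
    expansion in u; [curvature_log] bounds it below pointwise. *)
Lemma entropy_second_derivative : {ae mu, forall x, 0 <= psi x} ->
  2 * rho * Int (fun x => psi x * (G u u x / u x)) <=
  Int (fun x => L (L psi) x * (u x * ln (u x)) +
    2 * (L psi x * (- L u x * ln (u x) - L u x)) +
    psi x * (L (L u) x * ln (u x) + L u x * (L u x / u x) + L (L u) x)).
Proof.
move=> psi0.
have E1 := integral_chain_rule (approx_ln delta_gt0) (A_L Apsi) Au Au
  u_ge Bln Binv Binv2.
have E2 := integral_chain_rule (approx_ln delta_gt0) Apsi (A_L Au) Au
  u_ge Bln Binv Binv2.
have E3 := integral_chain_rule (approx_inv delta_gt0) Apsi (A_Gamma Au Au) Au
  u_ge Binv Binv2 Binv3.
have E4 := L_symmetric Apsi (A_L Au).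
have E1' : Int (fun x => L (L psi) x * (u x * ln (u x))) =
    Int (fun x => L psi x * (L u x * ln (u x))) + Int (fun x => L psi x * L u x) +
    Int (fun x => L psi x * (G u u x / u x)).
  rewrite E1 -IntD; [|by bounded|by bounded].
  rewrite -IntD; [|by bounded|by bounded].
  apply: Int_eq; [by bounded|by bounded|].
  with_ae u_ge; apply: aeW => x ux.
  by field; rewrite gt_eqF// (lt_le_trans delta_gt0).
rewrite IntD; [|by bounded|by bounded].
rewrite IntD; [|by bounded|by bounded].
rewrite IntZ; last by bounded.
have E5 : Int (fun x => L psi x * (- L u x * ln (u x) - L u x)) =
    - Int (fun x => L psi x * (L u x * ln (u x))) - Int (fun x => L psi x * L u x).
  rewrite -IntN; last by bounded.
  rewrite -IntB; [|by bounded|by bounded].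
  by congr Int; apply/funext => x; ring.
rewrite E1' E5 -E4 E2 E3.
set J1 := Int _; set J2 := Int _; set J3 := Int _; set J4 := Int _; set J5 := Int _.
rewrite (_ : _ + J5 = (J4 + J5) - (J2 + J3)); last by ring.
rewrite /J1 /J2 /J3 /J4 /J5.
rewrite -IntD; [|by bounded|by bounded].
rewrite -IntD; [|by bounded|by bounded].
rewrite -IntB; [|by bounded|by bounded].
rewrite -IntZ; last by bounded.
apply: Int_le; [by bounded|by bounded|].
with_ae psi0; with_ae u_ge; with_ae (curvature_log delta_gt0 Au u_ge).
apply: aeW => x h ux p0.
have u0 := lt_le_trans delta_gt0 ux.
have -> : 2 * rho * (psi x * (G u u x / u x)) = psi x * (2 * (rho * (G u u x / u x))).
  by ring.
apply: (@le_trans _ _ (psi x * (2 * (u x * (Gamma2 L u u x / u x ^+ 2 -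
    G u (G u u) x / u x ^+ 3 + G u u x ^+ 2 / u x ^+ 4))))).
  by rewrite ler_wpM2l// ler_wpM2l.
rewrite le_eqVlt; apply/orP; left; apply/eqP.
rewrite /Gamma2 (GammaC (L u) u) (GammaC (G u u) u).
by field; rewrite gt_eqF.
Qed.

End FixedTime.

Lemma P_rep2 s f : 0 <= s -> A f -> exists k, [/\ A k,
  {ae mu, forall x, P s f x = k x}, {ae mu, forall x, P s (L f) x = L k x} &
  {ae mu, forall x, P s (L (L f)) x = L (L k) x}].
Proof.
move=> s0 Af; have [k [Ak k1 k2]] := P_rep s0 Af.
have [l [Al l1 l2]] := P_rep s0 (A_L Af).
exists k; split => //.
have E : {ae mu, forall x, l x = L k x}.
  by with_ae k2; with_ae l1; apply: aeW => x -> ->.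
by with_ae (L_eq Al (A_L Ak) E); with_ae l2; apply: aeW => x -> ->.
Qed.

(** * Entropy along the interpolation between psi and g *)

Section Flow.
Variables (delta t : R) (psi g : T -> R).
Hypotheses (delta_gt0 : 0 < delta) (t_ge0 : 0 <= t) (Apsi : A psi) (Ag : A g)
  (psi_ge0 : {ae mu, forall x, 0 <= psi x}) (g_ge : {ae mu, forall x, delta <= g x}).

Let u s := P (t - s) g.
Let v s := P (t - s) (L g).
Let w s := P (t - s) (L (L g)).

Let ts s : s \in `[0, t] -> 0 <= t - s.
Proof. by rewrite in_itv/= subr_ge0 => /andP[]. Qed.

Let Bu s : s \in `[0, t] -> bdd (u s).
Proof. by move=> /ts s0; exact: (bddP s0 (A_bdd Ag)). Qed.

Let Bv s : s \in `[0, t] -> bdd (v s).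
Proof. by move=> /ts s0; exact: (bddP s0 (A_bdd (A_L Ag))). Qed.

Let u_ge s : s \in `[0, t] -> {ae mu, forall x, delta <= u s x}.
Proof. by move=> /ts s0; exact: (P_ge s0 (A_bdd Ag) g_ge). Qed.

Let Cu : curve mu 0 t u (fun s x => - v s x).
Proof. exact: curve_rev (curve_semigroup t (lexx 0) Ag). Qed.

Let Cv : curve mu 0 t v (fun s x => - w s x).
Proof. exact: curve_rev (curve_semigroup t (lexx 0) (A_L Ag)). Qed.

Let Cln : curve mu 0 t (fun s x => ln (u s x)) (fun s x => - v s x / u s x).
Proof. exact: (curve_ln delta_gt0 Cu u_ge). Qed.

(* The generator is moved onto psi and g, where it commutes with the semigroup;
   no bound on L (ln (P_(t-s) g)) that is uniform in s is needed. *)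
Definition flow s := Int (fun x => P s psi x * (u s x * ln (u s x))).

Definition flow' s := Int (fun x => P s (L psi) x * (u s x * ln (u s x)) +
  P s psi x * (- v s x * ln (u s x) - v s x)).

Definition flow'' s := Int (fun x => P s (L (L psi)) x * (u s x * ln (u s x)) +
  2 * (P s (L psi) x * (- v s x * ln (u s x) - v s x)) +
  P s psi x * (w s x * ln (u s x) + v s x * (v s x / u s x) + w s x)).

Lemma curve_flow : curve mu 0 t (fun s => cst (flow s)) (fun s => cst (flow' s)).
Proof.
apply: curve_Int.
have C := curveM (curve_semigroup t (lexx 0) Apsi)
  (curveM Cu Cln).
apply: (curve_eq C) => s sab.
- have s0 : 0 <= s by move: sab; rewrite in_itv/= => /andP[].
  have B1 := bddP s0 (A_bdd Apsi).
  have B2 := bddP s0 (A_bdd (A_L Apsi)).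
  have B3 := Bu sab; have B4 := Bv sab; have B5 := bdd_ln delta_gt0 B3 (u_ge sab).
  by split; bounded.
- by apply: aeW.
- with_ae (u_ge sab); apply: aeW => x ux; congr (_ + _ * _).
  by field; rewrite gt_eqF// (lt_le_trans delta_gt0).
Qed.

Lemma curve_flow' : curve mu 0 t (fun s => cst (flow' s)) (fun s => cst (flow'' s)).
Proof.
apply: curve_Int.
have C := curveD
  (curveM (curve_semigroup t (lexx 0) (A_L Apsi))
    (curveM Cu Cln))
  (curveM (curve_semigroup t (lexx 0) Apsi)
    (curveB (curveM (curveZ (-1) Cv) Cln) Cv)).
apply: (curve_eq C) => s sab.
- have s0 : 0 <= s by move: sab; rewrite in_itv/= => /andP[].
  have B1 := bddP s0 (A_bdd Apsi).
  have B2 := bddP s0 (A_bdd (A_L Apsi)).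
  have B3 := bddP s0 (A_bdd (A_L (A_L Apsi))).
  have B4 := Bu sab; have B5 := Bv sab; have B6 := bdd_ln delta_gt0 B4 (u_ge sab).
  have B7 := bdd_inv delta_gt0 B4 (u_ge sab).
  have B8 := bddP (ts sab) (A_bdd (A_L (A_L Ag))).
  by split; rewrite /u /v /w in B4 B5 B6 B7 B8 *; bounded.
- by apply: aeW => x; rewrite mulN1r.
- with_ae (u_ge sab); apply: aeW => x ux.
  by field; rewrite gt_eqF// (lt_le_trans delta_gt0).
Qed.

(** At a given s, the functions P_s psi and P_(t-s) g have representatives in A on which L commutes
    with the semigroup, so the fixed-time identities apply to them. *)
Let fixed_time s : s \in `[0, t] -> exists phi k, [/\ A phi, A k,
    {ae mu, forall x, delta <= k x}, {ae mu, forall x, 0 <= phi x} &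
  [/\ flow' s = Int (fun x => L phi x * (k x * ln (k x)) + phi x * (- L k x * ln (k x) - L k x)) &
  flow'' s = Int (fun x => L (L phi) x * (k x * ln (k x)) +
    2 * (L phi x * (- L k x * ln (k x) - L k x)) +
    phi x * (L (L k) x * ln (k x) + L k x * (L k x / k x) + L (L k) x))]].
Proof.
move=> sab; have s0 : 0 <= s by move: sab; rewrite in_itv/= => /andP[].
have [phi [Aphi p1 p2 p3]] := P_rep2 s0 Apsi.
have [k [Ak k1 k2 k3]] := P_rep2 (ts sab) Ag.
have k_ge : {ae mu, forall x, delta <= k x}.
  by with_ae k1; with_ae (u_ge sab); apply: aeW => x h1 h2; rewrite -h2.
have phi0 : {ae mu, forall x, 0 <= phi x}.
  with_ae p1; with_ae (P_ge s0 (A_bdd Apsi) psi_ge0).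
  by apply: aeW => x h1 h2; rewrite -h2.
exists phi, k; split => //.
have B1 := bddP s0 (A_bdd Apsi).
have B2 := bddP s0 (A_bdd (A_L Apsi)).
have B3 := bddP s0 (A_bdd (A_L (A_L Apsi))).
have B4 := Bu sab; have B5 := Bv sab; have B6 := bdd_ln delta_gt0 B4 (u_ge sab).
have B7 := bdd_inv delta_gt0 B4 (u_ge sab).
have B8 := bddP (ts sab) (A_bdd (A_L (A_L Ag))).
have B1' := A_bdd Aphi; have B2' := A_bdd (A_L Aphi); have B3' := A_bdd (A_L (A_L Aphi)).
have B4' := A_bdd Ak; have B5' := A_bdd (A_L Ak); have B8' := A_bdd (A_L (A_L Ak)).
have B6' := bdd_ln delta_gt0 B4' k_ge; have B7' := bdd_inv delta_gt0 B4' k_ge.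
split; rewrite /flow' /flow'' /u /v /w in B4 B5 B6 B7 B8 *.
  apply: Int_eq; [by bounded|by bounded|].
  by with_ae p1; with_ae p2; with_ae k1; with_ae k2; apply: aeW => x -> -> -> ->.
apply: Int_eq; [by bounded|by bounded|].
with_ae p1; with_ae p2; with_ae p3; with_ae k1; with_ae k2; with_ae k3.
by apply: aeW => x -> -> -> -> -> ->.
Qed.

Lemma flow''_ge s : s \in `[0, t] -> 2 * rho * flow' s <= flow'' s.
Proof.
move=> /fixed_time[phi [k [Aphi Ak k_ge phi0 [-> ->]]]].
rewrite (entropy_derivative delta_gt0 Aphi Ak k_ge).
exact: (entropy_second_derivative delta_gt0 Aphi Ak k_ge phi0).
Qed.

End Flow.

(** * The local logarithmic Sobolev inequality and the entropic inequality *)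

Lemma A_exp (l : R) f : A f -> A (fun x => expR (l * f x)).
Proof. by move=> Af; exact: (A_app exp_jet (A_scale l Af)). Qed.

Lemma Gamma_exp (l : R) f : A f -> {ae mu, forall x,
  G (fun y => expR (l * f y)) (fun y => expR (l * f y)) x =
  l ^+ 2 * expR (l * f x) ^+ 2 * G f f x}.
Proof.
move=> Af.
pose w := App exp_jet 0 (Mul (@Cst R 1 l) (Var ord0)).
have h1 := L_term w (fun=> Af); have h2 := L_term (Mul w w) (fun=> Af).
have E : (fun x => eval w (\row__ f x)) = (fun y => expR (l * f y)).
  by apply/funext => x; rewrite /= mxE.
have E2 : (fun x => eval (Mul w w) (\row__ f x)) = (fun y => expR (l * f y) * expR (l * f y)).
  by apply/funext => x; rewrite /= mxE.
rewrite E in h1; rewrite E2 in h2.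
with_ae h1; with_ae h2; apply: aeW => x; rewrite /Gamma => -> ->.
by rewrite !big_ord_recl !big_ord0 /= !mxE /Gamma; field.
Qed.

Lemma exp_lower_bound f : bdd f -> exists2 m : R, 0 < m &
  forall l, l \in `[0, 1] -> {ae mu, forall x, m <= expR (l * f x)}.
Proof.
move=> Bf; have [K K0 HK] := bdd_bound Bf; exists (expR (- K)); first exact: expR_gt0.
move=> l; rewrite in_itv/= => /andP[l0 l1]; with_ae HK; apply: aeW => x.
rewrite ler_norml ler_expR => /andP[h _].
have [f0|f0] := leP 0 (f x); first by rewrite (@le_trans _ _ 0)// ?oppr_le0// mulr_ge0.
rewrite (le_trans h)// -subr_ge0 (_ : _ - _ = (1 - l) * - f x); last by ring.
by rewrite mulr_ge0// ?subr_ge0// oppr_ge0 ltW.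
Qed.

Lemma local_log_sobolev (l t : R) f : 0 <= t -> l \in `[0, 1] -> A f -> {ae mu, forall x,
  P t (fun y => expR (l * f y) * (l * f y)) x -
  P t (fun y => expR (l * f y)) x * ln (P t (fun y => expR (l * f y)) x) <=
  (1 - expR (- (2 * rho * t))) / (2 * rho) *
  P t (fun y => l ^+ 2 * expR (l * f y) * G f f y) x}.
Proof.
move=> t0 l01 Af; set g := fun y => expR (l * f y).
have Ag : A g by exact: A_exp.
have [m m0 /(_ l l01) gm] := exp_lower_bound (A_bdd Af).
have Aglf : A (fun y => g y * (l * f y)) by exact/(A_mul)/(A_scale).
have AgG : A (fun y => l ^+ 2 * g y * G f f y).
  by apply: (A_mul _ (A_Gamma Af Af)); exact: (A_scale).
have Bg := A_bdd Ag; have Bglf := A_bdd Aglf; have BgG := A_bdd AgG.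
have BPg := bddP t0 Bg; have BPglf := bddP t0 Bglf.
have BPgG := bddP t0 BgG.
have Pgm := P_ge t0 Bg gm; have Bln := bdd_ln m0 BPg Pgm.
set c := (1 - _) / _.
have BW : bdd (fun x => P t (fun y => g y * (l * f y)) x - P t g x * ln (P t g x) -
    c * P t (fun y => l ^+ 2 * g y * G f f y) x).
  by apply: bddB; [apply: bddB => //; exact: bddM|exact: bddZ].
suff H : {ae mu, forall x, P t (fun y => g y * (l * f y)) x - P t g x * ln (P t g x) -
    c * P t (fun y => l ^+ 2 * g y * G f f y) x <= 0}.
  by with_ae H; apply: aeW => x; rewrite subr_le0.
apply: (ae_le0_test BW) => phi Aphi.
pose psi x := phi x ^+ 2.
have Apsi : A psi by exact: (A_mul Aphi Aphi).
have psi0 : {ae mu, forall x, 0 <= psi x} by apply: aeW => x; exact: sqr_ge0.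
have Bpsi := A_bdd Apsi; have BPpsi := bddP t0 Bpsi.
have BLg := A_bdd (A_L Ag); have BGg := A_bdd (A_Gamma Ag Ag).
have Blng := bdd_ln m0 Bg gm; have Bging := bdd_inv m0 Bg gm.
have P0g := ms_0 P_markov (bdd_L2 Bg); have P0Lg := ms_0 P_markov (bdd_L2 BLg).
have P0psi := ms_0 P_markov (bdd_L2 Bpsi).
have z0 : 0 <= 0 :> R by [].
have BP0g := bddP z0 Bg; have BP0Lg := bddP z0 BLg.
have BP0psi := bddP z0 Bpsi; have BPLpsi := bddP t0 (A_bdd (A_L Apsi)).
have P0gm := P_ge z0 Bg gm; have BP0ln := bdd_ln m0 BP0g P0gm.
have c20 : 0 < 2 * rho by exact: mulr_gt0.
(* At s = t the inner semigroup is the identity, so F(t) involves g ln g = e^(l f) l f and F'(t)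
   involves Gamma(g) / g = l^2 g Gamma(f), with P_t moved off psi by symmetry. At s = 0 the factor
   P_s psi is psi. *)
have := curve_gronwall c20 t0 (curve_flow t m0 Apsi Ag gm)
  (curve_flow' t m0 Apsi Ag gm)
  (flow''_ge
    m0 Apsi Ag psi0 gm).
rewrite -/c.
have -> : flow t psi g t = Int (fun x => psi x * P t (fun y => g y * (l * f y)) x).
  rewrite (P_symmetric t0 Apsi Aglf).
  rewrite /flow subrr; apply: Int_eq; [by bounded|by bounded|].
  by with_ae P0g; apply: aeW => x ->; rewrite {3}/g expRK.
have -> : flow t psi g 0 = Int (fun x => psi x * (P t g x * ln (P t g x))).
  rewrite /flow subr0; apply: Int_eq; [by bounded|by bounded|].
  by with_ae P0psi; apply: aeW => x ->.
have -> : flow' t psi g t = Int (fun x => psi x * P t (fun y => l ^+ 2 * g y * G f f y) x).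
  rewrite (P_symmetric t0 Apsi AgG).
  have [k [Ak k1 k2]] := P_rep t0 Apsi.
  have Bk := A_bdd Ak; have BLk := A_bdd (A_L Ak).
  transitivity (Int (fun x => k x * (G g g x / g x))).
    rewrite -(entropy_derivative m0 Ak Ag gm).
    rewrite /flow' subrr; apply: Int_eq; [by bounded|by bounded|].
    by with_ae P0g; with_ae P0Lg; with_ae k1; with_ae k2; apply: aeW => x -> -> -> ->.
  apply: Int_eq; [by bounded|by bounded|].
  with_ae k1; with_ae (Gamma_exp l Af); apply: aeW => x -> ->; rewrite /g.
  by field; rewrite gt_eqF// expR_gt0.
move=> h.
rewrite (_ : (fun x => phi x ^+ 2 * _) = (fun x =>
   psi x * P t (fun y => g y * (l * f y)) x - psi x * (P t g x * ln (P t g x)) -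
   c * (psi x * P t (fun y => l ^+ 2 * g y * G f f y) x))); last first.
  by apply/funext => x; rewrite /psi; ring.
rewrite IntB; [|by bounded|by bounded].
rewrite IntB; [|by bounded|by bounded].
rewrite IntZ; last by bounded.
by rewrite subr_le0.
Qed.

(* Young's inequality (k - h - r + 1) e^h <= e^(k - r), optimized in r. *)
Lemma entropy_variational (t : R) h k : 0 <= t -> A h -> A k -> {ae mu, forall x,
  P t (fun y => expR (h y) * k y) x <=
  P t (fun y => expR (h y) * h y) x -
  P t (fun y => expR (h y)) x * ln (P t (fun y => expR (h y)) x) +
  P t (fun y => expR (h y)) x * ln (P t (fun y => expR (k y)) x)}.
Proof.
move=> t0 Ah Ak.
have Aexp f : A f -> A (fun y => expR (f y)) by exact: (A_app exp_jet).
have Bh := A_bdd Ah; have Bk := A_bdd Ak.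
have Beh := A_bdd (Aexp h Ah); have Bek := A_bdd (Aexp k Ak).
have Bhh := bddM Beh Bh; have Bhk := bddM Beh Bk.
have pos f : bdd f -> {ae mu, forall x, 0 < P t (fun y => expR (f y)) x}.
  move=> Bf; have [m m0 /(_ 1)] := exp_lower_bound Bf.
  rewrite in_itv/= ler01 lexx => /(_ isT) fm.
  have Bef : bdd (fun y => expR (f y)).
    have := curve_exp 0 1 Bf => /(curve_bdd (s := 1)).
    rewrite in_itv/= ler01 lexx => /(_ isT).
    by rewrite (_ : (fun x => _) = (fun x => expR (f x)))//; apply/funext => x; rewrite mul1r.
  have fm' : {ae mu, forall x, m <= expR (f x)} by with_ae fm; apply: aeW => x; rewrite mul1r.
  by with_ae (P_ge t0 Bef fm'); apply: aeW => x; exact: lt_le_trans.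
have : {ae mu, forall x, forall r : R, 0 <= P t (fun y => expR (h y) * h y) x +
    ((r - 1) * P t (fun y => expR (h y)) x + expR (- r) * P t (fun y => expR (k y)) x) -
    P t (fun y => expR (h y) * k y) x}.
  apply: ae_forall_real => [r|x].
    have B1 := bddZ (r - 1) Beh; have B2 := bddZ (expR (- r)) Bek.
    have young : {ae mu, forall x, expR (h x) * k x <= expR (h x) * h x +
        ((r - 1) * expR (h x) + expR (- r) * expR (k x))}.
      apply: aeW => x; have := expR_ge1Dx (k x - r - h x).
      rewrite -(ler_pM2l (expR_gt0 (h x))) -!expRD.
      rewrite (_ : h x + (k x - r - h x) = - r + k x); last by ring.
      by lra.
    with_ae (P_le t0 Bhk (bddD Bhh (bddD B1 B2)) young).
    with_ae (PD t0 Bhh (bddD B1 B2)); with_ae (PD t0 B1 B2).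
    with_ae (PZ (r - 1) t0 Beh); with_ae (PZ (expR (- r)) t0 Bek).
    by apply: aeW => x e1 e2 e3 e4; rewrite e4 e3 e2 e1 subr_ge0.
  have ce : continuous (fun r : R => expR (- r)).
    by move=> r; apply: (@continuous_comp _ _ _ -%R expR);
      [exact: opp_continuous|exact: continuous_expR].
  move=> r; apply: cvgB; last exact: cvg_cst.
  apply: cvgD; first exact: cvg_cst.
  apply: cvgD; apply: cvgM; try exact: cvg_cst; last exact: ce.
  by apply: cvgB; [exact: cvg_id|exact: cvg_cst].
move=> H; with_ae H; with_ae (pos h Bh); with_ae (pos k Bk).
(* The optimal shift r satisfies e^(-r) P_t e^k = P_t e^h at x, which cancels the term - P_t e^h. *)
apply: aeW => x k0 h0 /(_ (ln (P t (fun y => expR (k y)) x) - ln (P t (fun y => expR (h y)) x))).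
rewrite opprB expRB !lnK ?posrE// divfK ?gt_eqF//.
by lra.
Qed.

(** * Herbst's argument *)

Section HerbstIntegration.
Variables (f : T -> R) (t alpha s : R).
Hypotheses (Af : A f) (t_gt0 : 0 < t) (s_gt1 : 1 < s)
  (alphaE : alpha = s ^+ 2 * ((1 - expR (- (2 * rho * t))) / (2 * rho))).

Let t0 : 0 <= t := ltW t_gt0.
Let Bf : bdd f := A_bdd Af.
Let AG : A (G f f) := A_Gamma Af Af.
Let BG : bdd (G f f) := A_bdd AG.
Let N (l : R) := P t (fun y => expR (l * f y)).
Let N' (l : R) := P t (fun y => f y * expR (l * f y)).
Let beta x := ln (P t (fun y => expR (alpha * G f f y)) x).
(** The primitive of 1 / (s^2 - l^2) that vanishes at 0; its value at 1 is the constant of the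
    inequality. *)
Let theta (l : R) := (2 * s)^-1 * (ln (s + l) - ln (s - l)).

Let C_gt0 : 0 < (1 - expR (- (2 * rho * t))) / (2 * rho).
Proof.
by rewrite divr_gt0 ?mulr_gt0// subr_gt0 expR_lt1 oppr_lt0 !mulr_gt0.
Qed.

Lemma bdd_exp (l : R) (g : T -> R) : bdd g -> bdd (fun y => expR (l * g y)).
Proof.
move=> Bg; apply: (curve_bdd (curve_exp l l Bg)).
by rewrite in_itv/= lexx.
Qed.

Let Bbeta : bdd beta.
Proof.
have Bag := bddZ alpha BG.
have [m m0 /(_ 1)] := exp_lower_bound Bag; rewrite in_itv/= ler01 lexx => /(_ isT) h.
have Be : bdd (fun y => expR (alpha * G f f y)) by exact: bdd_exp.
apply: (bdd_ln m0); first exact: (bddP t0 Be).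
apply: (P_ge t0 Be); with_ae h; apply: aeW => x.
by rewrite mul1r.
Qed.

Let N_ge : exists2 m : R, 0 < m & forall l, l \in `[0, 1] -> {ae mu, forall x, m <= N l x}.
Proof.
have [m m0 h] := exp_lower_bound Bf; exists m => // l l01.
exact: (P_ge t0 (bdd_exp l Bf) (h l l01)).
Qed.

(** For the entropy D = l N' - N ln N, the log-Sobolev inequality multiplied by s^2 and the relation
    alpha = s^2 C give s^2 D <= l^2 alpha P_t (e^(l f) Gamma(f)), and the entropic inequality bounds
    this by l^2 (D + N beta). *)
Let entropy_bound l : l \in `[0, 1] -> {ae mu, forall x,
  (l * N' l x - N l x * ln (N l x)) * (s ^+ 2 - l ^+ 2) <= l ^+ 2 * (N l x * beta x)}.
Proof.
move=> l01.
have Be := bdd_exp l Bf; have BeG := bddM Be BG; have Bfe := bddM Bf Be.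
have H1 := local_log_sobolev t0 l01 Af.
have H2 := entropy_variational t0 (A_scale l Af)
  (A_scale alpha AG).
have E1 : (fun y => expR (l * f y) * (l * f y)) = (fun y => l * (f y * expR (l * f y))).
  by apply/funext => y; ring.
have E2 : (fun y => l ^+ 2 * expR (l * f y) * G f f y) =
    (fun y => l ^+ 2 * (expR (l * f y) * G f f y)).
  by apply/funext => y; ring.
have E3 : (fun y => expR (l * f y) * (alpha * G f f y)) =
    (fun y => alpha * (expR (l * f y) * G f f y)).
  by apply/funext => y; ring.
with_ae H1; with_ae H2; with_ae (PZ l t0 Bfe); with_ae (PZ (l ^+ 2) t0 BeG).
with_ae (PZ alpha t0 BeG); apply: aeW => x e1 e2 e3.
rewrite E1 E2 E3 e1 e2 e3 -/(N l x) -/(N' l x) -/(beta x).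
set Q := P t _ x; set D := _ - N l x * ln (N l x); set C := _ / _ => h1 h2.
have l20 : 0 <= l ^+ 2 by exact: sqr_ge0.
have s20 : 0 <= s ^+ 2 by exact: sqr_ge0.
have h3 : D * s ^+ 2 <= C * (l ^+ 2 * Q) * s ^+ 2 by rewrite ler_wpM2r.
have h4 : l ^+ 2 * (s ^+ 2 * C * Q) <= l ^+ 2 * (D + N l x * beta x).
  by rewrite ler_wpM2l// -alphaE.
by lra.
Qed.

Let curve_N a b : curve mu a b N N'.
Proof. exact: (curve_P t0 (curve_exp a b Bf)). Qed.

Let curve_theta a b : 0 <= a -> b <= 1 ->
  curve mu a b (fun l => cst (theta l)) (fun l => cst (s ^+ 2 - l ^+ 2)^-1).
Proof.
move=> a0 b1.
have C1 := curveD (curve_const a b (bdd_cst mu s)) (curve_id mu a b).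
have C2 := curveB (curve_const a b (bdd_cst mu s)) (curve_id mu a b).
have s10 : 0 < s - 1 by rewrite subr_gt0.
have D1 : forall l, l \in `[a, b] -> {ae mu, forall x, s - 1 <= cst s x + cst l x}.
  by move=> l; rewrite in_itv/= => /andP[h1 h2]; apply: aeW => x /=; lra.
have D2 : forall l, l \in `[a, b] -> {ae mu, forall x, s - 1 <= cst s x - cst l x}.
  by move=> l; rewrite in_itv/= => /andP[h1 h2]; apply: aeW => x /=; lra.
have C := curveZ (2 * s)^-1 (curveB (curve_ln s10 C1 D1) (curve_ln s10 C2 D2)).
apply: (curve_eq C) => l lab.
- by split; exact: bdd_cst.
- exact: aeW.
- apply: aeW => x /=; move: lab; rewrite in_itv/= => /andP[h1 h2].
  have n1 : s + l != 0 by rewrite gt_eqF//; lra.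
  have n2 : s - l != 0 by rewrite gt_eqF//; lra.
  have n3 : s ^+ 2 - l ^+ 2 != 0 by rewrite subr_sqr mulf_neq0.
  have n4 : s != 0 by rewrite gt_eqF//; lra.
  by field; rewrite n1 n2 n3 n4.
Qed.

(** The derivative of ln N(l) / l is (l N' - N ln N) / (l^2 N), at most beta / (s^2 - l^2), whose
    denominator is positive since l <= 1 < s. Integration starts at eps because 1 / l is singular at
    0. *)
Let herbst_from eps : 0 < eps <= 1 ->
  {ae mu, forall x, ln (N 1 x) <= ln (N eps x) / eps + (theta 1 - theta eps) * beta x}.
Proof.
move=> /andP[e0 e1].
have [m m0 Nm] := N_ge.
have in01 l : l \in `[eps, 1] -> l \in `[0, 1].
  by rewrite !in_itv/= => /andP[h1 h2]; rewrite h2 (le_trans (ltW e0)).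
have C := curveB
  (curveM (curve_theta (ltW e0) (lexx 1)) (curve_const eps 1 Bbeta))
  (curveM (curve_ln m0 (curve_N eps 1) (fun l lab => Nm l (in01 l lab)))
    (curve_cst_inv mu 1 e0)).
have H : {ae mu, forall x, theta eps * beta x - ln (N eps x) * eps^-1 <=
    theta 1 * beta x - ln (N 1 x) * 1^-1}.
  apply: (curve_le e1 C) => l lab.
  with_ae (entropy_bound (in01 l lab)); with_ae (Nm l (in01 l lab)); apply: aeW => x /=.
  move=> hN hD; have N0 := lt_le_trans m0 hN.
  have [l0 l1] : 0 < l /\ l <= 1.
    by move: lab; rewrite in_itv/= => /andP[h1 h2]; rewrite (lt_le_trans e0).
  have sl : 0 < s ^+ 2 - l ^+ 2.
    rewrite subr_sqr mulr_gt0 ?subr_gt0 ?addr_gt0 ?(lt_trans ltr01 s_gt1)//.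
    exact: le_lt_trans l1 s_gt1.
  rewrite (_ : _ - _ = (l ^+ 2 * (N l x * beta x) -
    (l * N' l x - N l x * ln (N l x)) * (s ^+ 2 - l ^+ 2)) /
      ((s ^+ 2 - l ^+ 2) * N l x * l ^+ 2)); last first.
    by field; rewrite !gt_eqF.
  by rewrite divr_ge0 ?subr_ge0// !mulr_ge0// ?ltW// exprn_gt0.
with_ae H; apply: aeW => x; rewrite invr1 mulr1.
by move: (ln (N eps x) / eps) (theta eps) (theta 1) => a b c; lra.
Qed.

(** First-order expansion at l = 0, where N = 1 and N' = P_t f; with ln z <= z - 1 it gives the
    upper bound, the only side needed. *)
Let N_small : exists2 K : R, 0 <= K & forall eps, 0 < eps <= 1 ->
  {ae mu, forall x, ln (N eps x) / eps <= P t f x + K * eps}.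
Proof.
have [m m0 Nm] := N_ge.
have [K K0 [_ HK]] := curve_N 0 1; exists K => // eps /andP[e0 e1].
have i0 : 0 \in `[0, (1 : R)] by rewrite in_itv/= lexx ler01.
have ie : eps \in `[0, (1 : R)] by rewrite in_itv/= (ltW e0).
with_ae (HK 0 eps i0 ie); with_ae (Nm eps ie); with_ae (P_cst 1 t0).
apply: aeW => x; rewrite /N /N'.
have -> : (fun y => expR (0 * f y)) = cst 1 by apply/funext => y; rewrite mul0r expR0.
have -> : (fun y => f y * expR (0 * f y)) = f by apply/funext => y; rewrite mul0r expR0 mulr1.
rewrite -/(N eps x) => -> hN; rewrite ler_norml subr0 => /andP[_ h].
have N0 := lt_le_trans m0 hN; have h1 := ln_le_sub1 N0.
by rewrite ler_pdivrMr//; lra.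
Qed.

Lemma herbst : {ae mu, forall x, ln (P t (fun y => expR (f y)) x) - P t f x <=
  1 / (2 * s) * ln ((s + 1) / (s - 1)) * beta x}.
Proof.
have [K K0 HK] := N_small.
have H : {ae mu, forall x, forall n : nat,
    ln (N 1 x) <= P t f x + K * n.+1%:R^-1 + (theta 1 - theta n.+1%:R^-1) * beta x}.
  apply: ae_foralln => n.
  have e01 : 0 < (n.+1%:R^-1 : R) <= 1.
    by rewrite invr_gt0 ltr0n/= invf_le1 ?ler1n ?ltr0n.
  with_ae (HK _ e01); with_ae (herbst_from e01); apply: aeW => x h1 h2.
  by rewrite (le_trans h1)// lerD2r.
have s10 : 0 < s - 1 by rewrite subr_gt0.
have s0 : 0 < s by rewrite (lt_trans ltr01).
(* The cost of starting at e instead of 0 is O(e), by ln z <= z - 1 at z = (s + e) / (s - e) and s -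
   e >= s - 1. *)
have th e : 0 < e <= 1 -> `|theta e| <= (s * (s - 1))^-1 * e.
  move=> /andP[e0 e1].
  have p1 : 0 < s + e by rewrite addr_gt0.
  have p2 : 0 < s - e by rewrite subr_gt0 (le_lt_trans e1).
  have lnE : ln (s + e) - ln (s - e) = ln ((s + e) / (s - e)) by rewrite ln_div.
  have h1 : 0 <= ln ((s + e) / (s - e)).
    by rewrite ln_ge0// ler_pdivlMr// mul1r; lra.
  have h2 := ln_le_sub1 (divr_gt0 p1 p2).
  rewrite /theta lnE ger0_norm; last by rewrite mulr_ge0// invr_ge0 mulr_ge0// ltW.
  apply: (@le_trans _ _ ((2 * s)^-1 * (2 * e / (s - 1)))); last first.
    by rewrite le_eqVlt; apply/orP; left; apply/eqP; field; rewrite !gt_eqF.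
  rewrite ler_wpM2l ?invr_ge0 ?mulr_ge0 ?(ltW s0)// (le_trans h2)//.
  rewrite (_ : _ - 1 = 2 * e / (s - e)); last by field; rewrite gt_eqF.
  by rewrite ler_wpM2l ?mulr_ge0 ?(ltW e0)// lef_pV2 ?posrE// lerB.
with_ae H; apply: aeW => x {}H.
have N1 : N 1 = P t (fun y => expR (f y)).
  by rewrite /N; congr (P t _); apply/funext => y; rewrite mul1r.
rewrite -N1 lerBlDl.
have -> : 1 / (2 * s) * ln ((s + 1) / (s - 1)) = theta 1.
  by rewrite /theta ln_div ?posrE// ?addr_gt0// div1r.
apply/ler_addgt0Pr => e e0.
pose M := K + (s * (s - 1))^-1 * `|beta x|.
have M0 : 0 <= M by rewrite addr_ge0// mulr_ge0// invr_ge0 mulr_ge0// ltW.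
pose n := Num.truncn (M / e).
have hn : M / e < n.+1%:R := truncnS_gt _.
have e01 : 0 < (n.+1%:R^-1 : R) <= 1.
  by rewrite invr_gt0 ltr0n/= invf_le1 ?ler1n ?ltr0n.
have hM : M * n.+1%:R^-1 <= e.
  by rewrite ler_pdivrMr ?ltr0n// -ler_pdivrMl// mulrC ltW.
have h3 : - (theta n.+1%:R^-1 * beta x) <= (s * (s - 1))^-1 * `|beta x| * n.+1%:R^-1.
  apply: (le_trans (ler_norm _)); rewrite normrN normrM mulrAC.
  by rewrite ler_wpM2r// th.
have := H n; move: hM h3; rewrite /M; move: (n.+1%:R^-1 : R) => z.
by move: (theta z) (theta 1) (beta x) `|beta x| ((s * (s - 1))^-1) => *; lra.
Qed.

End HerbstIntegration.

(** * The limit of large times and the conclusion *)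

Lemma cvg_Int_ln (g : T -> R) (m : R) : A g -> 0 < m -> {ae mu, forall x, m <= g x} ->
  Int (fun x => ln (P t g x)) @[t --> +oo] --> ln (Int g).
Proof.
move=> Ag m0 gm; have Bg := A_bdd Ag.
have Im : m <= Int g.
  by rewrite -(Int_cst mu m); apply: Int_le => //; exact: bdd_cst.
apply/cvgrPdist_le => e e0.
(* P_t g stays above m, where ln is Lipschitz with constant 1 / m; so the L^2 distance to the mean
   is required to be at most e m. *)
have em0 : 0 < e * m by exact: mulr_gt0.
have := @Lpdist_cvg0 _ _ _ mu (+oo%R) (fun t => P t g) (cst (Int g)) _
  (fun t t0 => bddP (ltW t0) Bg) (bdd_cst mu _) (nbhs_pinfty_gt (num_real 0))
  (ac_ergodic A_admissible Ag) _ (exprn_gt0 2 em0).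
move=> H; near=> t.
have t0 : 0 <= t by near: t; exact: (nbhs_pinfty_ge (num_real _)).
have Ht : Int (fun x => (P t g x - cst (Int g) x) ^+ 2) <= (e * m) ^+ 2.
  by near: t; exact: H.
have BP := bddP t0 Bg; have Pm := P_ge t0 Bg gm.
have Bl := bdd_ln m0 BP Pm; have Bc := bdd_cst mu (ln (Int g)).
have Bs := bdd_sqr (bddB BP (bdd_cst mu (Int g))).
rewrite distrC -(Int_cst mu (ln (Int g))) -IntB//.
apply: (@le_trans _ _ (Int (fun x => `|ln (P t g x) - cst (ln (Int g)) x|))).
  have Bn := bdd_norm (bddB Bl Bc).
  have Bd := bddB Bl Bc.
  have h1 : Int (fun x => ln (P t g x) - cst (ln (Int g)) x) <=
      Int (fun x => `|ln (P t g x) - cst (ln (Int g)) x|).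
    by apply: Int_le => //; apply: aeW => x; exact: ler_norm.
  have h2 : - Int (fun x => ln (P t g x) - cst (ln (Int g)) x) <=
      Int (fun x => `|ln (P t g x) - cst (ln (Int g)) x|).
    rewrite -IntN//; apply: Int_le => //; first exact: bddN.
    by apply: aeW => x; rewrite -normrN; exact: ler_norm.
  by rewrite ler_norml h1 andbT lerNl.
(* The inequality z / m <= z^2 / (2 e m^2) + e / 2 replaces Cauchy-Schwarz: each of the two terms
   integrates to at most e / 2. *)
apply: (@le_trans _ _ (Int (fun x => (2 * e)^-1 * (m ^- 2 *
    (P t g x - cst (Int g) x) ^+ 2) + cst (e / 2) x))).
  apply: Int_le; [exact/bdd_norm/bddB|by apply: bddD; [exact/bddZ/bddZ|exact: bdd_cst]|].
  with_ae Pm; apply: aeW => x px /=; have := ln_lipschitz m0 px Im.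
  rewrite -[(P t g x - _) ^+ 2]real_normK ?num_real//.
  move: `|P t g x - _| => z h; apply: (le_trans h).
  rewrite -subr_ge0 (_ : _ - _ = (m^-1 * z - e) ^+ 2 / (2 * e)).
    by rewrite divr_ge0 ?sqr_ge0// mulr_ge0// ltW.
  by field; rewrite !gt_eqF.
rewrite IntD; [|exact/bddZ/bddZ|exact: bdd_cst].
rewrite Int_cst IntZ; last exact: bddZ.
rewrite IntZ//.
apply: (@le_trans _ _ ((2 * e)^-1 * (m ^- 2 * (e * m) ^+ 2) + e / 2)).
  by rewrite lerD2r ler_wpM2l ?invr_ge0 ?mulr_ge0 ?(ltW e0)// ler_wpM2l// invr_ge0 sqr_ge0.
by rewrite le_eqVlt; apply/orP; left; apply/eqP; field; rewrite !gt_eqF.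
Unshelve. all: by end_near.
Qed.

End MarkovDiffusion.

Lemma exists_scale (R : realType) (C alpha : R) : 0 < C -> C < alpha ->
  exists2 s : R, 1 < s & alpha = s ^+ 2 * C /\ s = Num.sqrt (alpha / C).
Proof.
move=> C0 Ca; have a0 := lt_trans C0 Ca.
exists (Num.sqrt (alpha / C)).
  by rewrite -[ltLHS]sqrtr1 ltr_sqrt ?divr_gt0// ltr_pdivlMr// mul1r.
by split => //; rewrite sqr_sqrtr ?divfK ?gt_eqF// divr_ge0// ltW.
Qed.

Theorem theorem3p1 (R : realType) (d : measure_display) (T : measurableType d)
    (mu : probability T R) (P : R -> (T -> R) -> T -> R)
    (L : (T -> R) -> T -> R) (A : set (T -> R)) (rho : R)
    (P_markov : markov_semigroup mu P)
    (L_generator : is_generator mu P L)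
    (L_self_adjoint : self_adjoint mu (generator_domain mu P) L)
    (A_admissible : admissible_class mu P L A)
    (L_diffusion : diffusion mu L A)
    (rho_gt0 : 0 < rho)
    (L_curvature : curvature mu L A rho) :
  (forall (f : T -> R) (t alpha : R), A f -> 0 < t ->
     (expR (2 * rho * t) + expR (- (2 * rho * t)) - 2) /
       (2 * rho * (expR (2 * rho * t) - 1)) < alpha ->
     {ae mu, forall x,
       ln (P t (fun y => expR (f y)) x) - P t f x <=
       c_ rho alpha t * ln (P t (fun y => expR (alpha * Gamma L f f y)) x)}) /\
  (forall (f : T -> R) (alpha : R), A f -> 1 / (2 * rho) < alpha ->
     (\int[mu]_x (f x)%:E = 0)%E ->
     (\int[mu]_x (expR (f x))%:E <=
      (\int[mu]_x (expR (alpha * Gamma L f f x))%:E) `^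
        (1 / (2 * Num.sqrt (2 * rho * alpha)) *
         ln ((Num.sqrt (2 * rho * alpha) + 1) /
             (Num.sqrt (2 * rho * alpha) - 1))))%E).
Proof.
have C_gt0 t : 0 < t -> 0 < (1 - expR (- (2 * rho * t))) / (2 * rho).
  by move=> t0; rewrite divr_gt0 ?mulr_gt0// subr_gt0 expR_lt1 oppr_lt0 !mulr_gt0.
(* In terms of s the constant has no exceptional values. The second inequality uses this form, as
   the exceptional [alpha] varies with t. *)
have main := herbst P_markov L_generator L_self_adjoint A_admissible L_diffusion
  rho_gt0 L_curvature.
split=> [f t alpha Af t0|f alpha Af].
  rewrite threshold_E// => Ca; have [s s1 [aE _]] := exists_scale (C_gt0 t t0) Ca.
  with_ae (main f t alpha s Af t0 s1 aE); apply: aeW => x.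
  by rewrite {2}aE c_E.
rewrite div1r => aC Intf.
have r0 : 0 < 2 * rho by exact: mulr_gt0.
have alpha0 : 0 < alpha by rewrite (lt_trans _ aC)// invr_gt0.
have AG : A (Gamma L f f) := A_Gamma A_admissible Af Af.
have Bf := A_bdd A_admissible Af; have BG := A_bdd A_admissible AG.
have expA g : A g -> A (fun x => expR (g x)) by exact: (A_app A_admissible exp_jet).
have Ae := expA _ Af; have AeG := expA _ (A_scale A_admissible alpha AG).
have Be := A_bdd A_admissible Ae; have BeG := A_bdd A_admissible AeG.
have low g : bdd mu g -> exists2 m : R, 0 < m & {ae mu, forall x, m <= expR (g x)}.
  move=> Bg; have [m m0 /(_ 1)] := exp_lower_bound Bg; rewrite in_itv/= ler01 lexx => /(_ isT) h.
  by exists m => //; with_ae h; apply: aeW => x; rewrite mul1r.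
have [m m0 em] := low _ Bf; have [m' m'0 eGm] := low _ (bddZ alpha BG).
have pos g c : 0 < c -> bdd mu g -> {ae mu, forall x, c <= g x} -> 0 < Int mu g.
  move=> c0 Bg cg; rewrite (lt_le_trans c0)// -[leLHS](Int_cst mu c).
  by apply: Int_le => //; exact: bdd_cst.
have X0 := pos _ _ m0 Be em; have Z0 := pos _ _ m'0 BeG eGm.
have If0 : Int mu f = 0 by move: Intf; rewrite IntE// => -[].
(* Invariance of [mu] is the symmetry of P_t tested against the constant 1. *)
have PI t : 0 <= t -> Int mu (P t f) = 0.
  move=> t0; have A1 := ac_cst A_admissible 1.
  have := P_symmetric P_markov L_generator L_self_adjoint A_admissible t0 A1 Af.
  rewrite (_ : (fun x => cst 1 x * P t f x) = P t f); last by apply/funext => x; rewrite mul1r.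
  move=> ->; rewrite -If0; apply: Int_eq => //.
    by apply: bddM => //; exact: (bddP P_markov t0 (bdd_cst mu 1)).
  by with_ae (ms_unit P_markov t0); apply: aeW => x ->; rewrite mul1r.
(* The parameter s belonging to time t, which tends to sqrt (2 rho alpha). *)
pose S t := Num.sqrt (alpha / ((1 - expR (- (2 * rho * t))) / (2 * rho))).
pose s := Num.sqrt (2 * rho * alpha).
have s1 : 1 < s.
  by rewrite /s -[ltLHS]sqrtr1 ltr_sqrt ?mulr_gt0// -ltr_pdivrMl// mulr1.
have cS : S t @[t --> +oo] --> s.
  rewrite /s (_ : 2 * rho * alpha = alpha / ((1 - 0) / (2 * rho))); last first.
    by field; rewrite gt_eqF.
  apply: (@continuous_cvg _ _ _ _ _
    (fun t => alpha / ((1 - expR (- (2 * rho * t))) / (2 * rho))) Num.sqrt).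
    exact: sqrt_continuous.
  apply: cvgM; first exact: cvg_cst.
  apply: cvgV; first by rewrite subr0 mulf_neq0 ?oner_neq0// invr_neq0// gt_eqF.
  apply: cvgM; last exact: cvg_cst.
  by apply: cvgB; [exact: cvg_cst|exact: cvg_expRN_pinfty].
have cR : herbst_const (S t) * Int mu (fun x => ln (P t (fun y => expR (alpha * Gamma L f f y)) x))
    @[t --> +oo] --> herbst_const s * ln (Int mu (fun y => expR (alpha * Gamma L f f y))).
  apply: cvgM; last exact: (cvg_Int_ln P_markov A_admissible AeG m'0 eGm).
  by apply: (@continuous_cvg _ _ _ _ _ S herbst_const) => //; exact: continuous_herbst_const.
have H : ln (Int mu (fun y => expR (f y))) <=
    herbst_const s * ln (Int mu (fun y => expR (alpha * Gamma L f f y))).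
  apply: (ler_cvg_to (cvg_Int_ln P_markov A_admissible Ae m0 em) cR).
  near=> t.
  have t0 : 0 < t by near: t; exact: (nbhs_pinfty_gt (num_real _)).
  (* The threshold at every time is below 1 / (2 rho), so [alpha] is admissible for all t. *)
  have Ca : (1 - expR (- (2 * rho * t))) / (2 * rho) < alpha.
    rewrite (lt_trans _ aC)// -[ltRHS]mul1r ltr_pM2r ?invr_gt0//.
    by rewrite ltrBlDr ltrDl expR_gt0.
  have [st st1 [aE sE]] := exists_scale (C_gt0 t t0) Ca.
  have BPf := bddP P_markov (ltW t0) Bf.
  have Bl1 := bdd_ln m0 (bddP P_markov (ltW t0) Be) (P_ge P_markov (ltW t0) Be em).
  have Bl2 := bdd_ln m'0 (bddP P_markov (ltW t0) BeG) (P_ge P_markov (ltW t0) BeG eGm).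
  (* The local inequality is integrated over [mu]; the term P_t f contributes 0. *)
  rewrite -[leLHS]subr0 -(PI t (ltW t0)) -IntB// -IntZ//.
  apply: Int_le; [exact: bddB|exact: bddZ|].
  by rewrite /S -sE; exact: (main f t alpha st Af t0 st1 aE).
rewrite !IntE// poweR_EFin lee_fin /powR gt_eqF//.
by rewrite -[leLHS]lnK ?posrE// ler_expR.
Unshelve. all: by end_near.
Qed.
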